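(* Let $T>0$, $w_0\in L^2(-1,1)$, $\alpha\in C^0([0,T])$, $|q_0|<1$, $q_1\in\mathbb{R}$, $\eta^1,\eta^2\in C^0([0,T])$, and for $i=1,2$ let $(w_i,p_i)$ be a solution to the fluid-particle system (written out in the context) with the common data $w_0,\alpha,q_0,q_1$ and with right boundary datum $\eta^i$, so that $\eta^i(t)=w_i(1,t)$; set $\beta^i(t):=w_{i,x}(-1,t)$ for $t\in(0,T)$. Assume that there exist constants $\delta\in(0,1)$ and $M>0$ such that, for $i=1,2$, $|p_i(t)|\le1-\delta$ for all $t\in(0,T)$, $$\|w_i|_{Q_\ell(p_i)}\|_{W^{2,\infty}(Q_\ell(p_i))}\le M\quad\text{and}\quad \|w_i|_{Q_r(p_i)}\|_{W^{2,\infty}(Q_r(p_i))}\le M.$$ If $\beta^1=\beta^2$ in $(0,T)$, then $$\eta^1=\eta^2\quad\text{in }(0,T).$$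
   Context: For $p\in C^0([0,T])$ with $|p(t)|\le 1$ for all $t\in[0,T]$, set $$Q(p)=\{(x,t)\in\mathbb{R}^2:-1<x<1,\ x\ne p(t),\ 0<t<T\},$$ $$Q_\ell(p)=\{(x,t)\in Q(p):x<p(t)\},\qquad Q_r(p)=\{(x,t)\in Q(p):x>p(t)\}.$$ The jump of a function $f$ at $x$ is $[f](x):=\lim_{s\to0^+}f(x+s)-\lim_{s\to0^-}f(x+s)$. The fluid-particle system for $(w,p)$ with data $w_0,\alpha,\eta,q_0,q_1$ is $$\begin{cases} w_t-w_{xx}+ww_x=0, & (x,t)\in Q(p),\\ w(p(t),t)=p'(t),\quad [w_x](p(t),t)=p''(t), & t\in(0,T),\\ w(-1,t)=\alpha(t),\quad w(1,t)=\eta(t), & t\in(0,T),\\ w(x,0)=w_0(x), & x\in(-1,1),\\ p(0)=q_0,\quad p'(0)=q_1,\end{cases}$$ where $[w_x](p(t),t)$ is the jump of $w_x(\cdot,t)$ at $x=p(t)$, i.e. $[w_x](p(t),t)=(v_x-u_x)(p(t),t)$ with $u=w|_{Q_\ell(p)}$ and $v=w|_{Q_r(p)}$. Here $p\in H^2(0,T)$. The spaces $W^{2,\infty}$ are space-time Sobolev spaces. *)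

(* Defs.v *)
From HB Require Import structures.
From mathcomp Require Import all_boot all_order all_algebra.
From mathcomp Require Import all_classical all_reals all_analysis.
Set Implicit Arguments.
Unset Strict Implicit.
Unset Printing Implicit Defensive.
Import Order.TTheory GRing.Theory Num.Theory.
Import numFieldNormedType.Exports.
Local Open Scope classical_set_scope.
Local Open Scope ring_scope.

(* Points of the space-time plane are pairs z = (x, t).  The measures are the
   library's Borel-Lebesgue measures: an L^p class is given by a Borel
   representative. *)

Section OneVariable.
Context {R : realType}.
Implicit Types (U : set R) (f g phi : R -> R).

(* C_c^oo(U) *)
Definition test_fun1 U phi : Prop :=
  [/\ (forall n x, derivable (derive1n n phi) x 1),
      compact (closure [set x | phi x != 0]) &
      closure [set x | phi x != 0] `<=` U].

Definition weak_deriv1 U (k : nat) f g : Prop :=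
  [/\ locally_integrable U f, locally_integrable U g &
      forall phi, test_fun1 U phi ->
        \int[lebesgue_measure]_(x in U) (f x * derive1n k phi x) =
        (-1) ^+ k * \int[lebesgue_measure]_(x in U) (g x * phi x)].

Definition in_L2 U f : Prop := f \_ U \in Lfun lebesgue_measure 2%:E.

Definition in_Hk (k : nat) U f : Prop :=
  forall j : nat, (j <= k)%N -> exists2 g, weak_deriv1 U j f g & in_L2 U g.

Definition has_jump f (x j : R) : Prop :=
  exists l r : R, [/\ f @ x^'- --> l, f @ x^'+ --> r & j = r - l].

End OneVariable.

Section TwoVariables.
Context {R : realType}.
Implicit Types (U : set (R * R)) (f g phi : R * R -> R).

Definition leb2 := (@lebesgue_measure R \x @lebesgue_measure R)%E.

Definition partial_x f : R * R -> R := fun z => derive1 (fun x => f (x, z.2)) z.1.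
Definition partial_t f : R * R -> R := fun z => derive1 (fun t => f (z.1, t)) z.2.

Definition derivable_x f (z : R * R) : Prop :=
  derivable (fun x => f (x, z.2)) z.1 1.
Definition derivable_t f (z : R * R) : Prop :=
  derivable (fun t => f (z.1, t)) z.2 1.

Fixpoint Ck (n : nat) f : Prop :=
  continuous f /\
  (if n is m.+1 then
     [/\ (forall z, derivable_x f z), (forall z, derivable_t f z),
         Ck m (partial_x f) & Ck m (partial_t f)]
   else True).

(* C_c^oo(U) *)
Definition test_fun2 U phi : Prop :=
  [/\ (forall n, Ck n phi),
      compact (closure [set z | phi z != 0]) &
      closure [set z | phi z != 0] `<=` U].

Definition locally_integrable2 U f : Prop :=
  [/\ measurable_fun U f, open U &
      forall K, K `<=` U -> compact K -> leb2.-integrable K (EFin \o f)].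

(* g is the weak derivative of f of order a in x and b in t. *)
Definition weak_deriv2 U (a b : nat) f g : Prop :=
  [/\ locally_integrable2 U f, locally_integrable2 U g &
      forall phi, test_fun2 U phi ->
        \int[leb2]_(z in U) (f z * iter a partial_x (iter b partial_t phi) z) =
        (-1) ^+ (a + b) * \int[leb2]_(z in U) (g z * phi z)].

(* The norm of W^{k,oo}(U), +oo outside that space.  The families D are those
   of all weak derivatives of f of order at most k; they are unique up to null
   sets, so that the infimum is over a set with at most one element. *)
Definition Wkoo_norm (k : nat) U f : \bar R :=
  ereal_inf [set N : \bar R |
    exists2 D : nat -> nat -> R * R -> R,
      (forall a b, (a + b <= k)%N -> weak_deriv2 U a b f (D a b)) &
      N = (\sum_(a < k.+1) \sum_(b < k.+1 | (a + b <= k)%N)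
             Lnorm leb2 +oo (EFin \o (D a b \_ U)))%E].

End TwoVariables.

Section FluidParticle.
Context {R : realType}.
Implicit Types (T : R) (p : R -> R).

Definition Qdom T p : set (R * R) :=
  [set z | [/\ -1 < z.1 < 1, z.1 != p z.2 & 0 < z.2 < T]].
Definition Qleft T p : set (R * R) := [set z | Qdom T p z /\ z.1 < p z.2].
Definition Qright T p : set (R * R) := [set z | Qdom T p z /\ p z.2 < z.1].

(* Strong solutions.  The derivatives in the equation and p'' are weak
   derivatives; boundary, interface and initial values are one-sided limits. *)
Record fluid_particle_solution T (w0 alpha eta : R -> R) (q0 q1 : R)
    (w : R * R -> R) p : Prop := FluidParticleSolution {
  fps_p_cont : {within `[0, T], continuous p} ;
  fps_p_le1 : forall t, t \in `[0, T] -> `|p t| <= 1 ;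
  fps_p_H2 : in_Hk 2 `]0, T[ p ;
  (* w is the C^1 representative of its class on Q(p), so that w_x has
     pointwise one-sided limits. *)
  fps_repr : forall z, Qdom T p z -> {for z, continuous w} /\ derivable_x w z ;
  fps_burgers : exists wt wx wxx : R * R -> R,
    [/\ weak_deriv2 (Qdom T p) 0 1 w wt,
        weak_deriv2 (Qdom T p) 1 0 w wx,
        weak_deriv2 (Qdom T p) 2 0 w wxx &
        {ae leb2, forall z, Qdom T p z -> wt z - wxx z + w z * wx z = 0}] ;
  fps_velocity : forall t, t \in `]0, T[ ->
    [/\ derivable p t 1,
        w (x, t) @[x --> (p t)^'-] --> derive1 p t &
        w (x, t) @[x --> (p t)^'+] --> derive1 p t] ;
  fps_jump : exists2 p2 : R -> R, weak_deriv1 `]0, T[ 2 p p2 &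
    {ae @lebesgue_measure R, forall t, t \in `]0, T[ ->
       has_jump (fun x => partial_x w (x, t)) (p t) (p2 t)} ;
  fps_left : forall t, t \in `]0, T[ ->
    w (x, t) @[x --> (-1)^'+] --> alpha t ;
  fps_right : forall t, t \in `]0, T[ ->
    w (x, t) @[x --> 1^'-] --> eta t ;
  fps_init : {ae @lebesgue_measure R, forall x, x \in `]-1, 1[ ->
    w (x, t) @[t --> 0^'+] --> w0 x} ;
  fps_p0 : p 0 = q0 ;
  fps_p'0 : h^-1 * (p h - p 0) @[h --> 0^'+] --> q1
}.

End FluidParticle.

(* Main.v *)
Require Import Defs.
From HB Require Import structures.
From mathcomp Require Import all_boot all_order all_algebra.
From mathcomp Require Import all_classical all_reals all_analysis.
From mathcomp Require Import measurable_realfun ess_sup_inf.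
From mathcomp Require Import ring lra.
Import Order.TTheory GRing.Theory Num.Theory.
Import numFieldNormedType.Exports.
Local Open Scope classical_set_scope.
Local Open Scope ring_scope.
Set Implicit Arguments.
Unset Strict Implicit.
Unset Printing Implicit Defensive.

(** Data on one lateral side determine a solution of a one-dimensional parabolic
    equation.  Here the two solutions have the same trace and the same flux at x = -1,
    so they agree up to the first of the two particles; the particle law then forces the
    particles to coincide and hands over the same trace and the same flux to the fluid on
    the other side, which therefore agrees as well, up to x = 1.

    _Regularity._  On each side the weak derivatives of w of order at most two are bounded
    by N = M + 1 and the equation holds weakly.  Mollification shows that w, w_x and w_t
    exist pointwise, are bounded by N and are N-Lipschitz on rectangles, and that w_x is
    differentiable in x with w_xx = w_t + w w_x ([regular_point], [regular_lipschitz],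
    [classical_equation]).

    _Unique continuation._  The difference y = w1 - w2 satisfies
    y_t = (y_x - (w1 + w2) y / 2)_x, so its x-primitive Y, which vanishes where the Cauchy
    data are given, satisfies |Y_t - Y_xx| <= N |Y_x|.  Let v = exp(s phi) Y with
    phi = (x - m - 1)^2 / 2 - kappa (t - t0)^2 up to a constant.  Expanding the
    square of the conjugated operator gives divergence terms J_x + K_t and, for large s, a
    positive remainder ([carleman_pointwise]).  After integration in time over a
    bounded interval only x is left: the integral of J starts from zero, ends at O(s^3) and
    decreases at least like the integral of v^2, up to O(s^3).  Near a point where Y does
    not vanish v^2 grows exponentially in s, a contradiction ([carleman_uniqueness]).

    _Lateral boundary._  To start from a curve x = c(t) that is only Lipschitz, y is
    extended by zero to its left.  If d is the distance to the curve, then y = O(d^2) and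
    y_x = O(d), and comparing y at two times at distance comparable to d gives y_t = O(d).
    Hence the extension is continuously differentiable, and so are the extended flux in x
    and the primitive of y in both variables ([vanishing_right_of_curve],
    [burgers_unique_right_of_curve]).

    _Particles._  With c = -1 this gives w1 = w2 for x < min(p1, p2).  As p_i' is the trace
    of w_i, which is N-Lipschitz in x, |p1' - p2'| <= N |p1 - p2|, and p1 = p2 by Gronwall
    ([velocity_gap], [equal_path]).  The weak second derivative of the common path is the
    jump of the flux, so the right fluxes agree at almost every time, then at every time
    because w_x is Lipschitz in t ([flux_trace]).  Unique continuation with c = p finishes
    the proof ([equal_right]). *)

(** * Derivatives of functions of one variable *)

Section Calculus.
Context {R : realType}.
Implicit Types (f g : R -> R) (x : R).

Lemma is_derive_derivable f x d : is_derive x 1 f d -> derivable f x 1.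
Proof. by case. Qed.

Lemma is_derive_derive1 f x d : is_derive x 1 f d -> derive1 f x = d.
Proof. by rewrite derive1E => -[_ ->]. Qed.

Lemma derivable_is_derive f x : derivable f x 1 -> is_derive x 1 f (derive1 f x).
Proof. by move=> df; rewrite derive1E; exact: derivableP. Qed.

Lemma is_derive_ext f g x d : f =1 g -> is_derive x 1 f d -> is_derive x 1 g d.
Proof. by move=> /funext ->. Qed.

Lemma is_derive_val f x d e : d = e -> is_derive x 1 f d -> is_derive x 1 f e.
Proof. by move=> ->. Qed.

Lemma is_deriveDf f g x a b : is_derive x 1 f a -> is_derive x 1 g b ->
  is_derive x 1 (fun y => f y + g y) (a + b).
Proof. by move=> fa gb; exact: (is_deriveD fa gb). Qed.

Lemma is_deriveBf f g x a b : is_derive x 1 f a -> is_derive x 1 g b ->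
  is_derive x 1 (fun y => f y - g y) (a - b).
Proof. by move=> fa gb; exact: (is_deriveB fa gb). Qed.

Lemma is_deriveNf f x a : is_derive x 1 f a -> is_derive x 1 (fun y => - f y) (- a).
Proof. by move=> fa; exact: (is_deriveN fa). Qed.

Lemma is_deriveMf f g x a b : is_derive x 1 f a -> is_derive x 1 g b ->
  is_derive x 1 (fun y => f y * g y) (a * g x + f x * b).
Proof.
move=> fa gb; apply: is_derive_val (is_deriveM fa gb).
by rewrite addrC mulrC; congr (_ + _).
Qed.

Lemma is_deriveZf f k x a : is_derive x 1 f a ->
  is_derive x 1 (fun y => k * f y) (k * a).
Proof. by move=> fa; exact: (is_deriveZ k fa). Qed.

Lemma is_derive_affine k c x : is_derive x 1 (fun y => k * y + c) k.
Proof.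
have := is_deriveDf (is_deriveZf k (is_derive_id x (1:R))) (is_derive_cst (c:R) x (1:R)).
by apply: is_derive_val; rewrite mulr1 addr0.
Qed.

Lemma is_derive_compf f g x a b : is_derive (g x) 1 f a -> is_derive x 1 g b ->
  is_derive x 1 (fun y => f (g y)) (a * b).
Proof. by move=> fa gb; exact: (is_derive1_comp fa gb). Qed.

(** Differentiability as an inequality without division, which can be checked at
    points where the function is only estimated, such as contact points. *)
Lemma is_deriveP f x d : is_derive x 1 f d <->
  forall e : R, 0 < e -> exists2 r : R, 0 < r &
    forall h : R, `|h| < r -> `|f (x + h) - f x - d * h| <= e * `|h|.
Proof.
split=> [fd e e0|H].
  have: h^-1 *: (f (h + x) - f x) @[h --> 0^'] --> d.
    have [df <-] := fd.
    have/cvg_ex [l /= fl] := df.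
    have -> : 'D_1 f x = l.
      by apply/cvg_lim => //; move: fl; under eq_fun do rewrite [_%:A]mulr1.
    by move: fl; under eq_fun do rewrite [_%:A]mulr1.
  move=> /cvgrPdist_le/(_ e e0)[r /= r0 Hr]; exists r => // h hr.
  have [->|h0] := eqVneq h 0; first by rewrite addr0 subrr mulr0 subrr !normr0 mulr0.
  have := Hr h; rewrite /= sub0r normrN => /(_ hr h0).
  rewrite -[_ *: _]/(_ * _) (addrC h) => Hh.
  rewrite -ler_pdivrMr ?normr_gt0// -normrV ?unitfE// -normrM.
  apply: le_trans Hh; rewrite le_eqVlt; apply/orP; left; apply/eqP.
  rewrite [RHS]distrC; congr `| _ |; field.
  exact: h0.
suff K : (fun h => h^-1 *: (f (h *: 1 + x) - f x)) @ 0^' --> d.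
  by apply: DeriveDef; [apply/cvg_ex; exists d|apply/cvg_lim].
apply/cvgrPdist_le => e e0; have [r r0 Hr] := H e e0.
exists r; first exact: r0.
move=> h /=; rewrite sub0r normrN => hr h0.
have := Hr h hr; rewrite -ler_pdivrMr ?normr_gt0// -normrV ?unitfE// -normrM.
apply: le_trans; rewrite le_eqVlt; apply/orP; left; apply/eqP.
rewrite -[_ *: (_ - _)]/(_ * _) [_%:A]mulr1 (addrC h).
by rewrite distrC; congr `| _ |; field; exact: h0.
Qed.

Lemma is_derive_cont f x d : is_derive x 1 f d -> {for x, continuous f}.
Proof. by move=> [df _]; exact/differentiable_continuous/derivable1_diffP. Qed.

(** Increments of either sign occur, hence endpoints in arbitrary order. *)
Lemma MVT_sym f df (a b : R) :
  (forall x, Num.min a b <= x <= Num.max a b -> is_derive x 1 f (df x)) ->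
  exists2 c, Num.min a b <= c <= Num.max a b & f b - f a = df c * (b - a).
Proof.
wlog ab : a b / a <= b => [H|].
  have [ab|ba] := leP a b; first by have := H a b ab; rewrite (min_idPl ab) (max_idPr ab).
  move=> Hd; have := H b a (ltW ba); rewrite (min_idPl (ltW ba)) (max_idPr (ltW ba)).
  move=> /(_ Hd) [c cab E]; exists c => //.
  by rewrite -opprB E; ring.
rewrite (min_idPl ab) (max_idPr ab) => Hd.
have [||c cab E] := @MVT_segment R f df a b ab.
- by move=> x; rewrite in_itv /= => /andP[/ltW ax /ltW xb]; apply: Hd; rewrite ax.
- apply: derivable_within_continuous => x; rewrite in_itv /= => xab.
  exact: is_derive_derivable (Hd _ xab).
by exists c => //; move: cab; rewrite in_itv.
Qed.

Lemma lipschitz_of_deriv f df (a b N : R) :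
  (forall x, Num.min a b <= x <= Num.max a b -> is_derive x 1 f (df x)) ->
  (forall x, Num.min a b <= x <= Num.max a b -> `|df x| <= N) ->
  `|f b - f a| <= N * `|b - a|.
Proof.
by move=> /MVT_sym[c cab ->] H; rewrite normrM ler_wpM2r// H.
Qed.

End Calculus.

(** * Smooth cutoffs *)

Section SmoothBump.
Context {R : realType}.
Implicit Types (f g : R -> R) (x : R).

Record smooth f : Prop := Smooth {
  smooth_derivable_derive1n : forall n x, derivable (derive1n n f) x 1 }.

(** It suffices to find a class of differentiable functions that is closed under
    derivation and contains the given one. *)
Lemma smooth_coind (P : (R -> R) -> Prop) :
  (forall f, P f -> (forall x, derivable f x 1) /\ P (derive1 f)) ->
  forall f, P f -> smooth f.
Proof.
move=> H f Pf; split=> n; elim: n f Pf => [|n IH] f Pf x; first by have [] := H f Pf.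
have [_ Pf'] := H f Pf.
have -> : derive1n n.+1 f = derive1n n (derive1 f).
  by rewrite /derive1n -iterSr.
exact: IH.
Qed.

Lemma smooth_derive1 f : smooth f -> smooth (derive1 f).
Proof.
move=> [sf]; split=> n x; have := sf n.+1 x.
by rewrite /derive1n iterSr.
Qed.

Lemma smooth_derive1n f n : smooth f -> smooth (derive1n n f).
Proof. by elim: n => [//|n IH] sf; exact: smooth_derive1 (IH sf). Qed.

Lemma smooth_derivable f x : smooth f -> derivable f x 1.
Proof. by move=> [/(_ 0%N x)]. Qed.

Lemma smooth_is_derive f x : smooth f -> is_derive x 1 f (derive1 f x).
Proof. by move=> sf; exact/derivable_is_derive/smooth_derivable. Qed.

Lemma smooth_continuous f : smooth f -> continuous f.
Proof. by move=> sf x; exact: is_derive_cont (smooth_is_derive x sf). Qed.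

(** The products of two smooth functions are not closed under derivation; the algebra
    generated by the smooth functions is. *)
Inductive smooth_alg : (R -> R) -> Prop :=
| Salg_base f : smooth f -> smooth_alg f
| Salg_add f g : smooth_alg f -> smooth_alg g -> smooth_alg (fun x => f x + g x)
| Salg_mul f g : smooth_alg f -> smooth_alg g -> smooth_alg (fun x => f x * g x).

Lemma smooth_algP f : smooth_alg f -> smooth f.
Proof.
move: f; apply: smooth_coind => f.
suff H : smooth_alg f -> exists2 f', smooth_alg f' & forall x, is_derive x 1 f (f' x).
  move=> /H[f' sf' df]; split=> [x|]; first exact: is_derive_derivable (df x).
  suff -> : derive1 f = f' by [].
  by apply/funext => x; exact: is_derive_derive1 (df x).
elim=> {f} [f sf|f g _ [f' sf' df] _ [g' sg' dg]|f g sf [f' sf' df] sg [g' sg' dg]].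
- exists (derive1 f); first exact/Salg_base/smooth_derive1.
  by move=> x; exact: smooth_is_derive.
- exists (fun x => f' x + g' x); first exact: Salg_add.
  by move=> x; exact: is_deriveDf.
- exists (fun x => f' x * g x + f x * g' x).
    by apply: Salg_add; exact: Salg_mul.
  by move=> x; exact: is_deriveMf.
Qed.

Lemma smoothM f g : smooth f -> smooth g -> smooth (fun x => f x * g x).
Proof. by move=> sf sg; apply/smooth_algP/Salg_mul; exact: Salg_base. Qed.

Lemma smooth_affine f k c : smooth f -> smooth (fun x => f (k * x + c)).
Proof.
move=> sf.
suff : forall h, (exists f m, smooth f /\ h = (fun x => m * f (k * x + c))) -> smooth h.
  move=> /(_ (fun x => f (k * x + c))); apply; exists f, 1; split => //.
  by apply/funext => x; rewrite mul1r.
apply: smooth_coind => {sf f} _ [f [m [sf ->]]].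
have H x : is_derive x 1 (fun x => m * f (k * x + c)) ((m * k) * derive1 f (k * x + c)).
  have := is_deriveZf m (is_derive_compf (f:=f) (g:=fun y => k * y + c) (smooth_is_derive _ sf) (is_derive_affine k c x)).
  by apply: is_derive_val; ring.
split; first by move=> x; exact: is_derive_derivable (H x).
exists (derive1 f), (m * k); split; first exact: smooth_derive1.
by apply/funext => x; exact: is_derive_derive1 (H x).
Qed.

(** The functions p(1/x) exp(-1/x), extended by zero, are closed under derivation, the
    polynomial absorbing the negative powers of x. *)
Definition flat (p : {poly R}) x := if 0 < x then p.[x^-1] * expR (- x^-1) else 0.

Lemma monom_expR_bound n (u : R) : 0 <= u -> u ^+ n * expR (- u) <= n`!%:R.
Proof.
move=> u0; rewrite expRN ler_pdivrMr ?expR_gt0//.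
case: n => [|n]; first by rewrite expr0 fact0 mul1r -expR0 ler_expR.
have := expR_ge1Dxn n u0.
have f0 : (0 : R) < (n.+1)`!%:R by rewrite ltr0n fact_gt0.
rewrite -ler_pdivrMl// => /(le_trans _); apply.
by rewrite mulrC lerDr.
Qed.

Lemma poly_expR_bound (p : {poly R}) :
  exists2 C : R, 0 <= C & forall u, 0 <= u -> `|p.[u] * expR (- u)| <= C.
Proof.
exists (\sum_(i < size p) `|p`_i| * i`!%:R).
  by apply: sumr_ge0 => i _; rewrite mulr_ge0.
move=> u u0; rewrite horner_coef mulr_suml.
apply: le_trans (ler_norm_sum _ _ _) _; apply: ler_sum => i _.
rewrite -mulrA normrM ler_wpM2l// ger0_norm ?monom_expR_bound//.
by rewrite mulr_ge0 ?exprn_ge0 ?expR_ge0.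
Qed.

(** At the origin the exponential beats every pole, so that the difference quotient
    tends to zero. *)
Lemma flat_deriv (p : {poly R}) x : is_derive x 1 (flat p) (flat ('X ^+ 2 * (p - p^`())) x).
Proof.
rewrite {2}/flat; case: ltgtP => [x0|x0|<-].
- have H : is_derive x 1 (fun x => p.[x^-1] * expR (- x^-1))
     (('X ^+ 2 * (p - p^`())).[x^-1] * expR (- x^-1)).
    have dV : is_derive x 1 (fun x : R => x^-1) (- x^-2).
      have := @is_deriveV R id x 1 1 (lt0r_neq0 x0) (is_derive_id x 1).
      by apply: is_derive_val; exact: mulr1.
    have dp := is_derive_compf (f:=horner p) (g:=fun x => x^-1) (is_derive_poly p x^-1) dV.
    have de := is_derive_compf (f:=expR) (g:=fun x => - x^-1) (is_derive_expR (- x^-1)) (is_deriveNf dV).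
    have := is_deriveMf dp de.
    apply: is_derive_val; rewrite hornerM hornerXn hornerD hornerN.
    by rewrite exprVn; ring.
  apply: near_eq_is_derive H; near=> y; rewrite /flat ifT//; near: y; exact: lt_nbhsr.
- have H : is_derive x 1 (fun _ : R => 0 : R) 0 by exact: is_derive_cst.
  apply: near_eq_is_derive H; near=> y; rewrite /flat ifF//.
  apply/negbTE; rewrite -leNgt ltW//; near: y; exact: lt_nbhsl.
- apply/is_deriveP => e e0.
  have [C C0 HC] := poly_expR_bound ('X ^+ 2 * p).
  exists (e / (C + 1)); first by rewrite divr_gt0// ltr_pwDr.
  move=> h hr; rewrite add0r mul0r subr0 {2}/flat ltxx subr0 /flat.
  case: ifPn => h0; last by rewrite normr0 mulr_ge0// ltW.
  have := HC h^-1; rewrite invr_ge0 => /(_ (ltW h0)).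
  rewrite hornerM hornerXn -mulrA normrM ger0_norm ?exprn_ge0 ?invr_ge0 ?(ltW h0)//.
  rewrite exprVn ler_pdivrMl ?exprn_gt0// => /le_trans; apply.
  rewrite gtr0_norm// expr2 mulrAC ler_wpM2r ?(ltW h0)//.
  move: hr; rewrite gtr0_norm// ltr_pdivlMr ?ltr_pwDr// => hr.
  by apply: le_trans (ltW hr); rewrite ler_wpM2l ?(ltW h0)// lerDl.
Unshelve. all: by end_near. Qed.

Lemma flat_smooth p : smooth (flat p).
Proof.
suff : forall h, (exists p, h = flat p) -> smooth h by apply; exists p.
apply: smooth_coind => _ [q ->]; split.
  by move=> x; exact: is_derive_derivable (flat_deriv q x).
exists ('X ^+ 2 * (q - q^`())); apply/funext => x.
exact: is_derive_derive1 (flat_deriv q x).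
Qed.

(** A bump on ]a, b[ whose transition layers shrink as n grows, so that it tends to the
    indicator of the open interval. *)
Definition cutoff (n a b : R) x := flat 1 (n * (x - a)) * flat 1 (n * (b - x)).

Lemma cutoff_smooth n a b : smooth (cutoff n a b).
Proof.
rewrite /cutoff; apply: smoothM.
  have -> : (fun x => flat 1 (n * (x - a))) = (fun x => flat 1 (n * x + - (n * a))).
    by apply/funext => x; congr flat; ring.
  exact/smooth_affine/flat_smooth.
have -> : (fun x => flat 1 (n * (b - x))) = (fun x => flat 1 ((-n) * x + (n * b))).
  by apply/funext => x; congr flat; ring.
exact/smooth_affine/flat_smooth.
Qed.

Lemma flat1_itv x : 0 <= flat 1 x <= 1.
Proof.
rewrite /flat; case: ifP => [x0|_]; last by rewrite lexx ler01.
by rewrite hornerC mul1r expR_ge0 expR_le1 oppr_le0 invr_ge0 ltW.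
Qed.

Lemma cutoff_ge0 n a b x : 0 <= cutoff n a b x.
Proof. by rewrite /cutoff mulr_ge0//; have /andP[] := flat1_itv (n * (x - a)); have /andP[] := flat1_itv (n * (b - x)). Qed.

Lemma cutoff_le1 n a b x : cutoff n a b x <= 1.
Proof.
rewrite /cutoff; have /andP[? ?] := flat1_itv (n * (x - a)); have /andP[? ?] := flat1_itv (n * (b - x)).
by rewrite mulr_ile1.
Qed.

Lemma cutoff_out n a b x : 0 < n -> ~~ (a < x < b) -> cutoff n a b x = 0.
Proof.
move=> n0; rewrite negb_and -!leNgt => /orP[xa|bx]; rewrite /cutoff.
  rewrite [X in X * _]/flat ifF ?mul0r//; apply/negbTE.
  by rewrite -leNgt pmulr_rle0// subr_le0.
rewrite [X in _ * X]/flat ifF ?mulr0//; apply/negbTE.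
by rewrite -leNgt pmulr_rle0// subr_le0.
Qed.

Lemma flat1_cvg (x : R) : 0 < x -> flat 1 (n.+1%:R * x) @[n --> \oo] --> (1 : R).
Proof.
move=> x0.
have -> : (fun n : nat => flat 1 (n.+1%:R * x)) = (fun n => expR (- (n.+1%:R^-1 * x^-1))).
  by apply/funext => n; rewrite /flat ifT ?mulr_gt0// hornerC mul1r invfM.
rewrite -[X in _ --> X]expR0; apply: continuous_cvg; first exact: continuous_expR.
rewrite -[X in _ --> X]oppr0; apply: cvgN; rewrite -[X in _ --> X](mul0r x^-1).
by apply: cvgMl; exact: cvg_harmonic.
Qed.

Lemma cutoff_cvg a b x :
  cutoff n.+1%:R a b x @[n --> \oo] --> ((if a < x < b then 1 else 0) : R).
Proof.
case: ifPn => [/andP[ax xb]|xab]; last first.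
  rewrite (_ : (fun n : nat => _) = (fun=> 0)); first exact: cvg_cst.
  by apply/funext => n; rewrite cutoff_out.
rewrite -[X in _ --> X]mulr1; apply: cvgM; apply: flat1_cvg; by rewrite subr_gt0.
Qed.

End SmoothBump.

(** * Functions with vanishing integrals *)

Section IntegralZero.
Local Open Scope ereal_scope.
Context d d' (T : measurableType d) (T' : measurableType d') (R : realType).
Variable mu : {measure set T -> \bar R}.

(** The sets with vanishing integral form a Dynkin system.  The map f allows to treat
    one coordinate of the plane at a time. *)
Lemma integral0_dynkin (f : T -> T') (D : set T) (g : T -> \bar R) (G : set (set T')) :
  measurable_fun setT f -> measurable D -> mu.-integrable D g ->
  @measurable _ T' = <<s G >> -> setI_closed G ->
  \int[mu]_(x in D) g x = 0 ->
  (forall A, G A -> \int[mu]_(x in D `&` f @^-1` A) g x = 0) ->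
  forall A, measurable A -> \int[mu]_(x in D `&` f @^-1` A) g x = 0.
Proof.
move=> mf mD ig GE GI D0 G0 A mA.
have mpre B : measurable B -> measurable (D `&` f @^-1` B).
  by move=> mB; apply: measurableI => //; rewrite -[X in measurable X]setTI; exact: mf.
have ipre B : measurable B -> mu.-integrable (D `&` f @^-1` B) g.
  by move=> mB; apply: integrableS ig => //; exact: mpre.
pose P := [set B : set T' | \int[mu]_(x in D `&` f @^-1` B) g x = 0].
suff : P A by [].
apply: (@dynkin_induction _ T' G P) => //; last by rewrite -GE.
- by rewrite /P /= preimage_setT setIT.
- move=> B mB PB; rewrite /P /=.
  have := integral_setU mu (mpre _ mB) (mpre _ (measurableC mB)).
  rewrite -setIUr -preimage_setU setUv preimage_setT setIT => /(_ g).
  rewrite D0 PB add0e => -> //; first exact: measurable_int ig.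
  by apply/disj_setPRL => x [Dx Bx] [_]; exact.
- move=> F mF tF PF; rewrite /P /= preimage_bigcup setI_bigcupr integral_bigcup.
  + by apply: eseries0 => n _ _; exact: PF.
  + by move=> i j _ _ [x [[_ fi] [_ fj]]]; apply: tF => //; exists (f x).
  + by move=> k; exact: mpre.
  + by rewrite -setI_bigcupr -preimage_bigcup; apply: ipre; exact: bigcup_measurable.
Qed.

Lemma integral0_ae_eq0 (D : set T) (g : T -> \bar R) :
  measurable D -> mu.-integrable D g ->
  (forall A, measurable A -> \int[mu]_(x in D `&` A) g x = 0) ->
  ae_eq mu D g (cst 0).
Proof.
move=> mD ig H; apply: integral_ae_eq => // E ED mE.
by rewrite integral_cst// mul0e -(setIidr ED) H.
Qed.

End IntegralZero.

(** * Rectangles and product test functions *)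

Lemma Rintegral_support {R : realType} d (T : measurableType d) (nu : {measure set T -> \bar R}) (f : T -> R)
    (U V : set T) : (forall z, U z -> ~ V z -> f z = 0) ->
  V `<=` U -> \int[nu]_(z in U) f z = \int[nu]_(z in V) f z.
Proof.
move=> H VU; rewrite Rintegral_mkcond [RHS]Rintegral_mkcond; congr (Rintegral _ _ _).
apply/funext => z; rewrite !patchE.
have [Uz|Uz] := boolP (z \in U); have [Vz|Vz] := boolP (z \in V) => //.
- by rewrite H//; [exact/set_mem|move=> Vz'; move: Vz; rewrite mem_set].
- by move: Uz; rewrite mem_set//; exact/VU/set_mem.
Qed.

Section Boxes.
Context {R : realType}.
Implicit Types (a b : R -> R) (U : set (R * R)).

Definition box (x1 x2 t1 t2 : R) : set (R * R) := `[x1, x2] `*` `[t1, t2].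
Definition obox (x1 x2 t1 t2 : R) : set (R * R) := `]x1, x2[ `*` `]t1, t2[.

Lemma boxP x1 x2 t1 t2 z : box x1 x2 t1 t2 z <-> x1 <= z.1 <= x2 /\ t1 <= z.2 <= t2.
Proof. by rewrite /box /= !in_itv. Qed.

Lemma oboxP x1 x2 t1 t2 z : obox x1 x2 t1 t2 z <-> x1 < z.1 < x2 /\ t1 < z.2 < t2.
Proof. by rewrite /obox /= !in_itv. Qed.

Lemma box_compact x1 x2 t1 t2 : compact (box x1 x2 t1 t2).
Proof. by apply: compact_setX; exact: segment_compact. Qed.

Lemma box_measurable x1 x2 t1 t2 : measurable (box x1 x2 t1 t2).
Proof. by apply: measurableX; exact: measurable_itv. Qed.

Lemma obox_measurable x1 x2 t1 t2 : measurable (obox x1 x2 t1 t2).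
Proof. by apply: measurableX; exact: measurable_itv. Qed.

Lemma box_closed x1 x2 t1 t2 : closed (box x1 x2 t1 t2).
Proof.
apply: compact_closed; last exact: box_compact.
exact: norm_hausdorff.
Qed.

Lemma obox_sub x1 x2 t1 t2 : obox x1 x2 t1 t2 `<=` box x1 x2 t1 t2.
Proof.
by move=> z /oboxP[/andP[/ltW a /ltW b] /andP[/ltW c /ltW d]]; apply/boxP; rewrite a b c d.
Qed.

Definition tensor a b : R * R -> R := fun z => a z.1 * b z.2.

Definition supp_in (a : R -> R) (x1 x2 : R) := forall x, ~~ (x1 <= x <= x2) -> a x = 0.

Lemma partial_x_tensor a b : smooth a -> partial_x (tensor a b) = tensor (derive1 a) b.
Proof.
move=> sa; apply/funext => z; rewrite /partial_x /tensor /=.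
have := is_deriveMf (smooth_is_derive z.1 sa) (is_derive_cst (b z.2) z.1 1).
by move/is_derive_derive1 ->; rewrite mulr0 addr0.
Qed.

Lemma partial_t_tensor a b : smooth b -> partial_t (tensor a b) = tensor a (derive1 b).
Proof.
move=> sb; apply/funext => z; rewrite /partial_t /tensor /=.
by have /is_derive_derive1 -> := is_deriveZf (a z.1) (smooth_is_derive z.2 sb).
Qed.

Lemma iter_partial_tensor a b i j : smooth a -> smooth b ->
  iter i partial_x (iter j partial_t (tensor a b)) = tensor (derive1n i a) (derive1n j b).
Proof.
move=> sa sb.
have -> : iter j partial_t (tensor a b) = tensor a (derive1n j b).
  elim: j => [//|j IH]; rewrite iterS IH derive1nS.
  exact: (partial_t_tensor a (@smooth_derive1n R b j sb)).
elim: i => [//|i IH]; rewrite iterS IH derive1nS.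
exact: (partial_x_tensor (derive1n j b) (@smooth_derive1n R a i sa)).
Qed.

Lemma tensor_continuous a b : smooth a -> smooth b -> continuous (tensor a b).
Proof.
move=> sa sb z; apply: cvgM.
  by apply: (@continuous_comp _ _ _ fst a); [exact: cvg_fst|exact: smooth_continuous].
by apply: (@continuous_comp _ _ _ snd b); [exact: cvg_snd|exact: smooth_continuous].
Qed.

Lemma tensor_Ck n a b : smooth a -> smooth b -> Ck n (tensor a b).
Proof.
elim: n a b => [|n IH] a b sa sb; split; [exact: tensor_continuous|by []|exact: tensor_continuous|].
split.
- move=> z; rewrite /derivable_x /tensor /=.
  by apply: is_derive_derivable (is_deriveMf (smooth_is_derive z.1 sa) (is_derive_cst (b z.2) z.1 1)).
- move=> z; rewrite /derivable_t /tensor /=.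
  exact: is_derive_derivable (is_deriveZf (a z.1) (smooth_is_derive z.2 sb)).
- by rewrite (partial_x_tensor b sa); apply: IH sb; exact: smooth_derive1.
- by rewrite (partial_t_tensor a sb); apply: IH; [exact: sa|exact: smooth_derive1].
Qed.

Lemma tensor_out a b x1 x2 t1 t2 z : supp_in a x1 x2 -> supp_in b t1 t2 ->
  ~ box x1 x2 t1 t2 z -> tensor a b z = 0.
Proof.
move=> Ha Hb /boxP; rewrite /tensor.
have [zx|/Ha->] := boolP (x1 <= z.1 <= x2); last by rewrite mul0r.
have [zt|/Hb->] := boolP (t1 <= z.2 <= t2); last by rewrite mulr0.
by move=> [].
Qed.

Lemma tensor_test a b x1 x2 t1 t2 U : smooth a -> smooth b ->
  supp_in a x1 x2 -> supp_in b t1 t2 -> box x1 x2 t1 t2 `<=` U ->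
  test_fun2 U (tensor a b).
Proof.
move=> sa sb Ha Hb BU.
have sub : closure [set z | tensor a b z != 0] `<=` box x1 x2 t1 t2.
  rewrite closureE => z; apply; split; first exact: box_closed.
  by move=> y /=; apply: contraPP => /(tensor_out Ha Hb) ->; rewrite eqxx.
split.
- by move=> n; exact: tensor_Ck.
- apply: (subclosed_compact _ (@box_compact x1 x2 t1 t2) sub).
  exact: closed_closure.
- exact: subset_trans sub BU.
Qed.

(** Only product test functions are used below; they confine the weak derivative to a
    rectangle, on which all the functions involved are integrable. *)
Lemma weak_deriv2_box U i j f g a b x1 x2 t1 t2 : weak_deriv2 U i j f g ->
  smooth a -> smooth b ->
  supp_in a x1 x2 -> supp_in b t1 t2 -> box x1 x2 t1 t2 `<=` U ->
  \int[leb2]_(z in box x1 x2 t1 t2) (f z * tensor (derive1n i a) (derive1n j b) z) =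
  (-1) ^+ (i + j) * \int[leb2]_(z in box x1 x2 t1 t2) (g z * tensor a b z).
Proof.
move=> [_ _ H] sa sb Ha Hb BU.
have Hd c y1 y2 n : supp_in c y1 y2 -> supp_in (derive1n n c) y1 y2.
  elim: n c => [//|n IH] c Hc.
  have -> : derive1n n.+1 c = derive1n n (derive1 c) by rewrite /derive1n -iterSr.
  apply: IH => x; rewrite negb_and -!ltNge => xy.
  suff : is_derive x 1 c 0 by exact: is_derive_derive1.
  have H0 : is_derive x (1 : R) (cst 0 : R -> R) (0 : R) by exact: is_derive_cst.
  apply: near_eq_is_derive H0.
  case/orP: xy => xy.
    near=> y; rewrite Hc// negb_and -!ltNge; apply/orP; left.
    by near: y; exact: lt_nbhsl.
  near=> y; rewrite Hc// negb_and -!ltNge; apply/orP; right.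
  by near: y; exact: lt_nbhsr.
have := H _ (tensor_test sa sb Ha Hb BU); rewrite iter_partial_tensor//.
rewrite (@Rintegral_support _ _ _ leb2 _ U (box x1 x2 t1 t2))//; last first.
  by move=> z _ nz; rewrite (tensor_out (Hd _ _ _ i Ha) (Hd _ _ _ j Hb) nz) mulr0.
rewrite [X in _ = _ * X](@Rintegral_support _ _ _ leb2 _ U (box x1 x2 t1 t2))//.
by move=> z _ nz; rewrite (tensor_out Ha Hb nz) mulr0.
Unshelve. all: by end_near. Qed.

End Boxes.

(** * The fundamental lemma of the calculus of variations *)

Section FundamentalLemma.
Context {R : realType}.

(** Dominated convergence, for cutoffs that tend to the indicator of P. *)
Lemma Rintegral_approx_indic d (T : measurableType d) (mu : {measure set T -> \bar R})
    (D P : set T) (g : T -> R) (phi : nat -> T -> R) :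
  measurable D -> measurable P -> mu.-integrable D (EFin \o g) ->
  (forall n, measurable_fun D (phi n)) -> (forall n x, `|phi n x| <= 1) ->
  (forall x, D x -> P x -> phi n x @[n --> \oo] --> (1 : R)) ->
  (forall x, D x -> ~ P x -> phi n x @[n --> \oo] --> (0 : R)) ->
  (forall n, \int[mu]_(x in D) (g x * phi n x) = 0) ->
  (\int[mu]_(x in D `&` P) (g x)%:E = 0)%E.
Proof.
move=> mD mP ig mphi phi1 cP cNP H.
have mg : measurable_fun D g by apply/measurable_EFinP; exact: measurable_int ig.
have ign n : mu.-integrable D (EFin \o (fun x => g x * phi n x)).
  have : mu.-integrable D ((EFin \o g) \* (EFin \o phi n))%E.
    apply: integrableMl => //.
    by exists 1; split => // M M1 x _; apply: le_trans (phi1 n x) (ltW M1).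
  by apply: eq_integrable => // x _; rewrite /= EFinM.
have E0 n : (\int[mu]_(x in D) (g x * phi n x)%:E = 0)%E.
  have := congr1 EFin (H n); rewrite /Rintegral fineK//.
  exact: integrable_fin_num (ign n).
have lim : (\int[mu]_(x in D) (g x * phi n x)%:E)%E @[n --> \oo] -->
           (\int[mu]_(x in D) ((EFin \o g) \_ P) x)%E.
  apply: (@dominated_cvg _ _ _ mu D mD (fun n x => (g x * phi n x)%:E)
     ((EFin \o g) \_ P) (fun x => `|g x|%:E)).
  - by move=> n; exact: measurable_int (ign n).
  - move=> x Dx; rewrite patchE; case: ifPn => xP.
      apply: cvg_EFin; first exact: nearW.
      rewrite -[X in _ --> X]mulr1; apply: cvgM; first exact: cvg_cst.
      by apply: cP => //; exact: set_mem.
    apply: cvg_EFin; first exact: nearW.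
    rewrite -[X in _ --> X](mulr0 (g x)); apply: cvgM; first exact: cvg_cst.
    by apply: cNP => // Px; move: xP; rewrite mem_set.
  - by [].
  - exact: integrable_abse ig.
  - move=> n x Dx; rewrite /= lee_fin normrM -[leRHS]mulr1 ler_wpM2l//.
rewrite integral_mkcondr.
move: lim; under eq_fun do rewrite E0.
by move/cvg_lim => <-//; apply: lim_cst.
Qed.

Lemma setI_closed_opens : setI_closed (@RGenOpens.G R).
Proof.
move=> _ _ [x [y ->]] [u [v ->]]; exists (Num.max x u), (Num.min y v).
apply/seteqP; split => z /=; rewrite !in_itv /= gt_max lt_min.
  by move=> [/andP[-> ->] /andP[-> ->]].
by move=> /andP[/andP[-> ->] /andP[-> ->]].
Qed.

Lemma integral0_dynkin_opens d (T : measurableType d) (mu : {measure set T -> \bar R})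
    (f : T -> measurableTypeR R) (D : set T) (g : T -> \bar R) :
  measurable_fun setT f -> measurable D -> mu.-integrable D g ->
  (\int[mu]_(x in D) g x = 0)%E ->
  (forall u v, \int[mu]_(x in D `&` f @^-1` `]u, v[) g x = 0)%E ->
  forall A : set (measurableTypeR R), measurable A -> (\int[mu]_(x in D `&` f @^-1` A) g x = 0)%E.
Proof.
move=> mf mD ig D0 H; apply: (integral0_dynkin mf mD ig (RGenOpens.measurableE R)) => //.
  exact: setI_closed_opens.
by move=> _ [u [v ->]]; exact: H.
Qed.

Lemma cutoff_norm_le1 (n a b x : R) : `|cutoff n a b x| <= 1.
Proof. by rewrite ger0_norm ?cutoff_ge0 ?cutoff_le1. Qed.

Lemma cutoff_supp (n a b : R) : 0 < n -> supp_in (cutoff n a b) a b.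
Proof.
move=> n0 x xab; apply: cutoff_out => //; apply: contra xab => /andP[/ltW -> /ltW ->] //.
Qed.

Lemma smooth_measurable (f : R -> R) (D : set R) : smooth f -> measurable_fun D f.
Proof.
move=> sf; apply: (@measurable_funS _ _ _ _ setT) => //.
by apply: continuous_measurable_fun => x; exact: smooth_continuous.
Qed.

Lemma tensor_measurable (a b : R -> R) (D : set (R * R)) : smooth a -> smooth b ->
  measurable_fun D (tensor a b).
Proof.
move=> sa sb; apply: (@measurable_funS _ _ _ _ setT) => //; apply: measurable_funM.
  by apply: (@measurableT_comp _ _ _ _ _ _ a); [exact: smooth_measurable|exact: measurable_fst].
by apply: (@measurableT_comp _ _ _ _ _ _ b); [exact: smooth_measurable|exact: measurable_snd].
Qed.

(** Orthogonality to the cutoffs kills the integral over every subinterval, and the open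
    intervals generate the Borel sets. *)
Lemma fundamental_lemma1 (g : R -> R) (x1 x2 : R) :
  lebesgue_measure.-integrable `[x1, x2] (EFin \o g) ->
  (forall n y1 y2 : R, 0 < n -> x1 <= y1 -> y2 <= x2 ->
     \int[lebesgue_measure]_(x in `[x1, x2]) (g x * cutoff n y1 y2 x) = 0) ->
  ae_eq lebesgue_measure (`]x1, x2[%classic : set R) (EFin \o g) (cst 0%E).
Proof.
move=> ig H.
have mD : measurable (`]x1, x2[ : set R) by exact: measurable_itv.
have sD : (`]x1, x2[ : set R) `<=` `[x1, x2].
  by move=> z /=; rewrite !in_itv /= => /andP[/ltW -> /ltW ->].
have igo : lebesgue_measure.-integrable `]x1, x2[ (EFin \o g).
  by apply: integrableS ig => //; exact: measurable_itv.
have key y1 y2 : x1 <= y1 -> y2 <= x2 ->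
    (\int[lebesgue_measure]_(x in `]y1, y2[) (g x)%:E = 0)%E.
  move=> xy yx.
  have -> : (`]y1, y2[ = `[x1, x2] `&` `]y1, y2[ :> set R)%classic.
    rewrite setIidr// => z; rewrite /= !in_itv /= => /andP[a b].
    by rewrite (le_trans xy (ltW a)) (le_trans (ltW b) yx).
  apply: (@Rintegral_approx_indic _ _ lebesgue_measure _ _ g (fun n => cutoff n.+1%:R y1 y2)) => //.
  - by move=> n; apply: smooth_measurable; exact: cutoff_smooth.
  - by move=> n x; exact: cutoff_norm_le1.
  - move=> x _; rewrite /= in_itv /= => xy12; have := @cutoff_cvg R y1 y2 x.
    by rewrite xy12.
  - move=> x _; rewrite /= in_itv /= => /negP/negbTE xy12; have := @cutoff_cvg R y1 y2 x.
    by rewrite xy12.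
  - by move=> n; exact: H.
apply: integral0_ae_eq0 => // A mA.
rewrite -[A](preimage_id).
apply: (@integral0_dynkin_opens _ _ _ id) => //.
- exact: key.
- move=> u v; rewrite preimage_id.
  have -> : (`]x1, x2[ `&` `]u, v[ = `](Num.max x1 u), (Num.min x2 v)[ :> set R)%classic.
    apply/seteqP; split => z /=; rewrite !in_itv /= gt_max lt_min.
      by move=> [/andP[-> ->] /andP[-> ->]].
    by move=> /andP[/andP[-> ->] /andP[-> ->]].
  by apply: key; rewrite ?le_max ?lexx// ge_min lexx.
Qed.

(** The cutoffs give open rectangles.  One side of the rectangle is first replaced by
    an arbitrary Borel set, then the other, and Borel rectangles generate the product
    sigma-algebra. *)
Lemma fundamental_lemma2 (g : R * R -> R) (x1 x2 t1 t2 : R) :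
  leb2.-integrable (box x1 x2 t1 t2) (EFin \o g) ->
  (forall n y1 y2 s1 s2 : R, 0 < n -> x1 <= y1 -> y2 <= x2 -> t1 <= s1 -> s2 <= t2 ->
     \int[leb2]_(z in box x1 x2 t1 t2) (g z * tensor (cutoff n y1 y2) (cutoff n s1 s2) z) = 0) ->
  ae_eq leb2 (obox x1 x2 t1 t2) (EFin \o g) (cst 0%E).
Proof.
move=> ig H.
set D := obox _ _ _ _.
have mD : measurable D by exact: obox_measurable.
have igo : leb2.-integrable D (EFin \o g).
  by apply: integrableS ig => //; [exact: box_measurable|exact: obox_sub].
have key y1 y2 s1 s2 : x1 <= y1 -> y2 <= x2 -> t1 <= s1 -> s2 <= t2 ->
    (\int[leb2]_(z in obox y1 y2 s1 s2) (g z)%:E = 0)%E.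
  move=> xy yx ts st.
  have -> : obox y1 y2 s1 s2 = box x1 x2 t1 t2 `&` obox y1 y2 s1 s2.
    rewrite setIidr// => z /oboxP[/andP[a b] /andP[c d]]; apply/boxP.
    by rewrite (le_trans xy (ltW a)) (le_trans (ltW b) yx) (le_trans ts (ltW c)) (le_trans (ltW d) st).
  apply: (@Rintegral_approx_indic _ _ leb2 _ _ g
    (fun n => tensor (cutoff n.+1%:R y1 y2) (cutoff n.+1%:R s1 s2))) => //.
  - exact: box_measurable.
  - exact: obox_measurable.
  - by move=> n; apply: tensor_measurable; exact: cutoff_smooth.
  - move=> n z; rewrite /tensor normrM mulr_ile1//; exact: cutoff_norm_le1.
  - move=> z _ /oboxP[z1 z2].
    rewrite -[X in _ --> X]mulr1; apply: cvgM.
      by have := @cutoff_cvg R y1 y2 z.1; rewrite z1.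
    by have := @cutoff_cvg R s1 s2 z.2; rewrite z2.
  - move=> z _ nz.
    have c1 := @cutoff_cvg R y1 y2 z.1; have c2 := @cutoff_cvg R s1 s2 z.2.
    have := cvgM c1 c2 _.
    suff -> : (if y1 < z.1 < y2 then 1 else 0) * (if s1 < z.2 < s2 then 1 else 0) = 0 :> R by apply.
    case: ifPn => h1; last by rewrite mul0r.
    case: ifPn => h2; last by rewrite mulr0.
    by exfalso; apply: nz; apply/oboxP.
  - by move=> n; exact: H.
have clip y1 y2 s1 s2 : D `&` (`]y1, y2[ `*` `]s1, s2[) =
    obox (Num.max x1 y1) (Num.min x2 y2) (Num.max t1 s1) (Num.min t2 s2).
  apply/seteqP; split => z.
    move=> [/oboxP[/andP[a b] /andP[c d]] /oboxP[/andP[a' b'] /andP[c' d']]].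
    by apply/oboxP; rewrite !gt_max !lt_min a b c d a' b' c' d'.
  move=> /oboxP; rewrite !gt_max !lt_min.
  move=> [/andP[/andP[a b] /andP[c d]] /andP[/andP[a' b'] /andP[c' d']]].
  by split; apply/oboxP; rewrite ?a ?b ?c ?d ?a' ?b' ?c' ?d'.
have key2 y1 y2 s1 s2 : (\int[leb2]_(z in D `&` (`]y1, y2[ `*` `]s1, s2[)) (g z)%:E = 0)%E.
  by rewrite clip; apply: key; rewrite ?le_max ?lexx// ge_min lexx.
have D0 : (\int[leb2]_(z in D) (g z)%:E = 0)%E by exact: key.
have step1 s1 s2 A : measurable A ->
    (\int[leb2]_(z in D `&` (A `*` `]s1, s2[)) (g z)%:E = 0)%E.
  move=> mA.
  have -> : D `&` (A `*` `]s1, s2[) = (D `&` (snd @^-1` `]s1, s2[)) `&` fst @^-1` A.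
    by apply/seteqP; split=> [z [? [? ?]]|z [[? ?] ?]]; split.
  have mD2 : measurable (D `&` snd @^-1` `]s1, s2[).
    apply: measurableI => //; rewrite -[X in measurable X]setTI.
    by apply: measurable_snd => //; exact: measurable_itv.
  apply: (@integral0_dynkin_opens _ _ _ fst) => //.
  - by apply: integrableS igo.
  - have := key2 x1 x2 s1 s2; congr (integral _ _ _ = _).
    apply/seteqP; split => [z [Dz [_ ?]]|z [Dz ?]]; split => //; split => //.
    by case: Dz.
  - move=> u v; have := key2 u v s1 s2; congr (integral _ _ _ = _).
    by apply/seteqP; split=> [z [? [? ?]]|z [[? ?] ?]]; split.
have step2 A B : measurable A -> measurable B ->
    (\int[leb2]_(z in D `&` (A `*` B)) (g z)%:E = 0)%E.
  move=> mA mB.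
  have -> : D `&` (A `*` B) = (D `&` (fst @^-1` A)) `&` snd @^-1` B.
    by apply/seteqP; split=> [z [? [? ?]]|z [[? ?] ?]]; split.
  have mD2 : measurable (D `&` fst @^-1` A).
    apply: measurableI => //; rewrite -[X in measurable X]setTI.
    by apply: measurable_fst.
  apply: (@integral0_dynkin_opens _ _ _ snd) => //.
  - by apply: integrableS igo.
  - have := step1 t1 t2 A mA; congr (integral _ _ _ = _).
    apply/seteqP; split => [z [Dz [? _]]|z [Dz ?]]; split => //; split => //.
    by case: Dz.
  - move=> u v; have := step1 u v A mA; congr (integral _ _ _ = _).
    by apply/seteqP; split=> [z [? [? ?]]|z [[? ?] ?]]; split.
apply: integral0_ae_eq0 => // A mA.
rewrite -[A](preimage_id).
apply: (@integral0_dynkin _ _ _ _ _ _ id _ _ [set A `*` B | A in measurable & B in measurable]) => //.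
- exact: measurable_prod_measurableType.
- move=> _ _ [A1 mA1 [B1 mB1 <-]] [A2 mA2 [B2 mB2 <-]].
  exists (A1 `&` A2); first exact: measurableI.
  by exists (B1 `&` B2); [exact: measurableI|rewrite setXI].
- by move=> _ [A1 mA1 [B1 mB1 <-]]; rewrite preimage_id; exact: step2.
Qed.

End FundamentalLemma.

(** * Mollification *)

Section Mollifier.
Context {R : realType}.
Local Notation mu := (@lebesgue_measure R).

Lemma smooth_cst (c : R) : smooth (fun _ : R => c).
Proof.
suff : forall h, (exists c : R, h = fun _ : R => c) -> smooth h by apply; exists c.
apply: smooth_coind => _ [k ->]; split; first by move=> x; exact: derivable_cst.
by exists 0; apply/funext => x; exact: is_derive_derive1 (is_derive_cst k x 1).
Qed.

Lemma smoothZ (k : R) (f : R -> R) : smooth f -> smooth (fun x => k * f x).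
Proof. by move=> sf; apply: smoothM sf; exact: smooth_cst. Qed.

Definition shiftf (a : R -> R) (c x : R) := a (x - c).

Lemma smooth_shift a c : smooth a -> smooth (shiftf a c).
Proof.
move=> sa; have -> : shiftf a c = fun x => a (1 * x + - c).
  by apply/funext => x; rewrite /shiftf mul1r.
exact: smooth_affine.
Qed.

Lemma derive1_shift a c : smooth a -> derive1 (shiftf a c) = shiftf (derive1 a) c.
Proof.
move=> sa; apply/funext => x; apply: is_derive_derive1.
have := is_derive_compf (f := a) (g := fun x => 1 * x + - c) (smooth_is_derive _ sa) (is_derive_affine 1 (- c) x).
move/is_derive_val => /(_ (derive1 a (x - c))); rewrite mulr1 mul1r => /(_ erefl).
by apply: is_derive_ext => y; rewrite mul1r.
Qed.

Lemma derive1n_shift n a c : smooth a -> derive1n n (shiftf a c) = shiftf (derive1n n a) c.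
Proof.
move=> sa; elim: n => [//|n IH]; rewrite derive1nS IH.
exact: derive1_shift (@smooth_derive1n R a n sa).
Qed.

Lemma supp_shift a c (x1 x2 : R) : supp_in a x1 x2 -> supp_in (shiftf a c) (x1 + c) (x2 + c).
Proof. by move=> Ha x xx; apply: Ha; rewrite lerBrDr lerBlDr. Qed.

Lemma supp_in_sub a (x1 x2 y1 y2 : R) : supp_in a x1 x2 -> y1 <= x1 -> x2 <= y2 -> supp_in a y1 y2.
Proof.
move=> Ha yx xy x nx; apply: Ha; apply: contra nx => /andP[u v].
by rewrite (le_trans yx u) (le_trans v xy).
Qed.

Lemma supp_derive1n n a (x1 x2 : R) : supp_in a x1 x2 -> supp_in (derive1n n a) x1 x2.
Proof.
move=> Ha; elim: n => [//|n IH] x nx.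
have -> : derive1n n.+1 a x = derive1 (derive1n n a) x by rewrite derive1nS.
move: nx; rewrite negb_and -!ltNge => xy.
suff : is_derive x 1 (derive1n n a) 0 by exact: is_derive_derive1.
have H0 : is_derive x (1 : R) (cst 0 : R -> R) (0 : R) by exact: is_derive_cst.
apply: near_eq_is_derive H0.
case/orP: xy => xy.
  near=> y; rewrite IH// negb_and -!ltNge; apply/orP; left.
  by near: y; exact: lt_nbhsl.
near=> y; rewrite IH// negb_and -!ltNge; apply/orP; right.
by near: y; exact: lt_nbhsr.
Unshelve. all: by end_near. Qed.

Lemma supp_bounded a (x1 x2 : R) : smooth a -> supp_in a x1 x2 ->
  exists2 C : R, 0 <= C & forall x, `|a x| <= C.
Proof.
move=> sa Ha; have [x12|x21] := leP x1 x2; last first.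
  exists 0 => // x; rewrite Ha ?normr0//.
  by apply/negP => /andP[u v]; have := le_lt_trans (le_trans u v) x21; rewrite ltxx.
have cont : {within `[x1, x2], continuous (fun x => `|a x|)}.
  apply: continuous_subspaceT => x; apply: (@continuous_comp _ _ _ a).
    exact: smooth_continuous.
  exact: norm_continuous.
have [c _ Hc] := EVT_max x12 cont.
exists `|a c| => // x.
have [xi|/Ha->] := boolP (x1 <= x <= x2); last by rewrite normr0.
by apply: Hc; rewrite in_itv.
Qed.

Lemma flat1_homo (x y : R) : x <= y -> flat 1 x <= flat 1 y.
Proof.
rewrite /flat => xy; case: ifPn => x0.
  rewrite ifT ?(lt_le_trans x0 xy)// !hornerC !mul1r ler_expR lerN2.
  by rewrite lef_pV2// posrE// (lt_le_trans x0 xy).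
by case: ifPn => y0; rewrite ?lexx// hornerC mul1r expR_ge0.
Qed.

(** The mass of the bump is positive and finite, which is what normalization needs. *)
Lemma cutoff_mass (e : R) : 0 < e ->
  exists2 m : R, 0 < m & (\int[mu]_x (cutoff 1 (- e) e x)%:E = m%:E)%E.
Proof.
move=> e0; set f := cutoff 1 (- e) e.
have mf : measurable_fun setT f by apply: smooth_measurable; exact: cutoff_smooth.
have f0 x : 0 <= f x by exact: cutoff_ge0.
pose k := flat 1 (e / 2) * flat 1 (e / 2) : R.
have k0 : 0 < k by rewrite mulr_gt0// /flat ifT ?divr_gt0// hornerC mul1r expR_gt0.
have lo : (k%:E * e%:E <= \int[mu]_x (f x)%:E)%E.
  apply: (@le_trans _ _ (\int[mu]_(x in `[(- (e / 2))%R, (e / 2)%R]) (cst k%:E) x)%E).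
    rewrite integral_cst; last exact: measurable_itv.
    rewrite [X in (_ <= _ * X)%E](_ : _ = e%:E)//.
    have := @lebesgue_measure_itv R `[- (e / 2), (e / 2)]; rewrite /= lte_fin ifT; last by lra.
    by rewrite -EFinB opprK -splitr.
  apply: (@le_trans _ _ (\int[mu]_(x in `[(- (e / 2))%R, (e / 2)%R]) (f x)%:E)%E).
    apply: ge0_le_integral => //.
    - by move=> x _; rewrite lee_fin ltW.
    - by apply/measurable_EFinP; exact: measurable_funS mf.
    - move=> x /=; rewrite in_itv /= => /andP[x1 x2]; rewrite lee_fin /f /cutoff !mul1r.
      apply: ler_pM; rewrite ?(andP (flat1_itv _)).1//.
        by apply: flat1_homo; lra.
        by apply: flat1_homo; lra.
  apply: ge0_subset_integral => //.
  + exact/measurable_EFinP.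
  + by move=> x _; rewrite lee_fin f0.
have hi : (\int[mu]_x (f x)%:E <= (e *+ 2)%:E)%E.
  have -> : (\int[mu]_x (f x)%:E = \int[mu]_(x in `[(- e)%R, e]) (f x)%:E)%E.
    rewrite [RHS]integral_mkcond; apply: eq_integral => x _; rewrite patchE.
    case: ifPn => // xe; rewrite /f cutoff_out//.
    apply: contra xe => /andP[/ltW a /ltW b]; rewrite inE /= in_itv /= a b //.
  apply: (@le_trans _ _ (\int[mu]_(x in `[(- e)%R, e]) (cst 1%:E) x)%E).
    apply: ge0_le_integral => //.
    - by move=> x _; rewrite lee_fin f0.
    - by apply/measurable_EFinP; exact: measurable_funS mf.
    - by move=> x _; rewrite lee_fin; exact: cutoff_le1.
  rewrite integral_cst; last exact: measurable_itv.
  rewrite mul1e [X in (X <= _)%E](_ : _ = (e *+ 2)%:E)//.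
  have := @lebesgue_measure_itv R `[- e, e]; rewrite /= lte_fin ifT; last by lra.
  by rewrite -EFinB opprK mulr2n.
have fin : (\int[mu]_x (f x)%:E)%E \is a fin_num.
  apply/fin_numPlt; rewrite (le_lt_trans hi) ?ltry// andbT.
  by apply: lt_le_trans lo; rewrite -EFinM ltNyr.
exists (fine (\int[mu]_x (f x)%:E)%E); last by rewrite fineK.
rewrite -lte_fin fineK//; apply: lt_le_trans lo.
by rewrite -EFinM lte_fin mulr_gt0.
Qed.

Definition mollifier (e x : R) := (fine (\int[mu]_y (cutoff 1 (- e) e y)%:E)%E)^-1 * cutoff 1 (- e) e x.

Lemma mollifier_smooth e : smooth (mollifier e).
Proof. by apply: smoothZ; exact: cutoff_smooth. Qed.

Lemma mollifier_ge0 e x : 0 <= mollifier e x.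
Proof.
rewrite mulr_ge0 ?cutoff_ge0// invr_ge0 fine_ge0// integral_ge0// => y _.
by rewrite lee_fin cutoff_ge0.
Qed.

Lemma mollifier_out e x : ~~ (- e < x < e) -> mollifier e x = 0.
Proof. by move=> xe; rewrite /mollifier cutoff_out ?mulr0. Qed.

Lemma mollifier_supp e : supp_in (mollifier e) (- e) e.
Proof. by move=> x xe; rewrite /mollifier (cutoff_supp _ xe) ?mulr0. Qed.

Lemma mollifier_int (e c : R) : 0 < e -> (\int[mu]_x (shiftf (mollifier e) c x)%:E = 1)%E.
Proof.
move=> e0; have [m m0 Hm] := cutoff_mass e0.
have E1 : (\int[mu]_x (mollifier e x)%:E = 1)%E.
  rewrite /mollifier Hm /=.
  under eq_integral do rewrite EFinM.
  rewrite ge0_integralZl_EFin ?invr_ge0 ?(ltW m0)//.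
  - by rewrite Hm -EFinM mulVf ?gt_eqF.
  - by move=> x _; rewrite lee_fin cutoff_ge0.
  - by apply/measurable_EFinP; apply: smooth_measurable; exact: cutoff_smooth.
have dF (x : R) : is_derive x (1 : R) (fun x : R => x - c) (1 : R).
  have := is_derive_affine 1 (- c) x; apply: is_derive_ext => y; by rewrite mul1r.
have F'1 : derive1 (fun x : R => x - c) = cst 1.
  by apply/funext => x; exact: is_derive_derive1 (dF x).
rewrite -[RHS]E1 (@increasing_ge0_integration_by_substitutionT _ (fun x => x - c) (mollifier e)).
- by apply: eq_integral => x _; rewrite F'1 /= mulr1.
- by move=> x y xy; rewrite ltrD2r.
- by rewrite F'1; exact: cst_continuous.
- by rewrite F'1; exact: is_cvg_cst.
- by rewrite F'1; exact: is_cvg_cst.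
- by move=> x; exact: is_derive_derivable (dF x).
- apply/cvgrNyPle => A; near=> x; rewrite lerBlDr; near: x; by apply: nbhs_ninfty_le; rewrite num_real.
- apply/cvgryPge => A; near=> x; rewrite lerBrDr; near: x; by apply: nbhs_pinfty_ge; rewrite num_real.
- exact/smooth_continuous/mollifier_smooth.
- exact: mollifier_ge0.
Unshelve. all: by end_near. Qed.

Definition mtensor e (z0 : R * R) := tensor (shiftf (mollifier e) z0.1) (shiftf (mollifier e) z0.2).

Lemma mtensor_ge0 e z0 z : 0 <= mtensor e z0 z.
Proof. by rewrite mulr_ge0// mollifier_ge0. Qed.

Lemma mtensor_out e z0 z : ~ (`|z.1 - z0.1| < e /\ `|z.2 - z0.2| < e) -> mtensor e z0 z = 0.
Proof.
rewrite /mtensor /tensor /shiftf !ltr_norml => H.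
have [h1|/mollifier_out->] := boolP (- e < z.1 - z0.1 < e); last by rewrite mul0r.
have [h2|/mollifier_out->] := boolP (- e < z.2 - z0.2 < e); last by rewrite mulr0.
by case: H.
Qed.

Lemma mtensor_int e z0 : 0 < e -> (\int[leb2]_z (mtensor e z0 z)%:E = 1)%E.
Proof.
move=> e0.
have ms c : measurable_fun setT (shiftf (mollifier e) c).
  by apply: smooth_measurable; apply: smooth_shift; exact: mollifier_smooth.
rewrite /leb2 fubini_tonelli1.
- rewrite -[RHS](mollifier_int z0.1 e0); apply: eq_integral => x _.
  rewrite /fubini_F /mtensor /tensor /=.
  under eq_integral do rewrite EFinM.
  rewrite ge0_integralZl_EFin ?mollifier_ge0//.
  + by rewrite mollifier_int// mule1.
  + by move=> y _; rewrite lee_fin mollifier_ge0.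
  + by apply/measurable_EFinP; exact: ms.
- apply/measurable_EFinP; apply: tensor_measurable; apply: smooth_shift; exact: mollifier_smooth.
- by move=> z; rewrite lee_fin mtensor_ge0.
Qed.

End Mollifier.

Global Instance ae_leb2_filter (R : realType) : Filter (nbhs (almost_everywhere (@leb2 R))).
Proof. exact: ae_filter_ringOfSetsType. Qed.

Section Pairing.
Context {R : realType}.
Implicit Types (f g : R * R -> R) (a b : R -> R) (B : set (R * R)).

(** The convolution, at z0, of f restricted to B with the reflected kernel
    (x, t) |-> a(-x) b(-t).  The set B keeps f within its domain of integrability. *)
Definition pairing f B a b (z0 : R * R) :=
  \int[leb2]_(z in B) (f z * tensor (shiftf a z0.1) (shiftf b z0.2) z).

Lemma integrable_tensor f B a b (C : R) : measurable B -> leb2.-integrable B (EFin \o f) ->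
  smooth a -> smooth b -> (forall z, `|tensor a b z| <= C) ->
  leb2.-integrable B (EFin \o (fun z => f z * tensor a b z)).
Proof.
move=> mB fi sa sb HC.
have : leb2.-integrable B ((EFin \o f) \* (EFin \o tensor a b))%E.
  apply: integrableMl => //; first exact: tensor_measurable.
  by exists C; split; [exact: num_real|move=> M M1 x _; apply: le_trans (HC x) (ltW M1)].
by apply: eq_integrable => // x _; rewrite /= EFinM.
Qed.

Lemma is_derive_under_Rintegral f B (F : R -> R * R -> R) (dF : R -> R * R -> R) (C x : R) :
  measurable B -> leb2.-integrable B (EFin \o f) ->
  (forall x, leb2.-integrable B (EFin \o (fun z => f z * F x z))) ->
  (forall (x : R) z, is_derive x 1 (fun x => F x z) (dF x z)) ->
  (forall x z, `|dF x z| <= C) ->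
  is_derive x 1 (fun x => \int[leb2]_(z in B) (f z * F x z))
    (\int[leb2]_(z in B) (f z * dF x z)).
Proof.
move=> mB fi Fi dFF HC.
have C0 : 0 <= C by apply: le_trans (HC 0 (0, 0)).
have d1 (x' : R) z : is_derive x' 1 (fun x => f z * F x z) (f z * dF x' z).
  exact: is_deriveZf.
have p1 x' z : partial1of2 (fun x z => f z * F x z) x' z = f z * dF x' z.
  by rewrite /partial1of2; exact: is_derive_derive1 (d1 x' z).
have Ix : (`]x - 1, x + 1[%classic : set R) x by rewrite /= in_itv /=; apply/andP; split; lra.
have iG : leb2.-integrable B (EFin \o (fun z => C * `|f z|)).
  have : leb2.-integrable B (fun z => C%:E * (abse ((EFin \o f) z)))%E.
    by apply: integrableZl => //; exact: integrable_abse.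
  by apply: eq_integrable.
have G0 z : 0 <= C * `|f z| by rewrite mulr_ge0.
have GU x' z : `]x - 1, x + 1[%classic x' -> B z -> `|partial1of2 (fun x z => f z * F x z) x' z| <= C * `|f z|.
  by move=> _ _; rewrite p1 normrM mulrC ler_wpM2r.
have dd x' z : `]x - 1, x + 1[%classic x' -> B z -> derivable (fun x => f z * F x z) x' 1.
  by move=> _ _; exact: is_derive_derivable (d1 x' z).
have := @derivable_under_integral _ _ _ leb2 (fun x z => f z * F x z) B mB x (x-1) (x+1) Ix (fun x _ => Fi x) dd _ G0 iG GU.
move=> /derivable_is_derive.
rewrite (@differentiation_under_integral _ _ _ leb2 (fun x z => f z * F x z) B mB x (x-1) (x+1) Ix (fun x _ => Fi x) dd _ G0 iG GU).
by apply: is_derive_val; apply: eq_Rintegral => z _; rewrite p1.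
Qed.

Lemma shiftf_is_derive a (y x : R) : smooth a ->
  is_derive x 1 (fun x => shiftf a x y) (- shiftf (derive1 a) x y).
Proof.
move=> sa; rewrite /shiftf.
have := is_derive_compf (f := a) (g := fun x => (-1) * x + y) (smooth_is_derive _ sa) (is_derive_affine (-1) y x).
have E u : -1 * u + y = y - u by ring.
rewrite E mulrN1; apply: is_derive_ext => u; by rewrite E.
Qed.

Lemma pairing_is_derive f B a b (C : R) : measurable B -> leb2.-integrable B (EFin \o f) ->
  smooth a -> smooth b -> (forall x, `|a x| <= C) -> (forall x, `|b x| <= C) ->
  (forall x, `|derive1 a x| <= C) -> (forall x, `|derive1 b x| <= C) ->
  forall x t : R,
  is_derive x 1 (fun x => pairing f B a b (x, t)) (- pairing f B (derive1 a) b (x, t)) /\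
  is_derive t 1 (fun t => pairing f B a b (x, t)) (- pairing f B a (derive1 b) (x, t)).
Proof.
move=> mB fi sa sb Ca Cb Cda Cdb x t.
have C0 : 0 <= C by apply: le_trans (Ca 0).
have bt (c d : R -> R) y s z : (forall x, `|c x| <= C) -> (forall x, `|d x| <= C) ->
    `|tensor (shiftf c y) (shiftf d s) z| <= C * C.
  by move=> Hc Hd; rewrite normrM; apply: ler_pM => //; [exact: Hc|exact: Hd].
have it (c d : R -> R) y s : smooth c -> smooth d -> (forall x, `|c x| <= C) -> (forall x, `|d x| <= C) ->
    leb2.-integrable B (EFin \o (fun z => f z * tensor (shiftf c y) (shiftf d s) z)).
  move=> sc sd Hc Hd; apply: (integrable_tensor (C := C * C)) => //.
  - exact: smooth_shift.
  - exact: smooth_shift.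
  - by move=> z; exact: bt.
have N (c d : R -> R) : smooth c -> smooth d -> (forall x, `|c x| <= C) -> (forall x, `|d x| <= C) ->
    \int[leb2]_(z in B) (f z * - tensor (shiftf c x) (shiftf d t) z) = - pairing f B c d (x, t).
  move=> sc sd Hc Hd; rewrite /pairing -mulN1r -RintegralZl//; last exact: it.
  by apply: eq_Rintegral => z _; rewrite mulN1r mulrN.
have sda := smooth_derive1 sa. have sdb := smooth_derive1 sb.
split.
- rewrite -N//.
  apply: (@is_derive_under_Rintegral f B
    (fun y => tensor (shiftf a y) (shiftf b t)) (fun y z => - tensor (shiftf (derive1 a) y) (shiftf b t) z) (C * C)) => //.
  + by move=> y; exact: it.
  + move=> y z; rewrite /tensor -mulNr.
    have := is_deriveMf (shiftf_is_derive z.1 y sa) (is_derive_cst (shiftf b t z.2) y (1 : R)).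
    by rewrite mulr0 addr0.
  + by move=> y z; rewrite normrN; exact: bt.
- rewrite -N//.
  apply: (@is_derive_under_Rintegral f B
    (fun y => tensor (shiftf a x) (shiftf b y)) (fun y z => - tensor (shiftf a x) (shiftf (derive1 b) y) z) (C * C)) => //.
  + by move=> y; exact: it.
  + move=> y z; rewrite /tensor -mulrN.
    by have := is_deriveZf (shiftf a x z.1) (shiftf_is_derive z.2 y sb).
  + by move=> y z; rewrite normrN; exact: bt.
Qed.

(** While the kernels stay inside the rectangle, a derivative of the kernel can be
    traded for a weak derivative of the function. *)
Lemma pairing_weak U i j f g a b x1 x2 t1 t2 d z0 : weak_deriv2 U i j f g ->
  smooth a -> smooth b -> supp_in a (- d) d -> supp_in b (- d) d ->
  box x1 x2 t1 t2 `<=` U -> x1 + d <= z0.1 -> z0.1 + d <= x2 -> t1 + d <= z0.2 -> z0.2 + d <= t2 ->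
  pairing f (box x1 x2 t1 t2) (derive1n i a) (derive1n j b) z0 =
  (-1) ^+ (i + j) * pairing g (box x1 x2 t1 t2) a b z0.
Proof.
move=> wd sa sb Ha Hb BU h1 h2 h3 h4; rewrite /pairing.
rewrite -(derive1n_shift i z0.1 sa) -(derive1n_shift j z0.2 sb).
apply: (weak_deriv2_box wd) => //; try exact: smooth_shift.
- by apply: supp_in_sub (supp_shift (c := z0.1) Ha) _ _; lra.
- by apply: supp_in_sub (supp_shift (c := z0.2) Hb) _ _; lra.
Qed.

(** A weighted average of values within eta of c is within eta of c.  With c = 0 this
    bounds a mollification, with c = f z0 it proves convergence. *)
Lemma pairing_mollifier_close f x1 x2 t1 t2 (e c eta : R) z0 : 0 < e -> 0 <= eta ->
  leb2.-integrable (box x1 x2 t1 t2) (EFin \o f) ->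
  x1 + e <= z0.1 -> z0.1 + e <= x2 -> t1 + e <= z0.2 -> z0.2 + e <= t2 ->
  {ae leb2, forall z, `|z.1 - z0.1| < e -> `|z.2 - z0.2| < e -> `|f z - c| <= eta} ->
  `|pairing f (box x1 x2 t1 t2) (mollifier e) (mollifier e) z0 - c| <= eta.
Proof.
move=> e0 eta0 fi h1 h2 h3 h4 Hae.
set B := box _ _ _ _.
have mB : measurable B by exact: box_measurable.
have [C C0 HC] := supp_bounded (mollifier_smooth e) (@mollifier_supp _ e).
have mt : (fun z => tensor (shiftf (mollifier e) z0.1) (shiftf (mollifier e) z0.2) z) = mtensor e z0 by [].
have sm c' : smooth (shiftf (mollifier e) c') by apply: smooth_shift; exact: mollifier_smooth.
have bt z : `|mtensor e z0 z| <= C * C by rewrite normrM; apply: ler_pM => //; exact: HC.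
have out z : ~ B z -> mtensor e z0 z = 0.
  move=> nB; apply: mtensor_out => -[u v]; apply: nB; apply/boxP; move: u v.
  by rewrite !ltr_norml => /andP[u1 u2] /andP[v1 v2]; split; apply/andP; split; lra.
have mass : (\int[leb2]_(z in B) (mtensor e z0 z)%:E = 1)%E.
  rewrite -(mtensor_int z0 e0) integral_mkcond; apply: eq_integral => z _.
  by rewrite patchE; case: ifPn => // zB; rewrite out// => Bz; rewrite mem_set in zB.
have ifm : leb2.-integrable B (EFin \o (fun z => f z * mtensor e z0 z)).
  exact: (integrable_tensor (C := C * C)).
have im : leb2.-integrable B (EFin \o mtensor e z0).
  apply/integrableP; split; first by apply/measurable_EFinP; exact: tensor_measurable.
  rewrite (_ : \int[leb2]_(x in B) _ = \int[leb2]_(z in B) (mtensor e z0 z)%:E)%E.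
    by rewrite mass ltry.
  by apply: eq_integral => z _; rewrite /= ger0_norm ?mtensor_ge0.
have icm : leb2.-integrable B (EFin \o (fun z => c * mtensor e z0 z)).
  have : leb2.-integrable B (fun z => c%:E * (EFin \o mtensor e z0) z)%E by apply: integrableZl.
  by apply: eq_integrable.
have E : pairing f B (mollifier e) (mollifier e) z0 - c =
    \int[leb2]_(z in B) ((f z - c) * mtensor e z0 z).
  transitivity (\int[leb2]_(z in B) (f z * mtensor e z0 z - c * mtensor e z0 z)).
    by rewrite RintegralB// RintegralZl// {2}/Rintegral mass mulr1.
  by apply: eq_Rintegral => z _; rewrite mulrBl.
have ifc : leb2.-integrable B (EFin \o (fun z => (f z - c) * mtensor e z0 z)).
  have : leb2.-integrable B (fun z => (f z * mtensor e z0 z)%:E - (c * mtensor e z0 z)%:E)%E.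
    exact: integrableB.
  by apply: eq_integrable => // z _; rewrite /= mulrBl EFinB.
rewrite E -lee_fin EFin_normr_Rintegral//.
apply: le_trans (le_abse_integral _ _ _) _ => //; first by apply: measurable_int ifc.
rewrite -[leRHS]mule1 -mass -ge0_integralZl_EFin//; last 2 first.
- by move=> z _; rewrite lee_fin mtensor_ge0.
- by apply/measurable_EFinP; exact: tensor_measurable.
apply: ae_ge0_le_integral => //.
- by apply/measurableT_comp => //; exact: measurable_int ifc.
- by move=> z _; rewrite mule_ge0// lee_fin// mtensor_ge0.
- by apply: emeasurable_funM => //; apply/measurable_EFinP; exact: tensor_measurable.
- apply: filterS Hae => z Hz _; rewrite /= -EFinM lee_fin normrM (ger0_norm (mtensor_ge0 _ _ _)).
  have [zc|zc] := pselect (`|z.1 - z0.1| < e /\ `|z.2 - z0.2| < e).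
    by rewrite ler_wpM2r ?mtensor_ge0// Hz//; case: zc.
  by rewrite mtensor_out// !mulr0.
Qed.

End Pairing.

(** * Derivatives of limits *)

Section LimitDerivative.
Context {R : realType}.

Lemma cvg_le (u v : R ^nat) (l m : R) : u n @[n --> \oo] --> l -> v n @[n --> \oo] --> m ->
  (forall n, u n <= v n) -> l <= m.
Proof. by move=> ul vm uv; apply: ler_cvg_to ul vm _; exact: nearW. Qed.

(** If the derivatives are equi-Lipschitz up to a vanishing error, difference quotients
    with a small fixed step approximate them uniformly in n; since the quotients converge,
    the derivatives form a Cauchy sequence, and their limit is the derivative of the limit. *)
Lemma limit_derivative (f_ f1_ : nat -> R -> R) (f : R -> R) (e_ : nat -> R) (N a b u : R) :
  a < u < b -> 0 <= N ->
  (forall n x, a <= x <= b -> is_derive x 1 (f_ n) (f1_ n x)) ->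
  (forall n x y, a <= x <= b -> a <= y <= b -> `|f1_ n x - f1_ n y| <= N * `|x - y| + e_ n) ->
  e_ n @[n --> \oo] --> (0 : R) ->
  (forall x, a <= x <= b -> f_ n x @[n --> \oo] --> f x) ->
  exists2 g : R, is_derive u 1 f g & f1_ n u @[n --> \oo] --> g.
Proof.
move=> /andP[au ub] N0 df Lip e0 ff.
have uab : a <= u <= b by rewrite !ltW.
have key n h : a <= u + h <= b ->
    `|f_ n (u + h) - f_ n u - f1_ n u * h| <= (N * `|h| + e_ n) * `|h|.
  move=> uh.
  have [|c cab ->] := @MVT_sym _ (f_ n) (f1_ n) u (u + h).
    move=> x /andP[x1 x2]; apply: df; move: x1 x2; rewrite ge_min le_max.
    move: uab uh => /andP[? ?] /andP[? ?] /orP[] ? /orP[] ?; apply/andP; split; lra.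
  have -> : f1_ n c * (u + h - u) - f1_ n u * h = (f1_ n c - f1_ n u) * h by ring.
  rewrite normrM ler_wpM2r//.
  have cab' : a <= c <= b /\ `|c - u| <= `|h|.
    move: cab; rewrite ge_min le_max => /andP[c1 c2].
    split.
      by move: uab uh c1 c2 => /andP[? ?] /andP[? ?] /orP[] ? /orP[] ?; apply/andP; split; lra.
    rewrite ler_norml; have := ler_norm h; have := ler_norm (- h); rewrite normrN.
    by move: c1 c2 => /orP[] ? /orP[] ? ? ?; apply/andP; split; lra.
  case: cab' => cab1 cu; apply: le_trans (Lip _ _ _ cab1 uab) _.
  by rewrite lerD2r ler_wpM2l.
have [g cg] : exists g : R, f1_ n u @[n --> \oo] --> g.
  apply/cvg_ex; apply: cauchy_cvg; apply: cauchy_exP => eps eps0.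
  pose h := Num.min (b - u) (eps / 8 / (N + 1)).
  have N1 : 0 < N + 1 by lra.
  have h0 : 0 < h by rewrite lt_min subr_gt0 ub !divr_gt0.
  have hb : h <= b - u by rewrite ge_min lexx.
  have hN : N * h <= eps / 8.
    apply: (@le_trans _ _ ((N + 1) * h)); first by rewrite ler_wpM2r ?ltW// ltrDl.
    by rewrite mulrC -ler_pdivlMr// ge_min lexx orbT.
  have uh : a <= u + h <= b by apply/andP; split; lra.
  exists ((f (u + h) - f u) / h).
  have cq : (f_ n (u + h) - f_ n u) / h @[n --> \oo] --> (f (u + h) - f u) / h.
    by apply: cvgMl; apply: cvgB; exact: ff.
  have e8 : 0 < eps / 8 by rewrite divr_gt0.
  have /cvgrPdist_le/(_ _ e8) [n1 _ H1] := cq.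
  have /cvgrPdist_le/(_ _ e8) [n2 _ H2] := e0.
  exists (maxn n1 n2) => // n /=; rewrite geq_max => /andP[k1 k2].
  rewrite /ball /= (le_lt_trans (ler_distD ((f_ n (u + h) - f_ n u) / h) _ _))//.
  have := H1 n k1; have := H2 n k2; rewrite /= sub0r normrN.
  have := key n h uh; rewrite (gtr0_norm h0) => K en q1.
  have : `|(f_ n (u + h) - f_ n u) / h - f1_ n u| <= N * h + e_ n.
    have -> : (f_ n (u + h) - f_ n u) / h - f1_ n u = (f_ n (u + h) - f_ n u - f1_ n u * h) / h.
      by field; rewrite gt_eqF.
    by rewrite normf_div (gtr0_norm h0) ler_pdivrMr.
  have := ler_norm (e_ n); lra.
exists g => //; apply/is_deriveP => eps eps0.
pose r := Num.min (Num.min (u - a) (b - u)) (eps / (N + 1)).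
have N1 : 0 < N + 1 by lra.
exists r; first by rewrite !lt_min !subr_gt0 au ub divr_gt0.
move=> h; rewrite !lt_min ltr_pdivlMr// => /andP[/andP[h1 h2] h3].
have uh : a <= u + h <= b.
  by have := ler_norm h; have := ler_norm (- h); rewrite normrN => ? ?; apply/andP; split; lra.
have : `|f (u + h) - f u - g * h| <= (N * `|h| + 0) * `|h|.
  apply: (@cvg_le (fun n => `|f_ n (u + h) - f_ n u - f1_ n u * h|) (fun n => (N * `|h| + e_ n) * `|h|)).
  - apply: cvg_norm; apply: cvgB; first by apply: cvgB; exact: ff.
    exact: cvgMl.
  - by apply: cvgMl; apply: cvgD; [exact: cvg_cst|].
  - by move=> n; exact: key.
move=> /le_trans; apply; rewrite addr0 ler_wpM2r// (le_trans _ (ltW h3))//.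
by rewrite mulrC ler_wpM2l// lerDl.
Qed.

End LimitDerivative.

(** * Interior regularity from bounded weak derivatives *)

Section InteriorRegularity.
Context {R : realType}.
Variables (U : set (R * R)) (w : R * R -> R) (D : nat -> nat -> R * R -> R) (N : R).
Hypothesis N0 : 0 <= N.
Hypothesis w_cont : forall z, U z -> {for z, continuous w}.
Hypothesis w_weak : forall i j, (i + j <= 2)%N -> weak_deriv2 U i j w (D i j).
Hypothesis D_bound : forall i j, (i + j <= 2)%N -> {ae leb2, forall z, U z -> `|D i j z| <= N}.

Definition within_box (X1 X2 S1 S2 e : R) (z : R * R) :=
  [/\ X1 + e <= z.1, z.1 + e <= X2, S1 + e <= z.2 & z.2 + e <= S2].

Section OneBox.
Variables (X1 X2 S1 S2 : R).
Let B := box X1 X2 S1 S2.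
Let inn := within_box X1 X2 S1 S2.
Hypothesis BU : B `<=` U.

Lemma locally_integrable2_box f V : locally_integrable2 V f -> B `<=` V ->
  leb2.-integrable B (EFin \o f).
Proof. by move=> [_ _ H] BV; apply: H => //; exact: box_compact. Qed.

Lemma w_integrable : leb2.-integrable B (EFin \o w).
Proof. by have [li _ _] := @w_weak 0 0 isT; exact: locally_integrable2_box li BU. Qed.

Lemma D_integrable i j : (i + j <= 2)%N -> leb2.-integrable B (EFin \o D i j).
Proof. by move=> /w_weak[_ li _]; exact: locally_integrable2_box li BU. Qed.

(** The derivative, i times in x and j times in t, of the mollification of w at scale
    e; the sign undoes the reflection of the kernel. *)
Definition mollify e i j z :=
  (-1) ^+ (i + j) * pairing w B (derive1n i (mollifier e)) (derive1n j (mollifier e)) z.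

Lemma derive1n_mollifier_bounded e i : exists2 C : R, 0 <= C &
  forall x, `|derive1n i (mollifier e) x| <= C.
Proof.
apply: (@supp_bounded _ _ (- e) e); first by apply: smooth_derive1n; exact: mollifier_smooth.
by apply: supp_derive1n; exact: mollifier_supp.
Qed.

Lemma mollify_is_derive e i j (x t : R) :
  is_derive x 1 (fun x => mollify e i j (x, t)) (mollify e i.+1 j (x, t)) /\
  is_derive t 1 (fun t => mollify e i j (x, t)) (mollify e i j.+1 (x, t)).
Proof.
have [C1 C10 H1] := derive1n_mollifier_bounded e i.
have [C2 C20 H2] := derive1n_mollifier_bounded e j.
have [C3 C30 H3] := derive1n_mollifier_bounded e i.+1.
have [C4 C40 H4] := derive1n_mollifier_bounded e j.+1.
pose C := C1 + C2 + C3 + C4.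
have sm k : smooth (derive1n k (mollifier e)) by apply: smooth_derive1n; exact: mollifier_smooth.
have [||||dx dt] := @pairing_is_derive R w B (derive1n i (mollifier e)) (derive1n j (mollifier e)) C
  (box_measurable _ _ _ _) w_integrable (sm i) (sm j) _ _ _ _ x t.
- by move=> y; apply: le_trans (H1 y) _; rewrite /C; lra.
- by move=> y; apply: le_trans (H2 y) _; rewrite /C; lra.
- by move=> y; rewrite -derive1nS; apply: le_trans (H3 y) _; rewrite /C; lra.
- by move=> y; rewrite -derive1nS; apply: le_trans (H4 y) _; rewrite /C; lra.
split.
  by have := is_deriveZf ((-1) ^+ (i + j)) dx; apply: is_derive_val; rewrite /mollify addSn exprS -derive1nS; ring.
by have := is_deriveZf ((-1) ^+ (i + j)) dt; apply: is_derive_val; rewrite /mollify addnS exprS -derive1nS; ring.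
Qed.

Lemma mollify_pairing e i j f V z : 0 < e -> inn e z -> weak_deriv2 V i j w f -> B `<=` V ->
  mollify e i j z = pairing f B (mollifier e) (mollifier e) z.
Proof.
move=> egt0 [h1 h2 h3 h4] wd BV; rewrite /mollify.
rewrite (pairing_weak (d := e) wd)//; try exact: mollifier_smooth; try exact: mollifier_supp.
by rewrite mulrA -expr2 sqrr_sign mul1r.
Qed.

(** Bounds on weak derivatives survive mollification, the kernel being a probability
    density. *)
Lemma mollify_bound e i j z : 0 < e -> inn e z -> (i + j <= 2)%N -> `|mollify e i j z| <= N.
Proof.
move=> egt0 iz ij; rewrite (mollify_pairing egt0 iz (w_weak ij) BU) -[X in `|X|]subr0.
have [h1 h2 h3 h4] := iz.
apply: pairing_mollifier_close => //; first exact: D_integrable.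
apply: filterS (D_bound ij) => z' Hz u v; rewrite subr0; apply: Hz; apply: BU; apply/boxP.
by move: u v; rewrite !ltr_norml => /andP[? ?] /andP[? ?]; split; apply/andP; split; lra.
Qed.

Lemma mollify_lipx e i j (x x' t : R) : 0 < e -> inn e (x, t) -> inn e (x', t) -> (i + j <= 1)%N ->
  `|mollify e i j (x, t) - mollify e i j (x', t)| <= N * `|x - x'|.
Proof.
move=> egt0 [/= h1 h2 h3 h4] [/= h1' h2' h3' h4'] ij.
apply: (@lipschitz_of_deriv _ (fun x => mollify e i j (x, t)) (fun x => mollify e i.+1 j (x, t))).
  by move=> y _; have [] := mollify_is_derive e i j y t.
move=> y; rewrite ge_min le_max => /andP[y1 y2]; apply: mollify_bound => //.
by split => //=; move: y1 y2 => /orP[] ? /orP[] ?; lra.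
Qed.

Lemma mollify_lipt e i j (x t t' : R) : 0 < e -> inn e (x, t) -> inn e (x, t') -> (i + j <= 1)%N ->
  `|mollify e i j (x, t) - mollify e i j (x, t')| <= N * `|t - t'|.
Proof.
move=> egt0 [/= h1 h2 h3 h4] [/= h1' h2' h3' h4'] ij.
apply: (@lipschitz_of_deriv _ (fun t => mollify e i j (x, t)) (fun t => mollify e i j.+1 (x, t))).
  by move=> y _; have [] := mollify_is_derive e i j x y.
move=> y; rewrite ge_min le_max => /andP[y1 y2]; apply: mollify_bound => //; last by rewrite addnS.
by split => //=; move: y1 y2 => /orP[] ? /orP[] ?; lra.
Qed.

Lemma mollify_lip e i j z z' : 0 < e -> inn e z -> inn e z' -> (i + j <= 1)%N ->
  `|mollify e i j z - mollify e i j z'| <= N * (`|z.1 - z'.1| + `|z.2 - z'.2|).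
Proof.
move=> egt0; case: z => x t; case: z' => x' t' iz iz' ij.
have iz'' : inn e (x', t) by case: iz => /= ? ? ? ?; case: iz' => /= ? ? ? ?; split.
rewrite mulrDr; apply: le_trans (ler_distD (mollify e i j (x', t)) _ _) _.
by apply: lerD; [exact: mollify_lipx|exact: mollify_lipt].
Qed.

Variable e0 : R.
Hypothesis e0_gt0 : 0 < e0.
Definition shrink n := e0 / n.+1%:R.

Lemma shrink_gt0 n : 0 < shrink n. Proof. by rewrite divr_gt0. Qed.
Lemma shrink_le n : shrink n <= e0.
Proof. by rewrite /shrink ler_pdivrMr// ler_peMr ?ler1n//; exact: ltW. Qed.
Lemma shrink_cvg : shrink n @[n --> \oo] --> (0 : R).
Proof.
rewrite -(mulr0 e0); apply: cvgMr; exact: cvg_harmonic.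
Qed.

Lemma inn_shrink n z : inn e0 z -> inn (shrink n) z.
Proof. by have := shrink_le n => ? [? ? ? ?]; split; lra. Qed.

Lemma mollify_cvg z : inn e0 z -> mollify (shrink n) 0 0 z @[n --> \oo] --> w z.
Proof.
move=> iz; have Uz : U z.
  by have [? ? ? ?] := iz; have ? := e0_gt0; apply: BU; apply/boxP; split; apply/andP; split; lra.
apply/cvgrPdist_le => eta eta0.
have /cvgrPdist_le/(_ eta eta0) := w_cont Uz.
move=> /nbhs_ballP[r /= r0 Hr].
have [m _ Hm] : \forall n \near \oo, `|0 - shrink n| < r.
  by have /cvgrPdist_lt := shrink_cvg; apply.
exists m => // n /= mn; rewrite distrC /mollify addn0 expr0 mul1r.
have [h1 h2 h3 h4] := inn_shrink n iz.
apply: pairing_mollifier_close => //; [exact: shrink_gt0|exact: ltW|exact: w_integrable|].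
have := Hm n mn; rewrite sub0r normrN gtr0_norm ?shrink_gt0// => er.
apply: aeW => z' u v; rewrite distrC; apply: Hr; split => /=.
  by rewrite /ball /= distrC (lt_trans u er).
by rewrite /ball /= distrC (lt_trans v er).
Qed.

Lemma w_lip z z' : inn e0 z -> inn e0 z' ->
  `|w z - w z'| <= N * (`|z.1 - z'.1| + `|z.2 - z'.2|).
Proof.
move=> iz iz'; apply: (cvg_le (u := fun n => `|mollify (shrink n) 0 0 z - mollify (shrink n) 0 0 z'|) _ (cvg_cst _)).
  by apply: cvg_norm; apply: cvgB; exact: mollify_cvg.
by move=> n; apply: mollify_lip => //; [exact: shrink_gt0|exact: inn_shrink|exact: inn_shrink].
Qed.

Lemma w_bound z : inn e0 z -> `|w z| <= N.
Proof.
move=> iz; apply: (cvg_le (u := fun n => `|mollify (shrink n) 0 0 z|) _ (cvg_cst _)).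
  by apply: cvg_norm; exact: mollify_cvg.
by move=> n; apply: mollify_bound => //; [exact: shrink_gt0|exact: inn_shrink].
Qed.

(** The first derivatives of the mollifications are N-Lipschitz by the bound on the
    second ones, so that [limit_derivative] applies in each variable.  The margin between
    e0 and e1 leaves room for increments. *)
Lemma w_derive (e1 : R) z : e0 < e1 -> inn e1 z ->
  [/\ is_derive z.1 1 (fun x => w (x, z.2)) (partial_x w z),
      mollify (shrink n) 1 0 z @[n --> \oo] --> partial_x w z,
      is_derive z.2 1 (fun t => w (z.1, t)) (partial_t w z) &
      mollify (shrink n) 0 1 z @[n --> \oo] --> partial_t w z].
Proof.
move=> e01; case: z => x t [/= h1 h2 h3 h4].
have c0 : (fun _ : nat => (0 : R)) n @[n --> \oo] --> (0 : R) by exact: cvg_cst.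
have ex := e0_gt0.
have [||||g dg cg] := @limit_derivative R (fun n x => mollify (shrink n) 0 0 (x, t))
  (fun n x => mollify (shrink n) 1 0 (x, t)) (fun x => w (x, t)) (fun=> 0) N (X1 + e0) (X2 - e0) x _ N0 _ _ c0.
- by apply/andP; split; lra.
- by move=> n y _; have [] := mollify_is_derive (shrink n) 0 0 y t.
- move=> n y y' /andP[? ?] /andP[? ?]; rewrite addr0.
  apply: mollify_lipx => //.
  + exact: shrink_gt0.
  + by apply: inn_shrink; split => /=; lra.
  + by apply: inn_shrink; split => /=; lra.
- by move=> y /andP[? ?]; apply: mollify_cvg; split => /=; lra.
have [||||g' dg' cg'] := @limit_derivative R (fun n t => mollify (shrink n) 0 0 (x, t))
  (fun n t => mollify (shrink n) 0 1 (x, t)) (fun t => w (x, t)) (fun=> 0) N (S1 + e0) (S2 - e0) t _ N0 _ _ c0.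
- by apply/andP; split; lra.
- by move=> n y _; have [] := mollify_is_derive (shrink n) 0 0 x y.
- move=> n y y' /andP[? ?] /andP[? ?]; rewrite addr0.
  apply: mollify_lipt => //.
  + exact: shrink_gt0.
  + by apply: inn_shrink; split => /=; lra.
  + by apply: inn_shrink; split => /=; lra.
- by move=> y /andP[? ?]; apply: mollify_cvg; split => /=; lra.
have -> : partial_x w (x, t) = g by rewrite /partial_x /=; exact: is_derive_derive1 dg.
have -> : partial_t w (x, t) = g' by rewrite /partial_t /=; exact: is_derive_derive1 dg'.
by split.
Qed.

Lemma wd_bound (e1 : R) z : e0 < e1 -> inn e1 z -> `|partial_x w z| <= N /\ `|partial_t w z| <= N.
Proof.
move=> e01 iz; have [_ cx _ ct] := w_derive e01 iz.
have iz0 : inn e0 z by have [? ? ? ?] := iz; split; lra.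
split.
  apply: (cvg_le (u := fun n => `|mollify (shrink n) 1 0 z|) (cvg_norm cx) (cvg_cst _)) => n.
  by apply: mollify_bound => //; [exact: shrink_gt0|exact: inn_shrink].
apply: (cvg_le (u := fun n => `|mollify (shrink n) 0 1 z|) (cvg_norm ct) (cvg_cst _)) => n.
by apply: mollify_bound => //; [exact: shrink_gt0|exact: inn_shrink].
Qed.

Lemma wd_lip (e1 : R) z z' : e0 < e1 -> inn e1 z -> inn e1 z' ->
  `|partial_x w z - partial_x w z'| <= N * (`|z.1 - z'.1| + `|z.2 - z'.2|) /\
  `|partial_t w z - partial_t w z'| <= N * (`|z.1 - z'.1| + `|z.2 - z'.2|).
Proof.
move=> e01 iz iz'; have [_ cx _ ct] := w_derive e01 iz; have [_ cx' _ ct'] := w_derive e01 iz'.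
have iz0 : inn e0 z by have [? ? ? ?] := iz; split; lra.
have iz0' : inn e0 z' by have [? ? ? ?] := iz'; split; lra.
split.
  apply: (cvg_le (u := fun n => `|mollify (shrink n) 1 0 z - mollify (shrink n) 1 0 z'|) (cvg_norm (cvgB cx cx')) (cvg_cst _)) => n.
  by apply: mollify_lip => //; [exact: shrink_gt0|exact: inn_shrink|exact: inn_shrink].
apply: (cvg_le (u := fun n => `|mollify (shrink n) 0 1 z - mollify (shrink n) 0 1 z'|) (cvg_norm (cvgB ct ct')) (cvg_cst _)) => n.
by apply: mollify_lip => //; [exact: shrink_gt0|exact: inn_shrink|exact: inn_shrink].
Qed.

End OneBox.
End InteriorRegularity.

(** By compactness the rectangle has a positive distance to the complement of U. *)
Lemma box_slack {R : realType} (U : set (R * R)) (x1 x2 t1 t2 : R) : open U -> box x1 x2 t1 t2 `<=` U ->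
  exists2 e : R, 0 < e & box (x1 - e) (x2 + e) (t1 - e) (t2 + e) `<=` U.
Proof.
move=> oU BU.
have [x12|] := boolP (x1 <= x2); last first.
  rewrite -ltNge => x21; exists ((x1 - x2) / 4); first by rewrite divr_gt0// subr_gt0.
  by move=> z /boxP[/andP[? ?] _]; exfalso; lra.
have [t12|] := boolP (t1 <= t2); last first.
  rewrite -ltNge => t21; exists ((t1 - t2) / 4); first by rewrite divr_gt0// subr_gt0.
  by move=> z /boxP[_ /andP[? ?]]; exfalso; lra.
have /compact_near_coveringP/(_ R (0^'+) (fun e z => forall z', `|z.1 - z'.1| <= e -> `|z.2 - z'.2| <= e -> U z') _) := @box_compact R x1 x2 t1 t2.
case=> [z Bz|d /= d0 Hd].
  have /nbhs_ballP[r /= r0 Hr] : nbhs z U by apply: open_nbhs_nbhs; split => //; exact: BU.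
  exists (ball z (r / 2), [set e | e < r / 2]) => /=.
    split; first by apply: nbhsx_ballx; rewrite divr_gt0.
    by apply: nbhs_right_lt; rewrite divr_gt0.
  move=> [z' e] [/= [zb1 zb2] er] z'' h1 h2; apply: Hr; split.
    have := zb1; rewrite /ball /= => zb.
    by apply: le_lt_trans (ler_distD z'.1 _ _) _; lra.
  have := zb2; rewrite /ball /= => zb.
  by apply: le_lt_trans (ler_distD z'.2 _ _) _; lra.
exists (d / 2); first by rewrite divr_gt0.
have d2 : 0 < d / 2 by rewrite divr_gt0.
move=> z /boxP[/andP[h1 h2] /andP[h3 h4]].
pose z0 := (Num.max x1 (Num.min z.1 x2), Num.max t1 (Num.min z.2 t2)).
have : box x1 x2 t1 t2 z0.
  by apply/boxP; rewrite /= !le_max !ge_max !ge_min !lexx x12 t12 ?orbT.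
move=> Bz0; apply: (Hd (d / 2) _ d2 z0 Bz0) => /=.
- by rewrite /ball_ /= sub0r normrN gtr0_norm//; lra.
- rewrite ler_norml; case: (leP z.1 x2) => ?; case: (leP x1 _) => ?; apply/andP; split; lra.
- rewrite ler_norml; case: (leP z.2 t2) => ?; case: (leP t1 _) => ?; apply/andP; split; lra.
Qed.

Section WithinBox.
Context {R : realType}.
Implicit Types (e : R) (z : R * R).

Lemma within_box_le (X1 X2 S1 S2 e e' : R) z : e' <= e ->
  within_box X1 X2 S1 S2 e z -> within_box X1 X2 S1 S2 e' z.
Proof. by move=> ? [? ? ? ?]; split; lra. Qed.

Lemma within_box_box (X1 X2 S1 S2 e : R) z : 0 <= e ->
  within_box X1 X2 S1 S2 e z -> box X1 X2 S1 S2 z.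
Proof. by move=> ? [? ? ? ?]; apply/boxP; split; apply/andP; split; lra. Qed.

Lemma within_box_near (X1 X2 S1 S2 e : R) z z' : within_box X1 X2 S1 S2 e z ->
  `|z'.1 - z.1| < e -> `|z'.2 - z.2| < e -> obox X1 X2 S1 S2 z'.
Proof.
move=> [? ? ? ?]; rewrite !ltr_norml => /andP[? ?] /andP[? ?].
by apply/oboxP; split; apply/andP; split; lra.
Qed.

End WithinBox.

(** * The equation holds classically *)

(** The increment of a + u b between two points, when P and Q approximate its values
    there: used with a = w_t, u = w and b = w_x after mollification. *)
Lemma perturbation_bound {R : realType} (P Q a a' b b' u u' c N d d0 : R) :
  `|P - (a + u * b)| <= c -> `|Q - (a' + u' * b')| <= c ->
  `|a - a'| <= N * d -> `|b - b'| <= N * d -> `|b| <= N -> `|u - u'| <= N * (d + d0) ->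
  d0 = 0 -> `|u'| <= N -> `|P - Q| <= (N + N * N + N * N) * d + 2 * c.
Proof.
move=> h1 h2 h3 h4 h5 h6 dE h7; rewrite dE addr0 in h6.
have -> : P - Q = (P - (a + u * b)) + (a - a') + (u - u') * b + u' * (b - b') - (Q - (a' + u' * b')).
  by ring.
have k1 : `|(u - u') * b| <= (N * d) * N by rewrite normrM ler_pM.
have k2 : `|u' * (b - b')| <= N * (N * d) by rewrite normrM ler_pM.
apply: le_trans (ler_normB _ _) _.
apply: le_trans (lerD (le_trans (ler_normD _ _) (lerD (le_trans (ler_normD _ _) (lerD (ler_normD _ _) k1)) k2)) h2) _.
by lra.
Qed.

Section ClassicalEquation.
Context {R : realType}.
Variables (U V : set (R * R)) (w : R * R -> R) (D : nat -> nat -> R * R -> R) (N : R).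
Hypothesis N0 : 0 <= N.
Hypothesis oU : open U.
Hypothesis UV : U `<=` V.
Hypothesis w_cont : forall z, U z -> {for z, continuous w}.
Hypothesis w_weak : forall i j, (i + j <= 2)%N -> weak_deriv2 U i j w (D i j).
Hypothesis D_bound : forall i j, (i + j <= 2)%N -> {ae leb2, forall z, U z -> `|D i j z| <= N}.

Lemma point_slack z : U z -> exists2 e, 0 < e & box (z.1 - e) (z.1 + e) (z.2 - e) (z.2 + e) `<=` U.
Proof.
move=> Uz; apply: box_slack => // z' /boxP[/andP[a b] /andP[c d]].
suff -> : z' = z by [].
by case: z z' {Uz} a b c d => [x t] [x' t'] /= *; congr (_, _); apply/eqP; rewrite eq_le; apply/andP.
Qed.

Lemma regular_point z : U z ->
  [/\ `|w z| <= N, `|partial_x w z| <= N, `|partial_t w z| <= N,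
      is_derive z.1 1 (fun x => w (x, z.2)) (partial_x w z) &
      is_derive z.2 1 (fun t => w (z.1, t)) (partial_t w z)].
Proof.
move=> Uz; have [e e0 BU] := point_slack Uz.
have e20 : 0 < e / 2 by rewrite divr_gt0.
have h : e / 2 < e by lra.
have iz : within_box (z.1 - e) (z.1 + e) (z.2 - e) (z.2 + e) e z by split; lra.
have iz' : within_box (z.1 - e) (z.1 + e) (z.2 - e) (z.2 + e) (e / 2) z by split; lra.
have [d1 _ d2 _] := w_derive N0 w_cont w_weak D_bound BU e20 h iz.
have [b1 b2] := wd_bound N0 w_cont w_weak D_bound BU e20 h iz.
have b0 := w_bound N0 w_cont w_weak D_bound BU e20 iz'.
split; [exact: b0|exact: b1|exact: b2|exact: d1|exact: d2].
Qed.

Lemma regular_lipschitz x1 x2 t1 t2 z z' : box x1 x2 t1 t2 `<=` U ->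
  box x1 x2 t1 t2 z -> box x1 x2 t1 t2 z' ->
  [/\ `|w z - w z'| <= N * (`|z.1 - z'.1| + `|z.2 - z'.2|),
      `|partial_x w z - partial_x w z'| <= N * (`|z.1 - z'.1| + `|z.2 - z'.2|) &
      `|partial_t w z - partial_t w z'| <= N * (`|z.1 - z'.1| + `|z.2 - z'.2|)].
Proof.
move=> BU Bz Bz'; have [e e0 BeU] := box_slack oU BU.
have e20 : 0 < e / 2 by rewrite divr_gt0.
have h : e / 2 < e by lra.
have ie y : box x1 x2 t1 t2 y -> within_box (x1 - e) (x2 + e) (t1 - e) (t2 + e) e y.
  by move=> /boxP[/andP[? ?] /andP[? ?]]; split; lra.
have ie' y : box x1 x2 t1 t2 y -> within_box (x1 - e) (x2 + e) (t1 - e) (t2 + e) (e / 2) y.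
  by move=> /boxP[/andP[? ?] /andP[? ?]]; split; lra.
have [l1 l2] := wd_lip N0 w_cont w_weak D_bound BeU e20 h (ie _ Bz) (ie _ Bz').
have l0 := w_lip N0 w_cont w_weak D_bound BeU e20 (ie' _ Bz) (ie' _ Bz').
split; [exact: l0|exact: l1|exact: l2].
Qed.

Variables wt wx wxx : R * R -> R.
Hypothesis wt_weak : weak_deriv2 V 0 1 w wt.
Hypothesis wx_weak : weak_deriv2 V 1 0 w wx.
Hypothesis wxx_weak : weak_deriv2 V 2 0 w wxx.
Hypothesis eqn : {ae leb2, forall z, V z -> wt z - wxx z + w z * wx z = 0}.

(** The equation is stated with the weak derivative on V, the bounds concern the one on
    U; their difference is orthogonal to all test functions. *)
Lemma wx_ae X1 X2 S1 S2 : box X1 X2 S1 S2 `<=` U ->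
  {ae leb2, forall z, obox X1 X2 S1 S2 z -> wx z = D 1 0 z}.
Proof.
move=> BU; have BV := subset_trans BU UV.
have [_ lix _] := wx_weak.
have iwx : leb2.-integrable (box X1 X2 S1 S2) (EFin \o wx) by exact: locally_integrable2_box lix BV.
have iD : leb2.-integrable (box X1 X2 S1 S2) (EFin \o D 1 0) by exact: (D_integrable w_weak BU).
have mB := @box_measurable R X1 X2 S1 S2.
have ig : leb2.-integrable (box X1 X2 S1 S2) (EFin \o (fun z => wx z - D 1 0 z)).
  have : leb2.-integrable (box X1 X2 S1 S2) (fun z => (wx z)%:E - (D 1 0 z)%:E)%E by exact: integrableB.
  by apply: eq_integrable.
have := fundamental_lemma2 ig.
move=> H; have {}H := H _; apply: filterS (H _) => [z Hz Oz|].
  by have := Hz Oz; rewrite /= => -[] /eqP; rewrite subr_eq0 => /eqP.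
move=> n y1 y2 s1 s2 n0 xy yx ts st.
have sc a b : smooth (cutoff n a b) by exact: cutoff_smooth.
have s1' : supp_in (cutoff n y1 y2) X1 X2 by apply: supp_in_sub (cutoff_supp n0) xy yx.
have s2' : supp_in (cutoff n s1 s2) S1 S2 by apply: supp_in_sub (cutoff_supp n0) ts st.
have E1 := weak_deriv2_box wx_weak (sc y1 y2) (sc s1 s2) s1' s2' BV.
have E2 := weak_deriv2_box (w_weak (i := 1) (j := 0) isT) (sc y1 y2) (sc s1 s2) s1' s2' BU.
have bt z : `|tensor (cutoff n y1 y2) (cutoff n s1 s2) z| <= 1.
  by rewrite normrM mulr_ile1// cutoff_norm_le1.
transitivity (\int[leb2]_(z in box X1 X2 S1 S2) (wx z * tensor (cutoff n y1 y2) (cutoff n s1 s2) z -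
   D 1 0 z * tensor (cutoff n y1 y2) (cutoff n s1 s2) z)).
  by apply: eq_Rintegral => z _; rewrite mulrBl.
rewrite RintegralB//; last 2 first.
- exact: (integrable_tensor (C := 1)).
- exact: (integrable_tensor (C := 1)).
move: E1; rewrite E2 => /(mulfI _) ->; first by rewrite subrr.
by rewrite signr_eq0.
Qed.

(** Mollified, the equation reads w_xx = w_t + w w_x up to the oscillation of w over the
    support of the kernel.  The mollified w_xx are thus Lipschitz in x up to a vanishing
    error, and [limit_derivative] identifies their limit with the derivative of w_x. *)
Lemma classical_equation z : U z ->
  is_derive z.1 1 (fun x => partial_x w (x, z.2)) (partial_t w z + w z * partial_x w z).
Proof.
move=> Uz; have [d4 d40 BU] := point_slack Uz.
pose d := d4 / 4; have d0 : 0 < d by rewrite divr_gt0.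
have d4E : d4 = 4 * d by rewrite /d; field.
set X1 := z.1 - d4 in BU; set X2 := z.1 + d4 in BU; set S1 := z.2 - d4 in BU; set S2 := z.2 + d4 in BU.
set B := box X1 X2 S1 S2 in BU.
have BV := subset_trans BU UV.
have dd : d < 2 * d by lra.
pose en := shrink d.
have en0 n : 0 < en n by exact: shrink_gt0.
have end_ n : en n <= d by exact: shrink_le.
have en2 n : en n <= 2 * d by have := end_ n; lra.
have d20 : 0 <= 2 * d by lra.
have mB : measurable B by exact: box_measurable.
have wi := w_integrable w_weak BU.
have i10 := D_integrable w_weak BU (i := 1) (j := 0) isT.
have [_ lit _] := wt_weak. have it := locally_integrable2_box lit BV.
have [_ lixx _] := wxx_weak. have ixx := locally_integrable2_box lixx BV.
have inz x : z.1 - d <= x <= z.1 + d -> within_box X1 X2 S1 S2 (2 * d) (x, z.2).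
  by rewrite /X1 /X2 /S1 /S2 d4E => /andP[? ?]; split => /=; lra.
pose c n := N * (2 * en n) * N.
have inB n z1 z2 : within_box X1 X2 S1 S2 (en n) z1 -> `|z2.1 - z1.1| < en n -> `|z2.2 - z1.2| < en n ->
    obox X1 X2 S1 S2 z2 /\ B z2.
  move=> iz1 h1 h2; have O := within_box_near iz1 h1 h2.
  by split; [exact: O|exact: obox_sub].
have key n z1 : within_box X1 X2 S1 S2 (2 * d) z1 ->
  `|mollify w X1 X2 S1 S2 (en n) 2 0 z1 - (mollify w X1 X2 S1 S2 (en n) 0 1 z1 + w z1 * mollify w X1 X2 S1 S2 (en n) 1 0 z1)| <= c n.
  move=> iz1; have iz : within_box X1 X2 S1 S2 (en n) z1 by exact: within_box_le (en2 n) iz1.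
  have Bz1 : B z1 by exact: within_box_box d20 iz1.
  rewrite (mollify_pairing (en0 n) iz wxx_weak BV) (mollify_pairing (en0 n) iz wt_weak BV).
  rewrite (mollify_pairing (en0 n) iz (w_weak (i := 1) (j := 0) isT) BU).
  set rho := mollifier _.
  have [C C00 HC] := supp_bounded (mollifier_smooth (en n)) (@mollifier_supp _ (en n)).
  pose T := tensor (shiftf rho z1.1) (shiftf rho z1.2).
  have itens f : leb2.-integrable B (EFin \o f) -> leb2.-integrable B (EFin \o (fun z => f z * T z)).
    move=> fi; apply: (integrable_tensor (C := C * C)) => //; try (apply: smooth_shift; exact: mollifier_smooth).
    by move=> z'; rewrite normrM; apply: ler_pM => //; exact: HC.
  pose f := fun z => wxx z - (wt z + w z1 * D 1 0 z).
  have iwD : leb2.-integrable B (EFin \o (fun z => w z1 * D 1 0 z)).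
    have : leb2.-integrable B (fun z => (w z1)%:E * (D 1 0 z)%:E)%E by apply: integrableZl.
    by apply: eq_integrable.
  have itwD : leb2.-integrable B (EFin \o (fun z => wt z + w z1 * D 1 0 z)).
    have : leb2.-integrable B (fun z => (wt z)%:E + (w z1 * D 1 0 z)%:E)%E by apply: integrableD.
    by apply: eq_integrable.
  have fi : leb2.-integrable B (EFin \o f).
    have : leb2.-integrable B (fun z => (wxx z)%:E - (wt z + w z1 * D 1 0 z)%:E)%E by apply: integrableB.
    by apply: eq_integrable.
  have -> : pairing wxx B rho rho z1 - (pairing wt B rho rho z1 + w z1 * pairing (D 1 0) B rho rho z1) =
      pairing f B rho rho z1.
    rewrite /pairing -/T -RintegralZl//; last exact: itens.
    rewrite -RintegralD//; last 2 first.
    - exact: itens.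
    - have := itens _ iwD; apply: eq_integrable => // z' _; by rewrite /= mulrA.
    rewrite -RintegralB//; last 2 first.
    - exact: itens.
    - have := itens _ itwD; apply: eq_integrable => // z' _; by rewrite /= mulrDl mulrA.
    by apply: eq_Rintegral => z' _; rewrite /f; ring.
  rewrite -[X in `|X|]subr0.
  have [h1 h2 h3 h4] := iz.
  apply: pairing_mollifier_close => //.
    by rewrite /c; apply: mulr_ge0 => //; apply: mulr_ge0 => //; apply: mulr_ge0 => //; exact: ltW.
  have ae1 := D_bound (i := 1) (j := 0) isT.
  have ae2 := wx_ae BU.
  apply: filterS3 ae1 ae2 eqn => z' b1 b2 b3 u v; rewrite subr0 /f.
  have [Oz' Bz'] := inB n _ _ iz u v.
  have Uz' := BU _ Bz'.
  have -> : wxx z' - (wt z' + w z1 * D 1 0 z') = (w z' - w z1) * D 1 0 z'.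
    have := b3 (UV Uz'); rewrite (b2 Oz') => H.
    have -> : wt z' = wxx z' - w z' * D 1 0 z' by apply/eqP; rewrite -subr_eq0 -H; apply/eqP; ring.
    by ring.
  rewrite normrM; apply: ler_pM => //; last exact: b1.
  have [l _ _] := regular_lipschitz BU Bz' Bz1.
  apply: le_trans l _; apply: ler_wpM2l => //.
  have -> : 2 * en n = en n + en n by ring.
  by apply: lerD; exact: ltW.
have W10c z1 : within_box X1 X2 S1 S2 (2 * d) z1 ->
   mollify w X1 X2 S1 S2 (en n) 1 0 z1 @[n --> \oo] --> partial_x w z1.
  by move=> iz1; have [_ h _ _] := w_derive N0 w_cont w_weak D_bound BU d0 dd iz1.
have W01c z1 : within_box X1 X2 S1 S2 (2 * d) z1 ->
   mollify w X1 X2 S1 S2 (en n) 0 1 z1 @[n --> \oo] --> partial_t w z1.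
  by move=> iz1; have [_ _ _ h] := w_derive N0 w_cont w_weak D_bound BU d0 dd iz1.
have cn0 : c n @[n --> \oo] --> (0 : R).
  have h := shrink_cvg d.
  have := cvgM (cvgM (cvg_cst N) (cvgM (cvg_cst (2 : R)) h)) (cvg_cst N) _.
  by rewrite !(mulr0, mul0r); apply.
have cn20 : 2 * c n @[n --> \oo] --> (0 : R).
  by have := cvgM (cvg_cst (2 : R)) cn0 _; rewrite mulr0; apply.
have iznn n x : z.1 - d <= x <= z.1 + d -> within_box X1 X2 S1 S2 (en n) (x, z.2).
  by move=> /inz; exact: within_box_le (en2 n).
have L0 : 0 <= N + N * N + N * N by rewrite !addr_ge0// mulr_ge0.
have [||||g dg cg] := @limit_derivative R (fun n x => mollify w X1 X2 S1 S2 (en n) 1 0 (x, z.2))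
   (fun n x => mollify w X1 X2 S1 S2 (en n) 2 0 (x, z.2)) (fun x => partial_x w (x, z.2))
   (fun n => 2 * c n) (N + N * N + N * N) (z.1 - d) (z.1 + d) z.1 _ L0 _ _ cn20 _.
- by apply/andP; split; lra.
- by move=> n x _; have [] := mollify_is_derive w_weak BU (en n) 1 0 x z.2.
- move=> n x y xi yi.
  have kx := key n _ (inz _ xi); have ky := key n _ (inz _ yi).
  have l01 := mollify_lipx N0 w_weak D_bound BU (i := 0) (j := 1) (en0 n) (iznn n _ xi) (iznn n _ yi) isT.
  have l10 := mollify_lipx N0 w_weak D_bound BU (i := 1) (j := 0) (en0 n) (iznn n _ xi) (iznn n _ yi) isT.
  have bx := mollify_bound N0 w_weak D_bound BU (i := 1) (j := 0) (en0 n) (iznn n _ xi) isT.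
  have Bz1 x' : z.1 - d <= x' <= z.1 + d -> B (x', z.2).
    by move=> /inz; exact: within_box_box d20.
  have [lw _ _] := regular_lipschitz BU (Bz1 _ xi) (Bz1 _ yi).
  have [by_ _ _ _ _] := regular_point (BU _ (Bz1 _ yi)).
  have l0 : `|(x, z.2).2 - (y, z.2).2| = 0 by rewrite /= subrr normr0.
  exact: (perturbation_bound kx ky l01 l10 bx lw l0 by_).
- by move=> x xi; apply: W10c; exact: inz.
suff -> : partial_t w z + w z * partial_x w z = g by [].
have zz : within_box X1 X2 S1 S2 (2 * d) z.
  by rewrite (surjective_pairing z); apply: inz; apply/andP; split; lra.
have lim : mollify w X1 X2 S1 S2 (en n) 2 0 z @[n --> \oo] --> partial_t w z + w z * partial_x w z.
  apply/cvgrPdist_le => eta eta0.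
  have h1 : mollify w X1 X2 S1 S2 (en n) 0 1 z + w z * mollify w X1 X2 S1 S2 (en n) 1 0 z @[n --> \oo] -->
      partial_t w z + w z * partial_x w z.
    by apply: cvgD; [exact: W01c|apply: cvgMr; exact: W10c].
  have eta2 : 0 < eta / 2 by rewrite divr_gt0.
  have /cvgrPdist_le/(_ _ eta2)[n1 _ H1] := h1.
  have /cvgrPdist_le/(_ _ eta2)[n2 _ H2] := cn0.
  exists (maxn n1 n2) => // n /=; rewrite geq_max => /andP[k1 k2].
  apply: le_trans (ler_distD (mollify w X1 X2 S1 S2 (en n) 0 1 z + w z * mollify w X1 X2 S1 S2 (en n) 1 0 z) _ _) _.
  rewrite [leRHS]splitr; apply: lerD; first exact: H1.
  rewrite distrC; apply: le_trans (key n z zz) _.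
  by have := H2 n k2; rewrite /= sub0r normrN; apply: le_trans; exact: ler_norm.
have cg' : mollify w X1 X2 S1 S2 (en n) 2 0 z @[n --> \oo] --> g.
  by move: cg; rewrite -surjective_pairing.
exact: (cvg_unique _ lim cg').
Qed.

End ClassicalEquation.

(** * A Carleman identity in one space dimension *)

Section ContinuousAt.
Context {R : realType}.
Implicit Types (f g : R * R -> R) (z : R * R).

(** A constant of its own, so that continuity goals can be matched syntactically. *)
Definition cont_at z f := {for z, continuous f}.

Lemma cont_at_cst z (k : R) : cont_at z (fun _ => k).
Proof. exact: cvg_cst. Qed.

Lemma cont_atD z f g : cont_at z f -> cont_at z g -> cont_at z (fun y => f y + g y).
Proof. by move=> ? ?; exact: cvgD. Qed.

Lemma cont_atB z f g : cont_at z f -> cont_at z g -> cont_at z (fun y => f y - g y).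
Proof. by move=> ? ?; exact: cvgB. Qed.

Lemma cont_atM z f g : cont_at z f -> cont_at z g -> cont_at z (fun y => f y * g y).
Proof. by move=> ? ?; exact: cvgM. Qed.

Lemma cont_at_sqr z f : cont_at z f -> cont_at z (fun y => f y ^+ 2).
Proof. by move=> ?; exact: cvgM. Qed.

End ContinuousAt.

Ltac cont_at_tac :=
  match goal with
  | H : cont_at ?z ?f |- cont_at ?z ?f => exact H
  | H : cont_at ?z ?f |- cont_at ?z (fun y => ?f y) => exact H
  | |- cont_at _ (fun _ => ?c) => exact: cont_at_cst
  | |- cont_at ?z (fun y => @?f y - @?g y) => apply (cont_atB (f := f) (g := g)); cont_at_tac
  | |- cont_at ?z (fun y => @?f y + @?g y) => apply (cont_atD (f := f) (g := g)); cont_at_tac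
  | |- cont_at ?z (fun y => @?f y * @?g y) => apply (cont_atM (f := f) (g := g)); cont_at_tac
  | |- cont_at ?z (fun y => @?f y ^+ 2) => apply (cont_at_sqr (f := f)); cont_at_tac
  end.

Section CarlemanWeight.
Context {R : realType}.
Variables (m t0 kappa s : R).

(** The weight (x - m - 1)^2 / 2 decreases for x <= m, where |x - m - 1| >= 1.  Normalized
    to vanish at (m, t0), it is positive at (x, t0) for x < m, while the term in t makes it
    nonpositive at the ends of the time interval if kappa is large. *)
Definition wr (z : R * R) : R := z.1 - (m + 1).
Definition wphi (z : R * R) : R :=
  (wr z ^+ 2 - 1) / 2 - kappa * (z.2 - t0) ^+ 2.
Definition wphit (z : R * R) : R := - 2 * kappa * (z.2 - t0).
Definition wE (z : R * R) : R := expR (s * wphi z).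

Lemma wr_dx (x t : R) : is_derive x 1 (fun x => wr (x, t)) 1.
Proof.
have := is_derive_affine 1 (- (m + 1)) x; apply: is_derive_ext => y.
by rewrite /wr /= mul1r.
Qed.

Lemma wphit_dt (x t : R) : is_derive t 1 (fun t => wphit (x, t)) (- 2 * kappa).
Proof.
have := is_derive_affine (- 2 * kappa) (2 * kappa * t0) t; apply: is_derive_ext => y.
by rewrite /wphit /=; ring.
Qed.

Lemma wphi_dx (x t : R) : is_derive x 1 (fun x => wphi (x, t)) (wr (x, t)).
Proof.
have d1 := wr_dx x t.
have d2 := is_deriveBf (is_deriveZf (1/2) (is_deriveBf (is_deriveMf d1 d1) (is_derive_cst (1 : R) x (1 : R))))
   (is_derive_cst (kappa * (t - t0) ^+ 2) x (1 : R)).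
apply: is_derive_ext (is_derive_val _ d2) => [y|].
  by rewrite /wphi /cst /= -expr2 mulrC mul1r.
by field.
Qed.

Lemma wphi_dt (x t : R) : is_derive t 1 (fun t => wphi (x, t)) (wphit (x, t)).
Proof.
have d0 := is_derive_affine 1 (- t0) t.
have d2 := is_deriveBf (is_derive_cst ((wr (x, t) ^+ 2 - 1) / 2) t (1 : R)) (is_deriveZf kappa (is_deriveMf d0 d0)).
apply: is_derive_ext (is_derive_val _ d2) => [y|].
  by rewrite /wphi /wr /cst /=; ring.
by rewrite /wphit /=; ring.
Qed.

Lemma wE_dx (x t : R) : is_derive x 1 (fun x => wE (x, t)) (s * wr (x, t) * wE (x, t)).
Proof.
have := is_derive_compf (f := expR) (g := fun x => s * wphi (x, t)) (is_derive_expR _) (is_deriveZf s (wphi_dx x t)).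
by apply: is_derive_val; rewrite /wE; ring.
Qed.

Lemma wE_dt (x t : R) : is_derive t 1 (fun t => wE (x, t)) (s * wphit (x, t) * wE (x, t)).
Proof.
have := is_derive_compf (f := expR) (g := fun t => s * wphi (x, t)) (is_derive_expR _) (is_deriveZf s (wphi_dt x t)).
by apply: is_derive_val; rewrite /wE; ring.
Qed.

Lemma wr_cont z : {for z, continuous wr}.
Proof. by apply: cvgB; [exact: cvg_fst|exact: cvg_cst]. Qed.

Lemma wphit_cont z : {for z, continuous wphit}.
Proof. by apply: cvgM; [exact: cvg_cst|apply: cvgB; [exact: cvg_snd|exact: cvg_cst]]. Qed.

Lemma wphi_cont z : {for z, continuous wphi}.
Proof.
apply: cvgB.
  apply: cvgM; last exact: cvg_cst.
  by apply: cvgB; [apply: cvgM; exact: wr_cont|exact: cvg_cst].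
apply: cvgM; first exact: cvg_cst.
by apply: cvgM; apply: cvgB; [exact: cvg_snd|exact: cvg_cst|exact: cvg_snd|exact: cvg_cst].
Qed.

Lemma wE_cont z : {for z, continuous wE}.
Proof.
apply: (@continuous_comp _ _ _ (fun z => s * wphi z) expR); last exact: continuous_expR.
by apply: cvgM; [exact: cvg_cst|exact: wphi_cont].
Qed.

Section Conjugation.
Variables (Y Yx Yxx Yt Yxt : R * R -> R).

(** The conjugate v = exp(s phi) Y and its derivatives v_x, v_xx, v_t, v_xt. *)
Definition cv z := wE z * Y z.
Definition cvx z := wE z * (Yx z + s * wr z * Y z).
Definition cvxx z := wE z * (Yxx z + 2 * s * wr z * Yx z + (s + s ^+ 2 * wr z ^+ 2) * Y z).
Definition cvt z := wE z * (Yt z + s * wphit z * Y z).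
Definition cvxt z := wE z * (Yxt z + s * wphit z * Yx z + s * wr z * (Yt z + s * wphit z * Y z)).

(** With q = s^2 r^2 + s phi_t, where r = phi_x, the divergence terms of the identity
    are J_x and K_t for J = - 2 v_x v_t - 2 s r v_x^2 - 2 s v v_x - 2 s r q v^2 and
    K = v_x^2 - q v^2. *)
Definition cq z := s ^+ 2 * wr z ^+ 2 + s * wphit z.

Definition cJ z := - 2 * (cvx z * cvt z) - 2 * s * (wr z * (cvx z * cvx z)) - 2 * s * (cv z * cvx z)
  - 2 * s * (wr z * (cq z * (cv z * cv z))).
Definition cJx z := - 2 * (cvxx z * cvt z + cvx z * cvxt z)
  - 2 * s * (cvx z * cvx z + 2 * wr z * (cvx z * cvxx z))
  - 2 * s * (cvx z * cvx z + cv z * cvxx z)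
  - 2 * s * (3 * s ^+ 2 * wr z ^+ 2 + s * wphit z) * (cv z * cv z)
  - 4 * s * wr z * cq z * (cv z * cvx z).
Definition cK z := cvx z * cvx z - cq z * (cv z * cv z).
Definition cKt z := 2 * (cvx z * cvxt z) + 2 * s * kappa * (cv z * cv z) - 2 * cq z * (cv z * cvt z).

(** Set A = - v_xx - q v and B = v_t + 2 s r v_x + s v, so that
    A + B = exp(s phi) (Y_t - Y_xx).  The product 2 A B equals J_x + K_t plus a quadratic
    form in (v_x, v) of order (s, s^3), and it is at most (A + B)^2 / 2, which the hypothesis
    bounds by a quadratic form of order (1, s^2). *)
Lemma carleman_pointwise (C : R) z : 0 <= kappa -> 1 <= wr z ^+ 2 ->
  1 <= s -> C ^+ 2 <= s -> kappa <= s -> `|Yt z - Yxx z| <= C * `|Yx z| ->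
  cJx z + cKt z <= - (cv z * cv z).
Proof.
move=> k0 r1 s1 sC sk H.
pose A := - cvxx z - cq z * cv z; pose B := cvt z + 2 * s * wr z * cvx z + s * cv z.
have E1 : cJx z + cKt z = 2 * (A * B) - 4 * s * cvx z ^+ 2 - (4 * s ^+ 3 * wr z ^+ 2 - 2 * s * kappa) * cv z ^+ 2.
  by rewrite /cJx /cKt /A /B /cq; ring.
have E2 : A + B = wE z * (Yt z - Yxx z).
  by rewrite /A /B /cq /cvxx /cv /cvt /cvx; ring.
have E3 : wE z * Yx z = cvx z - s * wr z * cv z by rewrite /cvx /cv; ring.
have E4 : (A + B) ^+ 2 <= C ^+ 2 * (cvx z - s * wr z * cv z) ^+ 2.
  rewrite E2 -E3 !exprMn [leRHS]mulrCA; apply: ler_wpM2l; first exact: sqr_ge0.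
  rewrite -(real_normK (num_real (Yt z - _))) -(real_normK (num_real (Yx z))) -exprMn.
  by rewrite ler_sqr ?nnegrE// (le_trans _ H).
have E5 : 2 * (A * B) <= (A + B) ^+ 2 / 2.
  by have := sqr_ge0 (A - B); rewrite !expr2; lra.
have E6 : (cvx z - s * wr z * cv z) ^+ 2 <= 2 * (cvx z ^+ 2 + s ^+ 2 * wr z ^+ 2 * cv z ^+ 2).
  by have := sqr_ge0 (cvx z + s * wr z * cv z); lra.
have E7 : 2 * (A * B) <= C ^+ 2 * (cvx z ^+ 2 + s ^+ 2 * wr z ^+ 2 * cv z ^+ 2).
  by apply: le_trans E5 _; have := ler_wpM2l (sqr_ge0 C) E6; lra.
have s0 : 0 <= s by lra.
have P0 := sqr_ge0 (cvx z). have Q0 := sqr_ge0 (cv z). have S0 := sqr_ge0 s.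
have F1 : C ^+ 2 * cvx z ^+ 2 <= s * cvx z ^+ 2 by exact: ler_wpM2r.
have X0 : 1 <= s ^+ 3 * wr z ^+ 2.
  rewrite -[leLHS]mulr1; apply: ler_pM => //; first by rewrite exprn_ege1.
have X1 : s * kappa <= s ^+ 3 * wr z ^+ 2.
  apply: (@le_trans _ _ (s ^+ 2 * 1)); first by rewrite mulr1 expr2 ler_wpM2l.
  apply: ler_pM => //; rewrite exprS ler_peMl//.
have X2 : C ^+ 2 * (s ^+ 2 * wr z ^+ 2) <= s ^+ 3 * wr z ^+ 2.
  by rewrite [s ^+ 3]exprS -mulrA; apply: ler_wpM2r => //; rewrite mulr_ge0// sqr_ge0.
have F2 := ler_wpM2r Q0 X0. have F3 := ler_wpM2r Q0 X1. have F4 := ler_wpM2r Q0 X2.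
have F5 : 0 <= s * cvx z ^+ 2 by exact: mulr_ge0.
rewrite E1 -expr2; move: F5 E7 F1 F2 F3 F4 P0.
by lra.
Qed.

Lemma cv_dx (x t : R) : is_derive x 1 (fun x => Y (x, t)) (Yx (x, t)) ->
  is_derive x 1 (fun x => cv (x, t)) (cvx (x, t)).
Proof.
move=> dY; have := is_deriveMf (wE_dx x t) dY.
by apply: is_derive_val; rewrite /cvx; ring.
Qed.

Lemma cv_dt (x t : R) : is_derive t 1 (fun t => Y (x, t)) (Yt (x, t)) ->
  is_derive t 1 (fun t => cv (x, t)) (cvt (x, t)).
Proof.
move=> dY; have := is_deriveMf (wE_dt x t) dY.
by apply: is_derive_val; rewrite /cvt; ring.
Qed.

Lemma cvx_dx (x t : R) : is_derive x 1 (fun x => Y (x, t)) (Yx (x, t)) ->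
  is_derive x 1 (fun x => Yx (x, t)) (Yxx (x, t)) ->
  is_derive x 1 (fun x => cvx (x, t)) (cvxx (x, t)).
Proof.
move=> dY dYx.
have := is_deriveMf (wE_dx x t) (is_deriveDf dYx (is_deriveMf (is_deriveZf s (wr_dx x t)) dY)).
by apply: is_derive_val; rewrite /cvxx; ring.
Qed.

Lemma cvx_dt (x t : R) : is_derive t 1 (fun t => Y (x, t)) (Yt (x, t)) ->
  is_derive t 1 (fun t => Yx (x, t)) (Yxt (x, t)) ->
  is_derive t 1 (fun t => cvx (x, t)) (cvxt (x, t)).
Proof.
move=> dY dYx.
have := is_deriveMf (wE_dt x t) (is_deriveDf dYx (is_deriveZf (s * wr (x, t)) dY)).
by apply: is_derive_val; rewrite /cvxt; ring.
Qed.

Lemma cvt_dx (x t : R) : is_derive x 1 (fun x => Y (x, t)) (Yx (x, t)) ->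
  is_derive x 1 (fun x => Yt (x, t)) (Yxt (x, t)) ->
  is_derive x 1 (fun x => cvt (x, t)) (cvxt (x, t)).
Proof.
move=> dY dYt.
have := is_deriveMf (wE_dx x t) (is_deriveDf dYt (is_deriveZf (s * wphit (x, t)) dY)).
by apply: is_derive_val; rewrite /cvxt; ring.
Qed.

Lemma cJ_dx (x t : R) : is_derive x 1 (fun x => Y (x, t)) (Yx (x, t)) ->
  is_derive x 1 (fun x => Yx (x, t)) (Yxx (x, t)) ->
  is_derive x 1 (fun x => Yt (x, t)) (Yxt (x, t)) ->
  is_derive x 1 (fun x => cJ (x, t)) (cJx (x, t)).
Proof.
move=> dY dYx dYt.
have d0 := cv_dx dY. have d1 := cvx_dx dY dYx. have d2 := cvt_dx dY dYt. have dr := wr_dx x t.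
have dq : is_derive x 1 (fun x => cq (x, t)) (2 * s ^+ 2 * wr (x, t)).
  have := is_deriveDf (is_deriveZf (s ^+ 2) (is_deriveMf dr dr)) (is_derive_cst (s * wphit (x, t)) x (1 : R)).
  by move=> h; apply: is_derive_ext (is_derive_val _ h) => [y|]; [rewrite /cq /cst expr2|ring].
have := is_deriveBf (is_deriveBf (is_deriveBf (is_deriveZf (- 2) (is_deriveMf d1 d2))
  (is_deriveZf (2 * s) (is_deriveMf dr (is_deriveMf d1 d1)))) (is_deriveZf (2 * s) (is_deriveMf d0 d1)))
  (is_deriveZf (2 * s) (is_deriveMf dr (is_deriveMf dq (is_deriveMf d0 d0)))).
by apply: is_derive_val; rewrite /cJx /cq; ring.
Qed.

Lemma cK_dt (x t : R) : is_derive t 1 (fun t => Y (x, t)) (Yt (x, t)) ->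
  is_derive t 1 (fun t => Yx (x, t)) (Yxt (x, t)) ->
  is_derive t 1 (fun t => cK (x, t)) (cKt (x, t)).
Proof.
move=> dY dYx.
have d0 := cv_dt dY. have d1 := cvx_dt dY dYx.
have dq : is_derive t 1 (fun t => cq (x, t)) (- 2 * s * kappa).
  have := is_deriveDf (is_derive_cst (s ^+ 2 * wr (x, t) ^+ 2) t (1 : R)) (is_deriveZf s (wphit_dt x t)).
  by move=> h; apply: is_derive_ext (is_derive_val _ h) => [y|]; [rewrite /cq /cst|ring].
have := is_deriveBf (is_deriveMf d1 d1) (is_deriveMf dq (is_deriveMf d0 d0)).
by apply: is_derive_val; rewrite /cKt; ring.
Qed.

Lemma conjugation_cont z : cont_at z Y -> cont_at z Yx -> cont_at z Yxx ->
  cont_at z Yt -> cont_at z Yxt ->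
  [/\ cont_at z cJ, cont_at z cJx, cont_at z cKt & cont_at z cv].
Proof.
move=> cY cYx cYxx cYt cYxt.
have cE : cont_at z wE := @wE_cont z.
have cr : cont_at z wr := @wr_cont z.
have cpt : cont_at z wphit := @wphit_cont z.
have h0 : cont_at z cv by unfold cv; cont_at_tac.
have h1 : cont_at z cvx by unfold cvx; cont_at_tac.
have h2 : cont_at z cvxx by unfold cvxx; cont_at_tac.
have h3 : cont_at z cvt by unfold cvt; cont_at_tac.
have h4 : cont_at z cvxt by unfold cvxt; cont_at_tac.
have hq : cont_at z cq by unfold cq; cont_at_tac.
split.
- by unfold cJ; cont_at_tac.
- by unfold cJx; cont_at_tac.
- by unfold cKt; cont_at_tac.
- exact: h0.
Qed.

End Conjugation.
End CarlemanWeight.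

(** * Integrals over time slices *)

Section ParametricIntegrals.
Context {R : realType}.
Local Notation mu := (@lebesgue_measure R).

Lemma box_bounded (f : R * R -> R) (x1 x2 t1 t2 : R) :
  (forall z, box x1 x2 t1 t2 z -> cont_at z f) ->
  exists2 C : R, 0 <= C & forall z, box x1 x2 t1 t2 z -> `|f z| <= C.
Proof.
move=> cf.
have cw : {within box x1 x2 t1 t2, continuous f}.
  by apply: continuous_in_subspaceT => z /set_mem Bz; exact: cf.
have /compact_bounded [M [_ HM]] := continuous_compact cw (@box_compact R x1 x2 t1 t2).
exists (`|M| + 1) => [|z Bz]; first by rewrite addr_ge0.
apply: (HM (`|M| + 1)); last by exists z.
by apply: le_lt_trans (ler_norm M) _; rewrite ltrDl.
Qed.

Lemma cont_at_slice (f : R * R -> R) (x t : R) : cont_at (x, t) f ->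
  {for t, continuous (fun t => f (x, t))}.
Proof.
move=> cf; apply: (@continuous_comp _ _ _ (fun t => (x, t)) f) => //.
rewrite /continuous_at/=.
exact: (cvg_pair (F := nbhs t) (f := fun=> x) (g := id) (cvg_cst x) cvg_id).
Qed.

Lemma slice_continuous (f : R * R -> R) (x t1 t2 : R) :
  (forall t, t1 <= t <= t2 -> cont_at (x, t) f) ->
  {within `[t1, t2], continuous (fun t => f (x, t))}.
Proof.
move=> cf; apply: continuous_in_subspaceT => t /set_mem; rewrite /= in_itv /= => tt.
by apply: cont_at_slice; exact: cf.
Qed.

Lemma slice_integrable (f : R * R -> R) (x t1 t2 : R) :
  (forall t, t1 <= t <= t2 -> cont_at (x, t) f) ->
  mu.-integrable `[t1, t2] (EFin \o (fun t => f (x, t))).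
Proof.
move=> cf; apply: continuous_compact_integrable; first exact: segment_compact.
exact: slice_continuous.
Qed.

Lemma is_derive_slice_integral (f fx : R * R -> R) (x1 x2 t1 t2 x : R) : x1 < x < x2 ->
  (forall z, box x1 x2 t1 t2 z -> is_derive z.1 1 (fun x => f (x, z.2)) (fx z)) ->
  (forall z, box x1 x2 t1 t2 z -> cont_at z f /\ cont_at z fx) ->
  is_derive x 1 (fun x => \int[mu]_(t in `[t1, t2]) f (x, t)) (\int[mu]_(t in `[t1, t2]) fx (x, t)).
Proof.
move=> /andP[x1x xx2] df cf.
have mB : measurable (`[t1, t2]%classic : set R) by exact: measurable_itv.
have inB (y t : R) : y \in `]x1, x2[ -> t1 <= t <= t2 -> box x1 x2 t1 t2 (y, t).
  by rewrite in_itv /= => /andP[? ?] tt; apply/boxP; split => //=; rewrite !ltW.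
have [C C0 HC] := box_bounded (fun z Bz => (cf z Bz).2).
have Ix : (`]x1, x2[%classic : set R) x by rewrite /= in_itv /= x1x.
pose F y t := f (y, t).
have Fi y : (`]x1, x2[%classic : set R) y -> mu.-integrable `[t1, t2] (EFin \o F y).
  by move=> yI; apply: slice_integrable => t tt; exact: (cf _ (inB _ _ yI tt)).1.
have p1 y t : (`]x1, x2[%classic : set R) y -> `[t1, t2]%classic t -> is_derive y 1 (F ^~ t) (fx (y, t)).
  by move=> yI; rewrite /= in_itv /= => tt; exact: df (inB _ _ yI tt).
have dd y t : (`]x1, x2[%classic : set R) y -> `[t1, t2]%classic t -> derivable (F ^~ t) y 1.
  by move=> yI tt; exact: is_derive_derivable (p1 _ _ yI tt).
have iG : mu.-integrable `[t1, t2] (EFin \o (fun _ : R => C)).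
  by apply: continuous_compact_integrable; [exact: segment_compact|exact: cst_continuous].
have GU y t : (`]x1, x2[%classic : set R) y -> `[t1, t2]%classic t -> `|partial1of2 F y t| <= C.
  move=> yI tt; rewrite /partial1of2 (is_derive_derive1 (p1 _ _ yI tt)); apply: HC.
  by apply: inB => //; move: tt; rewrite /= in_itv.
have := @derivable_under_integral _ _ _ mu F _ mB x x1 x2 Ix Fi dd _ (fun _ => C0) iG GU.
move=> /derivable_is_derive.
rewrite (@differentiation_under_integral _ _ _ mu F _ mB x x1 x2 Ix Fi dd _ (fun _ => C0) iG GU).
apply: is_derive_val; apply: eq_Rintegral => t /set_mem tt.
by rewrite /partial1of2 (is_derive_derive1 (p1 _ _ Ix tt)).
Qed.

Lemma slice_FTC (F f : R -> R) (t1 t2 : R) : t1 < t2 ->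
  (forall t, t1 <= t <= t2 -> is_derive t 1 F (f t)) ->
  {within `[t1, t2], continuous f} ->
  \int[mu]_(t in `[t1, t2]) f t = F t2 - F t1.
Proof.
move=> t12 dF cf; rewrite /Rintegral (@continuous_FTC2 _ f F)//.
- split.
  + move=> t; rewrite in_itv /= => /andP[/ltW a /ltW b].
    by apply: (is_derive_derivable (dF t _)); rewrite a.
  + by apply: cvg_at_right_filter; apply: (is_derive_cont (dF _ _)); rewrite lexx ltW.
  + by apply: cvg_at_left_filter; apply: (is_derive_cont (dF _ _)); rewrite lexx ltW.
- move=> t; rewrite in_itv /= => /andP[/ltW a /ltW b].
  by apply: (is_derive_derive1 (dF t _)); rewrite a.
Qed.

Lemma Rintegral_lower (f : R -> R) (t1 t2 c d k : R) : t1 <= c -> c <= d -> d <= t2 -> 0 <= k ->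
  mu.-integrable `[t1, t2] (EFin \o f) ->
  (forall t, t1 <= t <= t2 -> 0 <= f t) -> (forall t, c <= t <= d -> k <= f t) ->
  k * (d - c) <= \int[mu]_(t in `[t1, t2]) f t.
Proof.
move=> tc cd dt k0 fi f0 fk.
have mf : measurable_fun `[t1, t2] (EFin \o f) by exact: measurable_int fi.
have sub : (`[c, d]%classic : set R) `<=` `[t1, t2].
  by move=> t; rewrite /= !in_itv /= => /andP[a b]; rewrite (le_trans tc a) (le_trans b dt).
rewrite -lee_fin /Rintegral fineK; last by exact: integrable_fin_num fi.
apply: (@le_trans _ _ (\int[mu]_(t in `[c, d]) (f t)%:E)%E).
  have -> : (k * (d - c))%:E = (\int[mu]_(t in `[c, d]) (cst k%:E) t)%E.
    rewrite integral_cst; last exact: measurable_itv.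
    rewrite EFinM; congr (_ * _)%E.
    have := @lebesgue_measure_itv R `[c, d]; rewrite /= lte_fin.
    have [->|cd'] := eqVneq c d; first by rewrite ltxx subrr.
    by rewrite lt_neqAle cd' cd -EFinB => ->.
  apply: ge0_le_integral => //.
  exact: measurable_funS mf.
exact: ge0_subset_integral.
Qed.

Lemma Rintegral_upper_norm (f : R -> R) (t1 t2 k : R) : t1 <= t2 ->
  mu.-integrable `[t1, t2] (EFin \o f) ->
  (forall t, t1 <= t <= t2 -> `|f t| <= k) ->
  `|\int[mu]_(t in `[t1, t2]) f t| <= k * (t2 - t1).
Proof.
move=> t12 fi fk.
have mI : measurable (`[t1, t2]%classic : set R) by exact: measurable_itv.
have ik : mu.-integrable `[t1, t2] (EFin \o (fun _ : R => k)).
  by apply: continuous_compact_integrable; [exact: segment_compact|exact: cst_continuous].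
apply: (le_trans (@le_normr_Rintegral _ _ _ mu _ f mI fi)).
have -> : k * (t2 - t1) = \int[mu]_(t in `[t1, t2]) k.
  rewrite (@Rintegral_cst _ _ _ mu)//; congr (_ * _).
  have := @lebesgue_measure_itv R `[t1, t2]; rewrite /= lte_fin.
  have [->|t12'] := eqVneq t1 t2; first by rewrite ltxx subrr => ->.
  by rewrite lt_neqAle t12' t12 -EFinB => ->.
apply: (@le_Rintegral _ _ _ mu) => //.
exact: integrable_norm fi.
Qed.

End ParametricIntegrals.

(** * Unique continuation from vanishing lateral data *)

Section CarlemanUniqueness.
Context {R : realType}.
Local Notation mu := (@lebesgue_measure R).

Lemma expR_beats_cubic (k c L s0 : R) : 0 < k -> 0 < c ->
  (forall s, s0 <= s -> k * expR (s * c) <= L * s ^+ 3) -> False.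
Proof.
move=> k0 c0 H.
(* beyond this value k times the term of order four of the exponential exceeds L s^3 *)
pose s := `|s0| + 1 + `|L| * 24 / (k * c ^+ 4).
have d0 : 0 < k * c ^+ 4 by rewrite mulr_gt0// exprn_gt0.
have q0 : 0 <= `|L| * 24 / (k * c ^+ 4) by rewrite divr_ge0 ?mulr_ge0// ltW.
have s1 : 0 < s by rewrite /s; have := normr_ge0 s0; move: q0; lra.
have s0s : s0 <= s by rewrite /s; have := ler_norm s0; move: q0; lra.
have s3 : 0 < s ^+ 3 by rewrite exprn_gt0.
have := H s s0s; have := @expR_ge1Dxn R (s * c) 3 _; rewrite ltW ?mulr_gt0// => /(_ isT).
rewrite (_ : 4`!%:R = 24 :> R)// => E1 E2.
have E3 : k * ((s * c) ^+ 4 / 24) <= `|L| * s ^+ 3.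
  apply: le_trans (ler_wpM2r (ltW s3) (ler_norm L)); apply: le_trans E2.
  by rewrite ler_wpM2l ?(ltW k0)//; move: E1; lra.
have E4 : s ^+ 3 * (s * (k * c ^+ 4)) <= s ^+ 3 * (`|L| * 24).
  by move: E3; rewrite exprMn; set u := s ^+ 3; rewrite [s ^+ 4]exprS -/u; lra.
have E5 : s <= `|L| * 24 / (k * c ^+ 4) by rewrite ler_pdivlMr// -(ler_pM2l s3).
by move: E5; rewrite /s; have := normr_ge0 s0; lra.
Qed.

Lemma deriv_le_increment (G g : R -> R) (a b k : R) : a <= b ->
  (forall x, a <= x <= b -> is_derive x 1 G (g x) /\ g x <= k) ->
  G b - G a <= k * (b - a).
Proof.
move=> ab H.
have [x|c] := @MVT_sym R G g a b; rewrite (min_idPl ab) (max_idPr ab).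
  by move=> /H[].
by move=> /H[_ gk] ->; apply: ler_wpM2r => //; rewrite subr_ge0.
Qed.

(** A bound for the coefficient of s^3 in J and K where exp(s phi) is at most 1: there v is
    bounded, v_x and v_t are at most linear in s, and q is at most quadratic. *)
Definition boundary_const (B : R) : R :=
  let p := B + B ^+ 2 in 2 * p ^+ 2 + 2 * B * p ^+ 2 + 2 * B * p + 2 * B ^+ 3 * p.

Lemma cJK_polynomial (m t0 kappa s B : R) (Y Yx Yt : R * R -> R) (z : R * R) :
  1 <= s -> 1 <= B -> wphi m t0 kappa z <= 0 ->
  `|Y z| <= B -> `|Yx z| <= B -> `|Yt z| <= B -> `|wr m z| <= B -> `|wphit t0 kappa z| <= B ->
  `|cJ m t0 kappa s Y Yx Yt z| <= boundary_const B * s ^+ 3 /\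
  `|cK m t0 kappa s Y Yx z| <= boundary_const B * s ^+ 3.
Proof.
move=> s1 B1 p0 HY HYx HYt Hr Hp.
set p := B + B ^+ 2.
have s0 : 0 <= s by lra.
have B0 : 0 <= B by lra.
have pB : 0 <= p by rewrite addr_ge0// sqr_ge0.
have E0 : 0 <= wE m t0 kappa s z by exact: expR_ge0.
have E1 : wE m t0 kappa s z <= 1 by rewrite -expR0 ler_expR mulr_ge0_le0.
have Eb (u k : R) : `|u| <= k -> `|wE m t0 kappa s z * u| <= k.
  by move=> uk; rewrite normrM (ger0_norm E0) (le_trans _ uk)// ler_piMl.
have Mb (u v k l : R) : `|u| <= k -> `|v| <= l -> `|u * v| <= k * l.
  by move=> uk vl; rewrite normrM ler_pM.
have sn : `|s| <= s by rewrite ger0_norm.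
have BsB : B <= s * B by rewrite ler_peMl.
have lin (u v : R) : `|u| <= B -> `|v| <= B * B -> `|u + s * v| <= s * p.
  move=> ub vb; apply: le_trans (ler_normD _ _) _.
  have := Mb s v _ _ sn vb; rewrite /p; move: ub BsB; rewrite expr2; lra.
have h0 : `|cv m t0 kappa s Y z| <= B by exact: Eb.
have h1 : `|cvx m t0 kappa s Y Yx z| <= s * p.
  by apply: Eb; rewrite -mulrA; apply: lin => //; exact: Mb.
have h2 : `|cvt m t0 kappa s Y Yt z| <= s * p.
  by apply: Eb; rewrite -mulrA; apply: lin => //; exact: Mb.
have hq : `|cq m t0 kappa s z| <= s * (s * p).
  rewrite /cq !expr2 -!mulrA -mulrDr; apply: (Mb) => //; rewrite addrC.
  by apply: lin => //; exact: Mb.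
have h11 := Mb _ _ _ _ h1 h1. have h12 := Mb _ _ _ _ h1 h2. have h01 := Mb _ _ _ _ h0 h1.
have h00 := Mb _ _ _ _ h0 h0. have hq00 := Mb _ _ _ _ hq h00.
have hr11 := Mb _ _ _ _ Hr h11. have hrq := Mb _ _ _ _ Hr hq00.
have ss : s ^+ 2 <= s ^+ 3 by rewrite [leRHS]exprS ler_peMl// sqr_ge0.
have p20 : 0 <= p ^+ 2 by exact: sqr_ge0.
have Bp : 0 <= B * p by rewrite mulr_ge0.
have Bpp : 0 <= B * p ^+ 2 by rewrite mulr_ge0.
have B3p : 0 <= B ^+ 3 * p by rewrite mulr_ge0// exprn_ge0.
have B2p : 0 <= B ^+ 2 * p by rewrite mulr_ge0// exprn_ge0.
have BB : B ^+ 2 * p <= B ^+ 3 * p by rewrite ler_wpM2r// [leRHS]exprS ler_peMl// sqr_ge0.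
split.
  rewrite /cJ.
  have := Mb s _ _ _ sn hr11; have := Mb s _ _ _ sn h01; have := Mb s _ _ _ sn hrq.
  set a1 := s * _; set a2 := s * (cv _ _ _ _ _ _ * _); set a3 := s * (wr _ _ * (cvx _ _ _ _ _ _ _ * _)).
  rewrite -[2 * s * (cv _ _ _ _ _ _ * _)]mulrA -[2 * s * (wr _ _ * (cvx _ _ _ _ _ _ _ * _))]mulrA.
  rewrite -[2 * s * (wr _ _ * (cq _ _ _ _ _ * _))]mulrA -/a1 -/a2 -/a3.
  move: h12; set a0 := cvx _ _ _ _ _ _ _ * _.
  move: (ler_wpM2r p20 ss) (ler_wpM2r Bp ss).
  rewrite /boundary_const -/p => e1 e2 b0 b1 b2 b3.
  have nrm : `|- 2 * a0 - 2 * a3 - 2 * a2 - 2 * a1| <= 2 * `|a0| + 2 * `|a3| + 2 * `|a2| + 2 * `|a1|.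
    apply: le_trans (ler_normB _ _) _; apply: lerD; last by rewrite normrM ger0_norm.
    apply: le_trans (ler_normB _ _) _; apply: lerD; last by rewrite normrM ger0_norm.
    apply: le_trans (ler_normB _ _) _; apply: lerD; last by rewrite normrM ger0_norm.
    by rewrite mulNr normrN normrM ger0_norm.
  apply: le_trans nrm _; move: b0 b1 b2 b3 e1 e2 => {h0 h1 h2 hq h11 h01 h00 hq00 hr11 hrq}.
  lra.
rewrite /cK; apply: le_trans (ler_normB _ _) _.
have s30 : 0 <= s ^+ 3 by rewrite exprn_ge0.
have e1 := ler_wpM2r p20 ss; have e2 := ler_wpM2r B2p ss; have e3 := ler_wpM2l s30 BB.
have e4 := mulr_ge0 s30 p20; have e5 := mulr_ge0 s30 Bp; have e6 := mulr_ge0 s30 Bpp.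
have e7 := mulr_ge0 s30 B3p.
rewrite /boundary_const -/p; move: h11 hq00 e1 e2 e3 e4 e5 e6 e7 => {h0 h1 h2 hq h12 h01 h00 hr11 hrq}.
lra.
Qed.

Lemma dist_lt_of_segment (u v q r : R) : 0 < r -> q <= r / 2 -> u - q <= v -> v <= u + q ->
  `|u - v| < r.
Proof. by move=> ? ? ? ?; rewrite ltr_norml; apply/andP; split; lra. Qed.

Section Rectangle.
Variables (Y Yx Yxx Yt Yxt : R * R -> R) (l' l m m' t1 t2 C : R).
Hypotheses (l'l : l' < l) (lm : l < m) (mm' : m < m') (t12 : t1 < t2).
Hypothesis reg : forall z, box l' m' t1 t2 z ->
  [/\ is_derive z.1 1 (fun x => Y (x, z.2)) (Yx z),
      is_derive z.1 1 (fun x => Yx (x, z.2)) (Yxx z),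
      is_derive z.1 1 (fun x => Yt (x, z.2)) (Yxt z),
      is_derive z.2 1 (fun t => Y (z.1, t)) (Yt z) &
      is_derive z.2 1 (fun t => Yx (z.1, t)) (Yxt z)].
Hypothesis cont : forall z, box l' m' t1 t2 z ->
  [/\ cont_at z Y, cont_at z Yx, cont_at z Yxx, cont_at z Yt & cont_at z Yxt].
Hypothesis ineq : forall z, box l' m' t1 t2 z -> `|Yt z - Yxx z| <= C * `|Yx z|.
Hypothesis start : forall t, t1 <= t <= t2 -> Y (l, t) = 0 /\ Yx (l, t) = 0.

Let t0 := (t1 + t2) / 2.
(* the smallest kappa for which the weight is nonpositive at t1 and t2 on [l, m] *)
Let kappa := ((l - (m + 1)) ^+ 2 - 1) / 2 / ((t2 - t1) / 2) ^+ 2.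

Lemma kappa_ge0 : 0 <= kappa.
Proof.
rewrite /kappa divr_ge0 ?sqr_ge0// divr_ge0// subr_ge0.
have : 0 <= (m - l) ^+ 2 by exact: sqr_ge0.
by rewrite !expr2; move: lm; nra.
Qed.

Lemma wphi_ends x t : l <= x <= m -> (t = t1 \/ t = t2) -> wphi m t0 kappa (x, t) <= 0.
Proof.
move=> /andP[lx xm] tt; rewrite /wphi /wr /=.
have -> : kappa * (t - t0) ^+ 2 = ((l - (m + 1)) ^+ 2 - 1) / 2.
  have -> : (t - t0) ^+ 2 = ((t2 - t1) / 2) ^+ 2 by rewrite /t0; case: tt => ->; field.
  by rewrite /kappa divfK// expf_eq0 /= gt_eqF// divr_gt0// subr_gt0.
have : (x - (m + 1)) ^+ 2 <= (l - (m + 1)) ^+ 2 by rewrite !expr2; move: lx xm lm; nra.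
lra.
Qed.

Lemma wphi_right t : wphi m t0 kappa (m, t) <= 0.
Proof.
rewrite /wphi /wr /=; have := mulr_ge0 kappa_ge0 (sqr_ge0 (t - t0)).
by rewrite (_ : m - (m + 1) = - 1); [rewrite sqrrN expr1n; lra|ring].
Qed.

Lemma wr_ge1 z : z.1 <= m -> 1 <= wr m z ^+ 2.
Proof. by move=> zm; rewrite /wr expr2; move: zm; nra. Qed.

Lemma carleman_coefficients : exists2 A : R, 0 <= A & forall s x t, 1 <= s -> l <= x <= m ->
  t1 <= t <= t2 -> wphi m t0 kappa (x, t) <= 0 ->
  `|cJ m t0 kappa s Y Yx Yt (x, t)| <= A * s ^+ 3 /\
  `|cK m t0 kappa s Y Yx (x, t)| <= A * s ^+ 3.
Proof.
have cs z : box l' m' t1 t2 z -> [/\ cont_at z Y, cont_at z Yx & cont_at z Yt] by move=> /cont[].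
have [B1 B10 H1] := box_bounded (fun z Bz => let: And3 h _ _ := cs z Bz in h).
have [B2 B20 H2] := box_bounded (fun z Bz => let: And3 _ h _ := cs z Bz in h).
have [B3 B30 H3] := box_bounded (fun z Bz => let: And3 _ _ h := cs z Bz in h).
have [B4 B40 H4] := box_bounded (fun z (_ : box l' m' t1 t2 z) => @wr_cont R m z).
have [B5 B50 H5] := box_bounded (fun z (_ : box l' m' t1 t2 z) => @wphit_cont R t0 kappa z).
pose B := 1 + B1 + B2 + B3 + B4 + B5.
have B0 : 1 <= B by rewrite /B; lra.
exists (boundary_const B).
  rewrite /boundary_const; have pp : 0 <= B + B ^+ 2 by rewrite addr_ge0 ?sqr_ge0//; lra.
  by rewrite !addr_ge0 ?mulr_ge0 ?exprn_ge0//; lra.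
move=> s x t s1 /andP[lx xm] tt p0.
have Bz : box l' m' t1 t2 (x, t).
  by apply/boxP; split => //=; rewrite (le_trans (ltW l'l) lx) (le_trans xm (ltW mm')).
apply: cJK_polynomial => //.
- by apply: le_trans (H1 _ Bz) _; rewrite /B; lra.
- by apply: le_trans (H2 _ Bz) _; rewrite /B; lra.
- by apply: le_trans (H3 _ Bz) _; rewrite /B; lra.
- by apply: le_trans (H4 _ Bz) _; rewrite /B; lra.
- by apply: le_trans (H5 _ Bz) _; rewrite /B; lra.
Qed.

(** The integral of J over a time slice is zero at x = l, bounded by a multiple of s^3 at
    x = m, and decreases in x at least at the rate of the integral of v^2 minus the values
    of K at t1 and t2, which are O(s^3) too. *)
Lemma carleman_integrated : exists A : R, forall s c d e g k,
  1 + C ^+ 2 + kappa <= s -> l <= c -> c <= d -> d <= m -> t1 <= e -> e <= g -> g <= t2 -> 0 <= k ->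
  (forall z, box c d e g z -> k <= cv m t0 kappa s Y z * cv m t0 kappa s Y z) ->
  k * (g - e) * (d - c) <= A * s ^+ 3.
Proof.
have [A A0 HA] := carleman_coefficients.
exists (A * (2 * (m - l) + (t2 - t1))) => s c d e g k ss lc cd dm te eg gt k0 Hk.
have C2 := sqr_ge0 C. have K0 := kappa_ge0.
have s1 : 1 <= s by lra.
have inB x t : l <= x <= m -> t1 <= t <= t2 -> box l' m' t1 t2 (x, t).
  move=> /andP[lx xm] tt; apply/boxP; split => //=.
  by rewrite (le_trans (ltW l'l) lx) (le_trans xm (ltW mm')).
have CC z : box l' m' t1 t2 z -> [/\ cont_at z (cJ m t0 kappa s Y Yx Yt),
    cont_at z (cJx m t0 kappa s Y Yx Yxx Yt Yxt), cont_at z (cKt m t0 kappa s Y Yx Yt Yxt)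
    & cont_at z (cv m t0 kappa s Y)].
  by move=> /cont[? ? ? ? ?]; exact: conjugation_cont.
pose J := cJ m t0 kappa s Y Yx Yt; pose Jx := cJx m t0 kappa s Y Yx Yxx Yt Yxt.
pose Kt := cKt m t0 kappa s Y Yx Yt Yxt; pose K := cK m t0 kappa s Y Yx.
pose v := cv m t0 kappa s Y.
pose G x := \int[mu]_(t in `[t1, t2]) J (x, t).
pose G' x := \int[mu]_(t in `[t1, t2]) Jx (x, t).
have dG x : l <= x <= m -> is_derive x 1 G (G' x).
  move=> /andP[lx xm]; apply: (@is_derive_slice_integral R J Jx l' m').
  - by rewrite (lt_le_trans l'l lx) (le_lt_trans xm mm').
  - by move=> z /reg[dY dYx dYt _ _]; case: z dY dYx dYt => y t; exact: cJ_dx.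
  - by move=> z /CC[].
have vv x t : l <= x <= m -> t1 <= t <= t2 -> cont_at (x, t) (fun z => v z * v z).
  by move=> xx tt; have [_ _ _ ?] := CC _ (inB _ _ xx tt); exact: cont_atM.
have iv x : l <= x <= m -> mu.-integrable `[t1, t2] (EFin \o (fun t => v (x, t) * v (x, t))).
  by move=> xx; apply: (slice_integrable (f := fun z => v z * v z)) => t tt; exact: vv.
have G'le x : l <= x <= m -> G' x <= 2 * A * s ^+ 3 - \int[mu]_(t in `[t1, t2]) (v (x, t) * v (x, t)).
  move=> xx; have [lx xm] := andP xx.
  have iJx : mu.-integrable `[t1, t2] (EFin \o (fun t => Jx (x, t))).
    by apply: slice_integrable => t tt; have [] := CC _ (inB _ _ xx tt).
  have iKt : mu.-integrable `[t1, t2] (EFin \o (fun t => Kt (x, t))).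
    by apply: slice_integrable => t tt; have [] := CC _ (inB _ _ xx tt).
  have iJK : mu.-integrable `[t1, t2] (EFin \o (fun t => Jx (x, t) + Kt (x, t))).
    apply: (slice_integrable (f := fun z => Jx z + Kt z)) => t tt.
    by have [_ ? ? _] := CC _ (inB _ _ xx tt); exact: cont_atD.
  have iJKv : mu.-integrable `[t1, t2] (EFin \o (fun t => Jx (x, t) + Kt (x, t) + v (x, t) * v (x, t))).
    apply: (slice_integrable (f := fun z => Jx z + Kt z + v z * v z)) => t tt.
    have [_ ? ? _] := CC _ (inB _ _ xx tt).
    by apply: (cont_atD (f := fun z => Jx z + Kt z)); [exact: cont_atD|exact: vv].
  have IKt : \int[mu]_(t in `[t1, t2]) Kt (x, t) = K (x, t2) - K (x, t1).
    apply: (@slice_FTC R (fun t => K (x, t)) (fun t => Kt (x, t))) => // [t tt|].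
      by have [_ _ _ dt dxt] := reg (inB _ _ xx tt); exact: cK_dt.
    by apply: slice_continuous => t tt; have [] := CC _ (inB _ _ xx tt).
  have mI : measurable (`[t1, t2]%classic : set R) by exact: measurable_itv.
  have HS : \int[mu]_(t in `[t1, t2]) (Jx (x, t) + Kt (x, t) + v (x, t) * v (x, t)) <= 0.
    rewrite -[leRHS](mul0r (fine (mu `[t1, t2]))) -(@Rintegral_cst _ _ _ mu)//.
    apply: (@le_Rintegral _ _ _ mu) => //.
      by apply: continuous_compact_integrable; [exact: segment_compact|exact: cst_continuous].
    move=> t; rewrite /= in_itv /= => tt.
    have h1 : C ^+ 2 <= s by lra.
    have h2 : kappa <= s by lra.
    have := carleman_pointwise t0 Y Yxt K0 (wr_ge1 (z := (x, t)) xm) s1 h1 h2 (ineq (inB _ _ xx tt)).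
    by rewrite -/(Jx _) -/(Kt _) -/(v _); lra.
  have h3 : wphi m t0 kappa (x, t1) <= 0 by apply: wphi_ends => //; left.
  have h4 : wphi m t0 kappa (x, t2) <= 0 by apply: wphi_ends => //; right.
  have [_ k1] := HA s x t1 s1 xx (introT andP (conj (lexx _) (ltW t12))) h3.
  have [_ k2] := HA s x t2 s1 xx (introT andP (conj (ltW t12) (lexx _))) h4.
  move: HS; rewrite (@RintegralD _ _ _ mu)//; last exact: iv.
  rewrite (@RintegralD _ _ _ mu)// IKt -/(G' x).
  move: k1 k2; rewrite -/K !ler_norml => /andP[_ k1] /andP[k2 _]; lra.
have vv0 x : l <= x <= m -> 0 <= \int[mu]_(t in `[t1, t2]) (v (x, t) * v (x, t)).
  by move=> xx; apply: Rintegral_ge0 => t _; rewrite -expr2 sqr_ge0.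
have A3 : 0 <= A * s ^+ 3 by rewrite mulr_ge0// exprn_ge0//; lra.
have G1 : G c - G l <= 2 * A * s ^+ 3 * (c - l).
  apply: (deriv_le_increment (g := G')) => // x /andP[lx xc].
  have xx : l <= x <= m by rewrite lx (le_trans xc)// (le_trans cd).
  by split; [exact: dG|apply: le_trans (G'le x xx) _; rewrite gerBl; exact: vv0].
have G2 : G d - G c <= (2 * A * s ^+ 3 - k * (g - e)) * (d - c).
  apply: (deriv_le_increment (g := G')) => // x /andP[cx xd].
  have xx : l <= x <= m by rewrite (le_trans lc cx) (le_trans xd dm).
  split; first exact: dG.
  apply: le_trans (G'le x xx) _; rewrite lerD2l lerN2.
  apply: Rintegral_lower => //; first exact: iv.
    by move=> t _; rewrite -expr2 sqr_ge0.
  by move=> t tt; apply: Hk; apply/boxP; rewrite /= cx xd.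
have G3 : G m - G d <= 2 * A * s ^+ 3 * (m - d).
  apply: (deriv_le_increment (g := G')) => // x /andP[dx xm].
  have xx : l <= x <= m by rewrite xm (le_trans lc)// (le_trans cd).
  by split; [exact: dG|apply: le_trans (G'le x xx) _; rewrite gerBl; exact: vv0].
have Gl : G l = 0.
  have mI : measurable (`[t1, t2]%classic : set R) by exact: measurable_itv.
  rewrite /G -[RHS](mul0r (fine (mu `[t1, t2]))) -(@Rintegral_cst _ _ _ mu)//.
  apply: eq_Rintegral => t /set_mem; rewrite /= in_itv /= => tt.
  have [Y0 Yx0] := start tt.
  by rewrite /J /cJ /cvx /cv Y0 Yx0; ring.
have Gm : - (A * s ^+ 3 * (t2 - t1)) <= G m.
  have lmm : l <= m <= m by rewrite lexx ltW.
  have : `|G m| <= A * s ^+ 3 * (t2 - t1).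
    apply: Rintegral_upper_norm; first exact: ltW.
      by apply: slice_integrable => t tt; have [] := CC _ (inB _ _ lmm tt).
    by move=> t tt; have [] := HA s m t s1 lmm tt (wphi_right t).
  by rewrite ler_norml => /andP[].
move: G1 G2 G3 Gm; rewrite Gl; set S := s ^+ 3.
by move: (G c) (G d) (G m) S => u1 u2 u3 S; lra.
Qed.

(** Near a point with x < m where Y does not vanish the weight is bounded below by a positive
    number, so v^2 would grow exponentially in s, against [carleman_integrated]. *)
Theorem carleman_uniqueness x : l <= x -> x < m -> Y (x, t0) = 0.
Proof.
move=> lx xm; apply/eqP; apply: contraT => Y0.
have [A HA] := carleman_integrated.
have tt0 : t1 < t0 < t2 by rewrite /t0; apply/andP; split; move: t12; lra.
have [tt1 tt2] := andP tt0.
pose z0 := (x, t0) : R * R.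
have Bz0 : box l' m' t1 t2 z0.
  by apply/boxP; rewrite /= (le_trans (ltW l'l) lx) (ltW (lt_trans xm mm')) !ltW.
have [cY _ _ _ _] := cont Bz0.
have p0 : 0 < wphi m t0 kappa z0.
  by rewrite /wphi /wr /= subrr expr0n /= mulr0 subr0 divr_gt0// subr_gt0 expr2; move: xm; nra.
have cY2 : cont_at z0 (fun z => Y z * Y z) by exact: cont_atM.
have e0 : 0 < Y z0 * Y z0 by rewrite -expr2 exprn_even_gt0.
have [r r0 Hr] : exists2 r : R, 0 < r & forall z, `|z0.1 - z.1| < r -> `|z0.2 - z.2| < r ->
    Y z0 * Y z0 / 2 <= Y z * Y z /\ wphi m t0 kappa z0 / 2 <= wphi m t0 kappa z.
  have n1 : \forall z \near z0, Y z0 * Y z0 / 2 < Y z * Y z.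
    have h : (Y z * Y z) @[z --> z0] --> Y z0 * Y z0 by exact: cY2.
    by apply: (cvgr_gt _ h); lra.
  have n2 : \forall z \near z0, wphi m t0 kappa z0 / 2 < wphi m t0 kappa z.
    have h : wphi m t0 kappa z @[z --> z0] --> wphi m t0 kappa z0 by exact: wphi_cont.
    by apply: (cvgr_gt _ h); lra.
  have [r /= r0 Hr] := (nbhs_ballP _ _).1 (filterI n1 n2).
  by exists r => // z a b; have [/ltW ? /ltW ?] := Hr z (conj a b).
pose q := Num.min (r / 2) (Num.min (m - x) (Num.min (t0 - t1) (t2 - t0))).
have q0 : 0 < q by rewrite !lt_min divr_gt0// !subr_gt0 xm tt1.
have [qr [qm [q1 q2]]] : q <= r / 2 /\ q <= m - x /\ q <= t0 - t1 /\ q <= t2 - t0.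
  by have := lexx q; rewrite {2}/q !le_min => /and4P[].
have E2 : 0 < Y z0 * Y z0 / 2 * (2 * q) * q by apply: mulr_gt0 => //; apply: mulr_gt0; [exact: divr_gt0|exact: mulr_gt0].
apply: False_rec; apply: (expR_beats_cubic (s0 := 1 + C ^+ 2 + kappa) (L := A) E2 p0) => s ss.
have s0 : 0 <= s by have := kappa_ge0; have := sqr_ge0 C; lra.
have := HA s x (x + q) (t0 - q) (t0 + q) (Y z0 * Y z0 / 2 * expR (s * wphi m t0 kappa z0)) ss lx.
have h1 : x <= x + q by lra.
have h2 : x + q <= m by lra.
have h3 : t1 <= t0 - q by lra.
have h4 : t0 - q <= t0 + q by lra.
have h5 : t0 + q <= t2 by lra.
have h6 : 0 <= Y z0 * Y z0 / 2 * expR (s * wphi m t0 kappa z0).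
  by rewrite mulr_ge0 ?expR_ge0// divr_ge0// ltW.
move=> /(_ h1 h2 h3 h4 h5 h6) H.
apply: le_trans (H _); last first.
  move=> z /boxP[/andP[a b] /andP[c d]].
  have d1 : `|z0.1 - z.1| < r by apply: dist_lt_of_segment qr _ _ => //=; rewrite (le_trans _ a)// gerBl ltW.
  have d2 : `|z0.2 - z.2| < r by exact: dist_lt_of_segment qr _ _.
  have [HY Hp] := Hr _ d1 d2.
  rewrite /cv mulrACA mulrC; apply: ler_pM => //; first by apply: divr_ge0; [exact: ltW|].
  rewrite /wE -expRD ler_expR -mulrDr ler_wpM2l//.
  by rewrite [leLHS]splitr lerD.
rewrite le_eqVlt; apply/orP; left; apply/eqP; ring.
Qed.

End Rectangle.

End CarlemanUniqueness.

(** * Limits from the right and quadratic contact *)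

Section RightLimits.
Context {R : realType}.
Implicit Types (f g : R -> R).

Lemma right_limit_le f (c x u k : R) : c < x -> f s @[s --> c^'+] --> 0 ->
  (forall s, c < s < x -> u <= `|f s| + k) -> u <= k.
Proof.
move=> cx f0 H; apply/ler_addgt0Pr => e e0.
have H1 : \forall s \near c^'+, `|f s| <= e.
  by move/cvgr0Pnorm_le : f0; apply.
have [s [[cs sx] fs]] : exists s : R, (c < s /\ s < x) /\ `|f s| <= e.
  have H2 : \forall s \near c^'+, (c < s /\ s < x) /\ `|f s| <= e.
    near=> s; split; last by near: s.
    by split; near: s; [exact: nbhs_right_gt|exact: nbhs_right_lt].
  by have [s Hs] := filter_ex H2; exists s.
apply: le_trans (H s _) _; first by rewrite cs.
by rewrite addrC lerD2l.
Unshelve. all: by end_near.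
Qed.

Lemma right_limit0_of_linear f (c x k : R) : c < x -> 0 <= k ->
  (forall s, c < s <= x -> `|f s| <= k * (s - c)) -> f s @[s --> c^'+] --> 0.
Proof.
move=> cx k0 H; apply/cvgr0Pnorm_le => e e0.
have k1 : 0 < k + 1 by rewrite ltr_wpDl.
near=> s.
have cs : c < s by near: s; exact: nbhs_right_gt.
have sx : s <= x by near: s; exact: nbhs_right_ltW.
have se : s < c + e / (k + 1) by near: s; apply: nbhs_right_lt; rewrite ltrDl divr_gt0.
apply: le_trans (H s _) _; first by rewrite cs.
have : (s - c) * (k + 1) < e by rewrite -ltr_pdivlMr// ltrBlDl.
by have : 0 <= s - c; [rewrite subr_ge0 ltW|lra].
Unshelve. all: by end_near.
Qed.

(** The mean value theorem up to an endpoint where only a limit is known. *)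
Lemma right_limit_increment f df (c x k : R) : c < x -> f s @[s --> c^'+] --> 0 ->
  (forall s, c < s <= x -> is_derive s 1 f (df s) /\ `|df s| <= k) -> `|f x| <= k * (x - c).
Proof.
move=> cx f0 H.
have k0 : 0 <= k by have [_] := H x (introT andP (conj cx (lexx x))); apply: le_trans.
apply: (right_limit_le cx f0) => s /andP[cs sx].
have -> : f x = f s + (f x - f s) by ring.
apply: le_trans (ler_normD _ _) _; rewrite lerD2l.
have inr u : Num.min s x <= u <= Num.max s x -> c < u <= x.
  rewrite (min_idPl (ltW sx)) (max_idPr (ltW sx)) => /andP[su ->].
  by rewrite (lt_le_trans cs su).
apply: (@le_trans _ _ (k * `|x - s|)).
  by apply: (@lipschitz_of_deriv _ f df) => u /inr /H [].
apply: ler_wpM2l => //; rewrite ger0_norm; first by rewrite lerD2l lerN2 ltW.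
by rewrite subr_ge0 ltW.
Qed.

Lemma cont_at_fst (z : R * R) : cont_at z (fun z => z.1). Proof. exact: cvg_fst. Qed.
Lemma cont_at_snd (z : R * R) : cont_at z (fun z => z.2). Proof. exact: cvg_snd. Qed.

Lemma cont_at_gt (f : R * R -> R) (z : R * R) (k : R) : cont_at z f -> k < f z ->
  \forall s \near z, k < f s.
Proof. by move=> h; exact: (cvgr_gt _ h). Qed.

Lemma cont_at_lt (f : R * R -> R) (z : R * R) (k : R) : cont_at z f -> f z < k ->
  \forall s \near z, f s < k.
Proof. by move=> h; exact: (cvgr_lt _ h). Qed.

Lemma cont_at_near (f g : R * R -> R) (z : R * R) : (\forall s \near z, f s = g s) ->
  cont_at z g -> cont_at z f.
Proof.
move=> fg /cvgrPdist_le cg; apply/cvgrPdist_le => r r0.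
rewrite (nbhs_singleton fg); near=> s.
have -> : f s = g s by near: s.
by near: s; exact: cg.
Unshelve. all: by end_near.
Qed.

Lemma is_derive_near (f g : R -> R) (x d : R) : (\forall s \near x, f s = g s) ->
  is_derive x 1 f d -> is_derive x 1 g d.
Proof.
move=> fg fd; apply/is_deriveP => r r0; have [q q0 Hq] := (is_deriveP f x d).1 fd r r0.
have [q' /= q'0 Hq'] := (nbhs_ballP _ _).1 fg.
exists (Num.min q q'); first by rewrite lt_min q0.
move=> h; rewrite lt_min => /andP[hq hq'].
rewrite -(nbhs_singleton fg) -(Hq' (x + h)); first exact: Hq.
by rewrite /ball /= opprD addrA subrr sub0r normrN.
Qed.

Lemma is_derive0_quadratic (f : R -> R) (x k : R) : 0 <= k ->
  (\forall s \near x, `|f s| <= k * (s - x) ^+ 2) -> is_derive x 1 f 0.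
Proof.
move=> k0 fk; apply/is_deriveP => r r0.
have [q /= q0 Hq] := (nbhs_ballP _ _).1 fk.
have fx : f x = 0.
  by have := nbhs_singleton fk; rewrite subrr expr0n /= mulr0 normr_le0 => /eqP.
have k1 : 0 < k + 1 by rewrite ltr_wpDl.
exists (Num.min q (r / (k + 1))); first by rewrite lt_min q0 divr_gt0.
move=> h; rewrite lt_min => /andP[hq hr]; rewrite fx subr0 mul0r subr0.
have := Hq (x + h); rewrite /ball /= opprD addrA subrr sub0r normrN => /(_ hq) H.
apply: le_trans H _; rewrite addrAC subrr add0r -(real_normK (num_real h)) expr2 mulrA.
rewrite ler_wpM2r//; move: hr; rewrite ltr_pdivlMr//; have := normr_ge0 h; lra.
Qed.

Lemma cont_of_bounded_partials (f fx ft : R * R -> R) (z : R * R) (r C : R) : 0 < r -> 0 <= C ->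
  (forall s, box (z.1 - r) (z.1 + r) (z.2 - r) (z.2 + r) s ->
    [/\ is_derive s.1 1 (fun x => f (x, s.2)) (fx s), is_derive s.2 1 (fun t => f (s.1, t)) (ft s),
        `|fx s| <= C & `|ft s| <= C]) ->
  cont_at z f.
Proof.
case: z => x t /= r0 C0 H; apply/cvgrPdist_le => e e0.
have C1 : 0 < 2 * C + 1 by lra.
have inB (u v p : R) : p - r <= u <= p + r -> p - r <= v <= p + r ->
    forall s : R, Num.min u v <= s <= Num.max u v -> p - r <= s <= p + r.
  move=> /andP[u1 u2] /andP[v1 v2] s /andP[s1 s2]; apply/andP; split.
    by apply: le_trans s1; rewrite le_min u1.
  by apply: (le_trans s2); rewrite ge_max u2.
have ctr (p : R) : p - r <= p <= p + r by rewrite gerBl lerDl ltW.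
have {}H (u v : R) : x - r <= u <= x + r -> t - r <= v <= t + r -> _ :=
  fun ub vb => H (u, v) ((boxP (x - r) (x + r) (t - r) (t + r) (u, v)).2 (conj ub vb)).
have h1 (u v : R) : x - r <= u <= x + r -> t - r <= v <= t + r ->
    `|f (x, v) - f (u, v)| <= C * `|x - u|.
  move=> ub vb; apply: (@lipschitz_of_deriv _ (fun x => f (x, v)) (fun x => fx (x, v))) => s /(inB _ _ _ ub (ctr x)) sb.
    by have [h _ _ _] := H s v sb vb; exact: h.
  by have [] := H s v sb vb.
have h2 (u v : R) : x - r <= u <= x + r -> t - r <= v <= t + r ->
    `|f (u, t) - f (u, v)| <= C * `|t - v|.
  move=> ub vb; apply: (@lipschitz_of_deriv _ (fun t => f (u, t)) (fun t => ft (u, t))) => s /(inB _ _ _ vb (ctr t)) sb.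
    by have [_ h _ _] := H u s ub sb; exact: h.
  by have [] := H u s ub sb.
exists (ball x (Num.min r (e / (2 * C + 1))), ball t (Num.min r (e / (2 * C + 1)))).
  by split; apply: nbhsx_ballx; rewrite lt_min r0 divr_gt0.
move=> [x' t'] [/=]; rewrite /ball /= !lt_min => /andP[x1 x2] /andP[t1 t2].
have bx : x - r <= x' <= x + r by move: (ltW x1); rewrite ler_norml; lra.
have bt : t - r <= t' <= t + r by move: (ltW t1); rewrite ler_norml; lra.
have -> : f (x, t) - f (x', t') = (f (x, t) - f (x', t)) + (f (x', t) - f (x', t')) by ring.
apply: le_trans (ler_normD _ _) _.
apply: (@le_trans _ _ (C * (e / (2 * C + 1)) + C * (e / (2 * C + 1)))).
  by apply: lerD; [apply: le_trans (h1 _ _ bx (ctr t)) _|apply: le_trans (h2 _ _ bx bt) _]; rewrite ler_wpM2l// ltW.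
by rewrite -mulrDl mulrA ler_pdivrMr//; move: e0; lra.
Qed.

Lemma cont_at_swap (f : R * R -> R) (z : R * R) : cont_at (z.2, z.1) f -> cont_at z (fun s => f (s.2, s.1)).
Proof.
move=> cf; apply: (@continuous_comp _ _ _ (fun s : R * R => (s.2, s.1)) f) => //.
exact: (cvg_pair (F := nbhs z) (f := snd) (g := fst) cvg_snd cvg_fst).
Qed.

End RightLimits.

(** * Extension by zero across a Lipschitz curve *)

Section ZeroExtension.
Context {R : realType}.
Local Notation mu := (@lebesgue_measure R).
Variables (c : R -> R) (a b M L P K : R) (y D e F : R * R -> R).
Hypotheses (L0 : 0 < L) (P0 : 0 <= P) (K0 : 0 <= K).

(** In the application y is the difference of two solutions, D and e are its derivatives
    in x and t, and F is the flux of the conservation law y_t = F_x, which differs from D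
    by a multiple of y. *)
Definition right_of (z : R * R) := [/\ a < z.2 < b, c z.2 < z.1 & z.1 < M].

Hypothesis c_lip : forall t t', a < t < b -> a < t' < b -> `|c t - c t'| <= L * `|t - t'|.
Hypothesis y_dx : forall z, right_of z -> is_derive z.1 1 (fun x => y (x, z.2)) (D z).
Hypothesis y_dt : forall z, right_of z -> is_derive z.2 1 (fun t => y (z.1, t)) (e z).
Hypothesis F_dx : forall z, right_of z -> is_derive z.1 1 (fun x => F (x, z.2)) (e z).
Hypothesis F_D : forall z, right_of z -> `|F z - D z| <= K * `|y z|.
Hypothesis y_cont : forall z, right_of z -> [/\ cont_at z y, cont_at z D, cont_at z e & cont_at z F].
Hypothesis D_lip : forall x x' t, x <= x' -> right_of (x, t) -> x' < M ->
  `|D (x', t) - D (x, t)| <= P * (x' - x).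
Hypothesis e_lip : forall x t t', t <= t' -> (forall s, t <= s <= t' -> right_of (x, s)) ->
  `|e (x, t') - e (x, t)| <= P * (t' - t).
Hypothesis y_trace : forall t, a < t < b -> y (x, t) @[x --> (c t)^'+] --> 0.
Hypothesis D_trace : forall t, a < t < b -> D (x, t) @[x --> (c t)^'+] --> 0.

Lemma right_of_left x x' t : right_of (x, t) -> c t < x' <= x -> right_of (x', t).
Proof. by move=> [? ? xM] /andP[? x'x]; split => //=; exact: le_lt_trans xM. Qed.

Lemma D_linear z : right_of z -> `|D z| <= P * (z.1 - c z.2).
Proof.
case: z => x t Oz; have [tab /= cx xM] := Oz.
apply: (right_limit_le cx (D_trace tab)) => s /andP[cs sx].
have Os : right_of (s, t) by apply: right_of_left Oz _; rewrite cs ltW.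
have -> : D (x, t) = D (s, t) + (D (x, t) - D (s, t)) by ring.
apply: le_trans (ler_normD _ _) _; rewrite lerD2l.
apply: le_trans (D_lip (ltW sx) Os xM) _.
by apply: ler_wpM2l => //; rewrite lerD2l lerN2 ltW.
Qed.

Lemma y_quadratic z : right_of z -> `|y z| <= P * (z.1 - c z.2) ^+ 2.
Proof.
case: z => x t Oz; have [tab /= cx xM] := Oz.
rewrite expr2 mulrA.
apply: (@right_limit_increment R (fun x => y (x, t)) (fun x => D (x, t))) => //; first exact: y_trace.
move=> s /andP[cs sx].
have Os : right_of (s, t) by apply: right_of_left Oz _; rewrite cs.
split; first exact: (y_dx Os).
by apply: le_trans (D_linear Os) _; rewrite ler_wpM2l// lerD2r.
Qed.

Definition e_const := P / (2 * L) + 9 * P * L.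

Lemma e_const_ge0 : 0 <= e_const.
Proof. by rewrite /e_const addr_ge0// ?divr_ge0 ?mulr_ge0// ltW// mulr_gt0. Qed.

(** Between t and t + q, with q comparable to the distance h to the curve, y changes by
    O(h^2), so e is O(h) somewhere in between, hence at t since e is Lipschitz.  The slope
    of the curve enters the choice of q, as the points must stay to its right. *)
Lemma e_linear z : right_of z -> z.2 + (z.1 - c z.2) / (2 * L) < b ->
  `|e z| <= e_const * (z.1 - c z.2).
Proof.
case: z => x t Oz; have [tab /= cx xM] := Oz; have [at_ tb] := andP tab.
set h := x - c t => hb.
have h0 : 0 < h by rewrite subr_gt0.
(* during time q the curve moves by at most h / 2 *)
pose q := h / (2 * L).
have q0 : 0 < q by rewrite divr_gt0// mulr_gt0.
have Lq : L * q = h / 2 by rewrite /q; field; rewrite gt_eqF.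
have near_curve s : t <= s <= t + q -> right_of (x, s) /\ x - c s <= 3 / 2 * h.
  move=> /andP[ts sq].
  have sab : a < s < b by rewrite (lt_le_trans at_ ts) (le_lt_trans sq hb).
  have := c_lip sab tab; rewrite (ger0_norm (_ : 0 <= s - t)) ?subr_ge0//.
  have : L * (s - t) <= h / 2 by rewrite -Lq ler_pM2l// lerBlDl.
  rewrite ler_norml => u1 /andP[u2 u3].
  split; last by rewrite /h in u1 *; move: u1 u2 u3; lra.
  by split => //=; move: u1 u2 u3 h0; rewrite /h; lra.
have inr s : Num.min t (t + q) <= s <= Num.max t (t + q) -> t <= s <= t + q.
  by rewrite (min_idPl _) ?(max_idPr _) ?lerDl// ltW.
have [s sI Es] := @MVT_sym R (fun s => y (x, s)) (fun s => e (x, s)) t (t + q)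
  (fun s si => y_dt (near_curve s (inr s si)).1).
have {sI}/andP[ts sq] := inr s sI.
have Hs : `|e (x, s) - e (x, t)| <= P * q.
  apply: le_trans (e_lip ts _) _.
    by move=> r /andP[tr rs]; apply: (near_curve r _).1; rewrite tr (le_trans rs).
  by rewrite ler_wpM2l// lerBlDl.
have yb r : t <= r <= t + q -> `|y (x, r)| <= P * (9 / 4 * h ^+ 2).
  move=> rI; have [Or hr] := near_curve r rI; have [_ /= cr _] := Or.
  apply: le_trans (y_quadratic Or) _; rewrite ler_wpM2l//=.
  have -> : 9 / 4 * h ^+ 2 = (3 / 2 * h) ^+ 2 by field.
  by rewrite ler_sqr ?nnegrE ?subr_ge0 ?mulr_ge0 ?divr_ge0// ltW.
have tq : t <= t + q by rewrite lerDl ltW.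
have Y1 := yb t (introT andP (conj (lexx t) tq)).
have Y2 := yb (t + q) (introT andP (conj tq (lexx _))).
have Eq : `|e (x, s)| * q <= P * (9 / 2 * h ^+ 2).
  rewrite -{1}(gtr0_norm q0) -normrM (_ : e (x, s) * q = y (x, t + q) - y (x, t)); last by rewrite Es; ring.
  by apply: le_trans (ler_normB _ _) _; move: Y1 Y2; lra.
have Eb : `|e (x, s)| <= 9 * P * L * h.
  rewrite -(ler_pM2r q0); apply: le_trans Eq _.
  rewrite le_eqVlt; apply/orP; left; apply/eqP.
  rewrite -[RHS](_ : 9 * P * h * (L * q) = _); last by ring.
  by rewrite Lq; field.
have -> : e (x, t) = e (x, s) - (e (x, s) - e (x, t)) by ring.
apply: le_trans (ler_normB _ _) _.
have -> : e_const * h = 9 * P * L * h + P * q.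
  by rewrite /e_const /q; field; rewrite gt_eqF.
exact: lerD.
Qed.

(** The time interval used in [e_linear] ends before b. *)
Definition short_of (z : R * R) := z.2 + (z.1 - c z.2) / (2 * L) < b.

Lemma short_of_left x x' t : short_of (x, t) -> x' <= x -> short_of (x', t).
Proof.
rewrite /short_of /= => H x'x; apply: le_lt_trans H; rewrite lerD2l ler_wpM2r ?invr_ge0 ?mulr_ge0 ?(ltW L0)//.
by rewrite lerD2r.
Qed.

(** The derivative e of F in x is O(d).  This improves on D, which is estimated by O(d)
    only, and makes the extended flux differentiable at the curve. *)
Lemma F_quadratic z : right_of z -> short_of z -> `|F z| <= e_const * (z.1 - c z.2) ^+ 2.
Proof.
case: z => x t Oz sz; have [tab /= cx xM] := Oz.
have Ok s : c t < s <= x -> right_of (s, t) by move=> si; exact: right_of_left Oz si.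
have F0 : F (x, t) @[x --> (c t)^'+] --> 0.
  apply: (@right_limit0_of_linear R _ _ x (P + K * (P * (x - c t)))) => //.
    by rewrite addr_ge0 ?mulr_ge0// subr_ge0 ltW.
  move=> s si; have Os := Ok s si; have /andP[cs sx] := si.
  have -> : F (s, t) = D (s, t) + (F (s, t) - D (s, t)) by ring.
  apply: le_trans (ler_normD _ _) _; rewrite mulrDl; apply: lerD; first exact: (D_linear Os).
  apply: le_trans (F_D Os) _; rewrite -mulrA; apply: ler_wpM2l => //.
  apply: le_trans (y_quadratic Os) _; rewrite /= -mulrA ler_wpM2l// expr2.
  by rewrite ler_wpM2r ?lerD2r// subr_ge0 ltW.
rewrite expr2 mulrA.
apply: (@right_limit_increment R (fun x => F (x, t)) (fun x => e (x, t))) => // s si.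
have Os := Ok s si; have /andP[cs sx] := si.
split; first exact: (F_dx Os).
apply: le_trans (e_linear Os (short_of_left sz sx)) _.
by rewrite ler_wpM2l ?e_const_ge0// lerD2r.
Qed.

Definition ext (f : R * R -> R) (z : R * R) : R := if c z.2 < z.1 then f z else 0.
Definition strip (z : R * R) := a < z.2 < b /\ z.1 < M.

Lemma curve_cont z : strip z -> cont_at z (fun z => c z.2).
Proof.
move=> [/andP[az zb] _]; apply/cvgrPdist_le => r r0.
near=> s.
have sab : a < s.2 < b.
  apply/andP; split; near: s; [apply: (cvgr_gt z.2) => //|apply: (cvgr_lt z.2) => //]; exact: cvg_snd.
apply: le_trans (c_lip _ sab) _; first by rewrite az.
rewrite -ler_pdivlMl//; near: s.
have : (z.2 - s.2) @[s --> z] --> 0 by rewrite -(subrr z.2); apply: cvgB; [exact: cvg_cst|exact: cvg_snd].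
by move/cvgr0Pnorm_le; apply; rewrite mulr_gt0// invr_gt0.
Unshelve. all: by end_near.
Qed.

Lemma strip_near z : strip z -> \forall s \near z, strip s.
Proof.
move=> [/andP[az zb] zM]; near=> s; split.
  apply/andP; split; near: s; [apply: (cvgr_gt z.2) => //|apply: (cvgr_lt z.2) => //]; exact: cvg_snd.
by near: s; apply: (cvgr_lt z.1) => //; exact: cvg_fst.
Unshelve. all: by end_near.
Qed.

Lemma dist_cont z : strip z -> cont_at z (fun z => z.1 - c z.2).
Proof. by move=> sz; exact: (cont_atB (f := fun z => z.1) (@cont_at_fst R z) (curve_cont sz)). Qed.

Lemma above_near z : strip z -> c z.2 < z.1 -> \forall s \near z, c s.2 < s.1.
Proof.
move=> sz; rewrite -subr_gt0 => H.
by apply: filterS (cont_at_gt (dist_cont sz) H) => s; rewrite subr_gt0.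
Qed.

Lemma below_near z : strip z -> z.1 < c z.2 -> \forall s \near z, s.1 < c s.2.
Proof.
move=> sz; rewrite -subr_lt0 => H.
by apply: filterS (cont_at_lt (dist_cont sz) H) => s; rewrite subr_lt0.
Qed.

Lemma short_near z : strip z -> z.1 = c z.2 -> \forall s \near z, short_of s.
Proof.
move=> sz E.
have h : cont_at z (fun z => z.2 + (z.1 - c z.2) * (2 * L)^-1).
  apply: (cont_atD (f := fun z => z.2) (@cont_at_snd R z)).
  exact: (cont_atM (dist_cont sz) (@cont_at_cst R _ _)).
apply: (cont_at_lt h); rewrite E subrr mul0r addr0.
by have [/andP[]] := sz.
Qed.

Lemma ext_cont f k z : (forall z, right_of z -> cont_at z f) ->
  (forall z, right_of z -> short_of z -> `|f z| <= k * (z.1 - c z.2)) -> 0 <= k ->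
  strip z -> cont_at z (ext f).
Proof.
move=> cf fk k0 sz; have [zab zM] := sz.
have [cz|zc|E] := ltgtP (c z.2) z.1.
- apply: cont_at_near (cf z _) => //.
  by apply: filterS (above_near sz cz) => s cs; rewrite /ext cs.
- apply: cont_at_near (@cont_at_cst R z 0).
  by apply: filterS (below_near sz zc) => s sc; rewrite /ext ltNge (ltW sc).
- have e0 : ext f z = 0 by rewrite /ext E ltxx.
  apply/cvgrPdist_le => r r0.
  have h : cont_at z (fun s => k * (s.1 - c s.2)).
    exact: (cont_atM (f := fun=> k) (@cont_at_cst R _ _) (dist_cont sz)).
  near=> s; rewrite e0 sub0r normrN /ext; case: ifPn => cs; last by rewrite normr0 ltW.
  have ss : strip s by near: s; exact: strip_near.
  have sh : short_of s by near: s; apply: short_near => //; rewrite E.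
  apply: le_trans (fk s _ sh) _; first by case: ss => ? ?; split.
  by apply: ltW; near: s; apply: (cont_at_lt h); rewrite E subrr mulr0.
Unshelve. all: by end_near.
Qed.

Lemma ext_dx f f' k z :
  (forall z, right_of z -> is_derive z.1 1 (fun x => f (x, z.2)) (f' z)) ->
  (forall z, right_of z -> short_of z -> `|f z| <= k * (z.1 - c z.2) ^+ 2) -> 0 <= k ->
  strip z -> is_derive z.1 1 (fun x => ext f (x, z.2)) (ext f' z).
Proof.
case: z => x t df fk k0 sz; have [zab /= zM] := sz.
have sl (Q : set (R * R)) : (\forall s \near (x, t), Q s) -> \forall s \near x, Q (s, t).
  move=> H; apply: (cvg_pair (F := nbhs x) (f := id) (g := fun=> t) cvg_id (cvg_cst t) H).
have [cz|zc|E] := ltgtP (c t) x.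
- rewrite [ext f' _]/ext /= cz.
  apply: is_derive_near (df (x, t) _) => //=.
  by apply: filterS (sl _ (above_near sz cz)) => s /= cs; rewrite /ext /= cs.
- rewrite [ext f' _]/ext /= ltNge (ltW zc) /=.
  apply: is_derive_near (is_derive_cst (0 : R) x (1 : R)).
  by apply: filterS (sl _ (below_near sz zc)) => s /= sc; rewrite /ext /= ltNge (ltW sc).
- rewrite [ext f' _]/ext /= E ltxx; apply: (is_derive0_quadratic k0).
  near=> s; rewrite /ext /=; case: ifPn => cs; last by rewrite normr0 mulr_ge0// sqr_ge0.
  rewrite -[X in s - X]E; apply: (fk (s, t)).
    split => //=; near: s; exact: (cvgr_lt x).
  by near: s; exact: sl (short_near sz (esym E)).
Unshelve. all: by end_near.
Qed.

(** At a point of the curve the distance to the curve is at most L times the time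
    increment, so that the contact is quadratic in t as well. *)
Lemma ext_dt f f' k z :
  (forall z, right_of z -> is_derive z.2 1 (fun t => f (z.1, t)) (f' z)) ->
  (forall z, right_of z -> short_of z -> `|f z| <= k * (z.1 - c z.2) ^+ 2) -> 0 <= k ->
  strip z -> is_derive z.2 1 (fun t => ext f (z.1, t)) (ext f' z).
Proof.
case: z => x t df fk k0 sz; have [zab /= zM] := sz.
have sl (Q : set (R * R)) : (\forall s \near (x, t), Q s) -> \forall s \near t, Q (x, s).
  move=> H; apply: (cvg_pair (F := nbhs t) (f := fun=> x) (g := id) (cvg_cst x) cvg_id H).
have [cz|zc|E] := ltgtP (c t) x.
- rewrite [ext f' _]/ext /= cz.
  apply: is_derive_near (df (x, t) _) => //=.
  by apply: filterS (sl _ (above_near sz cz)) => s /= cs; rewrite /ext /= cs.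
- rewrite [ext f' _]/ext /= ltNge (ltW zc) /=.
  apply: is_derive_near (is_derive_cst (0 : R) t (1 : R)).
  by apply: filterS (sl _ (below_near sz zc)) => s /= sc; rewrite /ext /= ltNge (ltW sc).
- rewrite [ext f' _]/ext /= E ltxx.
  apply: (@is_derive0_quadratic _ _ _ (k * L ^+ 2)); first by rewrite mulr_ge0// sqr_ge0.
  near=> s; rewrite /ext /=; case: ifPn => cs; last by rewrite normr0 mulr_ge0 ?sqr_ge0// mulr_ge0 ?sqr_ge0.
  have ss : strip (x, s) by near: s; exact: sl (strip_near sz).
  have sh : short_of (x, s) by near: s; exact: sl (short_near sz (esym E)).
  have [sab sM] := ss.
  apply: le_trans (fk (x, s) _ sh) _ => //=.
  rewrite -mulrA ler_wpM2l// -exprMn -E.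
  have := c_lip zab sab; rewrite distrC (distrC t) => Hc.
  rewrite -(real_normK (num_real (c t - _))) -(real_normK (num_real (L * _))) ler_sqr ?nnegrE//.
  by rewrite normrM (gtr0_norm L0) distrC.
Unshelve. all: by end_near.
Qed.

Lemma ext_regular z : strip z ->
  [/\ is_derive z.1 1 (fun x => ext y (x, z.2)) (ext D z),
      is_derive z.2 1 (fun t => ext y (z.1, t)) (ext e z) &
      is_derive z.1 1 (fun x => ext F (x, z.2)) (ext e z)].
Proof.
have e0 := e_const_ge0; have yq z' Oz (_ : short_of z') := @y_quadratic z' Oz.
by move=> sz; split; [exact: ext_dx yq _ sz|exact: ext_dt yq _ sz|exact: ext_dx F_quadratic _ sz].
Qed.

Lemma ext_continuous z : strip z ->
  [/\ cont_at z (ext y), cont_at z (ext D), cont_at z (ext e) & cont_at z (ext F)].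
Proof.
move=> sz.
have cD : cont_at z (ext D).
  apply: (@ext_cont _ P) => // [s /y_cont[]//|s Os _]; exact: D_linear.
have ce : cont_at z (ext e).
  by apply: (@ext_cont _ e_const) => // [s /y_cont[]//||]; [exact: e_linear|exact: e_const_ge0].
have short_dist s : right_of s -> short_of s -> s.1 - c s.2 <= 2 * L * (b - a).
  move=> [/andP[as_ sb] cs _]; rewrite /short_of -ltrBrDl ltr_pdivrMr ?mulr_gt0// mulrC => /ltW H.
  by apply: le_trans H _; rewrite ler_wpM2l ?mulr_ge0 ?(ltW L0)// lerD2l lerN2 ltW.
have ab : 0 <= 2 * L * (b - a).
  have [/andP[/ltW az /ltW zb] _] := sz.
  by rewrite mulr_ge0 ?mulr_ge0 ?(ltW L0)// subr_ge0 (le_trans az).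
have lin k f : 0 <= k -> (forall s, right_of s -> short_of s -> `|f s| <= k * (s.1 - c s.2) ^+ 2) ->
    forall s, right_of s -> short_of s -> `|f s| <= k * (2 * L * (b - a)) * (s.1 - c s.2).
  move=> k0 H s Os ss; apply: le_trans (H s Os ss) _; rewrite -mulrA ler_wpM2l// expr2.
  by have [_ cs _] := Os; rewrite ler_wpM2r ?subr_ge0 ?(ltW cs)// short_dist.
have cy : cont_at z (ext y).
  apply: (@ext_cont _ (P * (2 * L * (b - a)))) => //; first by move=> s /y_cont[].
    by apply: lin => // s Os _; exact: y_quadratic.
  by rewrite mulr_ge0.
have cF : cont_at z (ext F).
  apply: (@ext_cont _ (e_const * (2 * L * (b - a)))) => //; first by move=> s /y_cont[].
    by apply: lin; [exact: e_const_ge0|exact: F_quadratic].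
  by rewrite mulr_ge0// e_const_ge0.
by split.
Qed.

Section Primitive.
Variable l : R.
Hypothesis lc : forall t, a < t < b -> l < c t.

(** Passing to the primitive in x dispenses with a second derivative of y across the
    curve: its derivatives in x are y and D, and its derivative in t is F by the
    conservation law. *)
Definition primitive (z : R * R) : R := \int[mu]_(u in `[l, z.1]) ext y (u, z.2).

Lemma primitive_dx z : strip z -> l < z.1 -> is_derive z.1 1 (fun x => primitive (x, z.2)) (ext y z).
Proof.
case: z => x t [/= tab xM] lx.
pose u := (x + M) / 2.
have xu : x < u by rewrite /u; move: xM; lra.
have uM : u < M by rewrite /u; move: xM; lra.
have cz s : s <= u -> cont_at (t, s) (fun w => ext y (w.2, w.1)).
  move=> su; apply: cont_at_swap => /=; have [] // := @ext_continuous (s, t).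
  by split => //=; exact: le_lt_trans uM.
have iy : mu.-integrable `[l, u] (EFin \o (fun s => ext y (s, t))).
  by apply: (slice_integrable (f := fun w => ext y (w.2, w.1))) => s /andP[_]; exact: cz.
have cx : {for x, continuous (fun s => ext y (s, t))}.
  by apply: (cont_at_slice (f := fun w => ext y (w.2, w.1))); apply: cz; exact: ltW.
have [dP EP] := @continuous_FTC1_closed R (fun s => ext y (s, t)) l x u xu iy lx cx.
by rewrite -EP; exact: derivable_is_derive.
Qed.

Lemma primitive_dt z : strip z -> l < z.1 -> is_derive z.2 1 (fun t => primitive (z.1, t)) (ext F z).
Proof.
case: z => x t [/= /andP[at_ tb] xM] lx.
pose a' := (a + t) / 2; pose b' := (t + b) / 2.
have aa' : a < a' by rewrite /a'; move: at_; lra.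
have a't : a' < t by rewrite /a'; move: at_; lra.
have tb' : t < b' by rewrite /b'; move: tb; lra.
have b'b : b' < b by rewrite /b'; move: tb; lra.
have inS z : box a' b' l x z -> strip (z.2, z.1).
  by move=> /boxP[/andP[u1 u2] /andP[u3 u4]]; split => /=; [rewrite (lt_le_trans aa' u1) (le_lt_trans u2 b'b)|exact: le_lt_trans xM].
have tt : a' < t < b' by rewrite a't.
have inx s : l <= s <= x -> strip (s, t).
  by move=> sx; apply: (inS (t, s)); apply/boxP; split => //=; rewrite !ltW.
have := @is_derive_slice_integral R (fun w => ext y (w.2, w.1)) (fun w => ext e (w.2, w.1)) a' b' l x t tt.
have h1 z : box a' b' l x z -> is_derive z.1 1 (fun s => ext y (z.2, s)) (ext e (z.2, z.1)).
  by move=> /inS /ext_regular[].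
have h2 z : box a' b' l x z -> cont_at z (fun w => ext y (w.2, w.1)) /\ cont_at z (fun w => ext e (w.2, w.1)).
  by move=> /inS /ext_continuous[? _ ? _]; split; exact: cont_at_swap.
move=> /(_ h1 h2); apply: is_derive_val => /=.
have -> : \int[mu]_(u in `[l, x]) ext e (u, t) = ext F (x, t) - ext F (l, t).
  apply: (@slice_FTC R (fun u => ext F (u, t)) (fun u => ext e (u, t))) => //.
    by move=> s /inx /ext_regular[].
  apply: (slice_continuous (f := fun w => ext e (w.2, w.1))) => s /inx /ext_continuous[_ _ h _].
  exact: cont_at_swap.
by rewrite [X in _ - X]/ext /= ltNge (ltW (lc _)) ?at_//= subr0.
Qed.

Lemma primitive_cont z : strip z -> l < z.1 -> cont_at z primitive.
Proof.
case: z => x t [/= /andP[at_ tb] xM] lx.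
pose r := Num.min ((x - l) / 2) (Num.min ((M - x) / 2) (Num.min ((t - a) / 2) ((b - t) / 2))).
have r0 : 0 < r by rewrite !lt_min !divr_gt0// subr_gt0.
have [r1 [r2 [r3 r4]]] : r <= (x - l) / 2 /\ r <= (M - x) / 2 /\ r <= (t - a) / 2 /\ r <= (b - t) / 2.
  by have := lexx r; rewrite {2}/r !le_min => /and4P[].
have inS z : box (x - r) (x + r) (t - r) (t + r) z -> strip z /\ l < z.1.
  move=> /boxP[/andP[u1 u2] /andP[u3 u4]]; split; last by move: u1 r1 lx; lra.
  by split; [apply/andP; split|]; move: u2 u3 u4 r2 r3 r4 at_ tb xM; lra.
have cy z : box (x - r) (x + r) (t - r) (t + r) z -> cont_at z (ext y) by move=> /inS[/ext_continuous[]].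
have cF z : box (x - r) (x + r) (t - r) (t + r) z -> cont_at z (ext F) by move=> /inS[/ext_continuous[]].
have [C1 C10 H1] := box_bounded cy. have [C2 C20 H2] := box_bounded cF.
apply: (@cont_of_bounded_partials R primitive (ext y) (ext F) (x, t) r (C1 + C2)) => //.
  exact: addr_ge0.
move=> s Bs; have [ss ls] := inS s Bs; split.
- exact: primitive_dx.
- exact: primitive_dt.
- by apply: le_trans (H1 s Bs) _; rewrite lerDl.
- by apply: le_trans (H2 s Bs) _; rewrite lerDr.
Qed.

End Primitive.

(** Unique continuation applies to the primitive on a rectangle that reaches beyond the
    curve on the left, where the primitive is zero.  The conclusion is
    drawn in the middle of the time interval, which can be centred anywhere. *)
Theorem vanishing_right_of_curve x : right_of (x, (a + b) / 2) -> y (x, (a + b) / 2) = 0.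
Proof.
set t0 := (a + b) / 2 => Ox; have [/= tab cx xM] := Ox.
have ab : a < b by have /andP[] := tab; exact: lt_trans.
(* left of the whole curve, with room for the abscissae l + 1 / 4, l + 1 / 2 and l + 1 *)
pose l := c t0 - L * (b - a) - 2.
have lc t : a < t < b -> l + 1 < c t.
  move=> tI; have := c_lip tab tI; rewrite ler_norml => /andP[_].
  have : L * `|t0 - t| <= L * (b - a).
    rewrite ler_wpM2l ?(ltW L0)// ler_norml; have /andP[] := tab; have /andP[] := tI.
    by move=> ? ? ? ?; apply/andP; split; lra.
  by rewrite /l; lra.
have lc0 t : a < t < b -> l < c t by move=> /lc; lra.
pose t1 := (3 * a + b) / 4; pose t2 := (a + 3 * b) / 4.
pose m := (2 * x + M) / 3; pose m' := (x + 2 * M) / 3.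
have inS z : box (l + 1 / 4) m' t1 t2 z -> strip z /\ l < z.1.
  move=> /boxP[/andP[u1 u2] /andP[u3 u4]]; split; last by move: u1; lra.
  by split; [apply/andP; split|]; move: u2 u3 u4; rewrite /t1 /t2 /m'; move: ab xM; lra.
have Et : (t1 + t2) / 2 = t0 by rewrite /t1 /t2 /t0; field.
have lx : l + 1 < x by exact: lt_trans (lc _ tab) cx.
have zero_left z : strip z -> z.1 <= l + 1 -> ext y z = 0.
  by move=> [zab _] zl; rewrite /ext ltNge (le_trans zl)// ltW// lc.
have start t : t1 <= t <= t2 -> primitive l (l + 1 / 2, t) = 0 /\ ext y (l + 1 / 2, t) = 0.
  move=> /andP[u1 u2].
  have tI : a < t < b by apply/andP; split; move: u1 u2; rewrite /t1 /t2; move: ab; lra.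
  have sl s : s <= l + 1 -> strip (s, t) by split => //=; move: lx xM; lra.
  split; last by rewrite zero_left//=; [apply: sl|]; lra.
  rewrite /primitive -[RHS](mul0r (fine (mu `[l, l + 1 / 2]))) -(@Rintegral_cst _ _ _ mu)//=.
  apply: eq_Rintegral => s /set_mem; rewrite /= in_itv /= => /andP[_ sl'].
  by rewrite zero_left//=; [apply: sl|]; lra.
have := @carleman_uniqueness R (primitive l) (ext y) (ext D) (ext F) (ext e)
  (l + 1 / 4) (l + 1 / 2) m m' t1 t2 K.
have h1 : l + 1 / 4 < l + 1 / 2 by lra.
have h2 : l + 1 / 2 < m by rewrite /m; move: lx xM; lra.
have h3 : m < m' by rewrite /m /m'; move: xM; lra.
have h4 : t1 < t2 by rewrite /t1 /t2; move: ab; lra.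
move=> /(_ h1 h2 h3 h4); rewrite Et => H.
have -> : y (x, t0) = ext y (x, t0) by rewrite /ext /= cx.
have Yz x' : l + 1 / 2 <= x' -> x' < m -> primitive l (x', t0) = 0.
  apply: H => //.
  - move=> z /inS[sz lz]; have [d1 d2 d3] := ext_regular sz; split => //.
      exact: primitive_dx.
    exact: primitive_dt.
  - by move=> z /inS[sz lz]; have [? ? ? ?] := ext_continuous sz; split => //; exact: primitive_cont.
  - move=> z /inS[[zab zM] lz]; rewrite /ext; case: ifPn => cz; last by rewrite subrr normr0 mulr0.
    exact: F_D.
have sx : strip (x, t0) by split.
have lx' : l < x by move: lx; lra.
have dY := primitive_dx sx lx'.
have d0 : is_derive x 1 (fun s => primitive l (s, t0)) 0.
  apply: is_derive_near (is_derive_cst (0 : R) x (1 : R)).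
  near=> s; rewrite /cst /= Yz//; first by apply: ltW; near: s; apply: lt_nbhsr; move: lx; lra.
  by near: s; apply: lt_nbhsl; rewrite /m; move: xM; lra.
by rewrite -(is_derive_derive1 dY) (is_derive_derive1 d0).
Unshelve. all: by end_near.
Qed.

End ZeroExtension.

(** * Classical solutions of the Burgers equation *)

Section ClassicalSolutions.
Context {R : realType}.
Implicit Types (U V : set (R * R)) (w : R * R -> R).

Lemma Lnorm_oo_ae (f : R * R -> R) (k : R) : (Lnorm leb2 +oo (EFin \o f) <= k%:E)%E ->
  {ae leb2, forall z, `|f z| <= k}.
Proof.
rewrite unlock /=; case: ifPn => [_ /ess_supP|]; first by apply: filterS => z /=; rewrite lee_fin.
rewrite -leNgt => l0 _; exists setT; split => //.
by apply/eqP; rewrite eq_le l0 measure_ge0.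
Qed.

(** The norm is an infimum over families of weak derivatives: a family that is nearly
    optimal is bounded by M + 1. *)
Lemma Wkoo_norm_bound (k : nat) U w (M : R) : (Wkoo_norm k U w <= M%:E)%E ->
  exists2 D : nat -> nat -> R * R -> R,
    forall i j, (i + j <= k)%N -> weak_deriv2 U i j w (D i j) &
    forall i j, (i + j <= k)%N -> {ae leb2, forall z, U z -> `|D i j z| <= M + 1}.
Proof.
move=> WM.
have : (Wkoo_norm k U w < (M + 1)%:E)%E by apply: le_lt_trans WM _; rewrite lte_fin ltrDl.
move=> /ereal_inf_lt[x [D Dw ->] Dx]; exists D => // i j ij.
have ik : (i < k.+1)%N by rewrite ltnS (leq_trans _ ij)// leq_addr.
have jk : (j < k.+1)%N by rewrite ltnS (leq_trans _ ij)// leq_addl.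
have : (Lnorm leb2 +oo (EFin \o (D i j \_ U)) <= (M + 1)%:E)%E.
  apply: le_trans (ltW Dx).
  rewrite (bigD1 (Ordinal ik))//= (bigD1 (Ordinal jk))//=.
  rewrite -addeA leeDl// adde_ge0// ?sume_ge0// => *; rewrite ?sume_ge0// => *; exact: Lnorm_ge0.
move/Lnorm_oo_ae; apply: filterS => z H Uz.
by move: H; rewrite patchE mem_set.
Qed.

(** The Lipschitz bounds concern rectangles inside U because U itself, bounded by the
    path of the particle, is not convex. *)
Record classical_burgers U w (N : R) : Prop := ClassicalBurgers {
  cb_open : open U ;
  cb_point : forall z, U z -> [/\ `|w z| <= N, `|partial_x w z| <= N, `|partial_t w z| <= N,
     is_derive z.1 1 (fun x => w (x, z.2)) (partial_x w z) &
     is_derive z.2 1 (fun t => w (z.1, t)) (partial_t w z)] ;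
  cb_lip : forall x1 x2 t1 t2 z z', box x1 x2 t1 t2 `<=` U ->
     box x1 x2 t1 t2 z -> box x1 x2 t1 t2 z' ->
     [/\ `|w z - w z'| <= N * (`|z.1 - z'.1| + `|z.2 - z'.2|),
         `|partial_x w z - partial_x w z'| <= N * (`|z.1 - z'.1| + `|z.2 - z'.2|)
       & `|partial_t w z - partial_t w z'| <= N * (`|z.1 - z'.1| + `|z.2 - z'.2|)] ;
  cb_eq : forall z, U z ->
     is_derive z.1 1 (fun x => partial_x w (x, z.2)) (partial_t w z + w z * partial_x w z)
}.

Lemma classical_of_Wkoo U V w (M : R) : 0 < M -> U `<=` V ->
  (forall z, V z -> {for z, continuous w}) ->
  (exists wt wx wxx : R * R -> R,
    [/\ weak_deriv2 V 0 1 w wt, weak_deriv2 V 1 0 w wx, weak_deriv2 V 2 0 w wxx &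
        {ae leb2, forall z, V z -> wt z - wxx z + w z * wx z = 0}]) ->
  (Wkoo_norm 2 U w <= M%:E)%E -> classical_burgers U w (M + 1).
Proof.
move=> M0 UV cw [wt [wx [wxx [h1 h2 h3 h4]]]] /Wkoo_norm_bound[D Dw DM].
have [[_ oU _] _ _] := Dw 0 0 isT.
have N0 : 0 <= M + 1 by lra.
have cU z : U z -> {for z, continuous w} by move=> /UV; exact: cw.
split; first exact: oU.
- exact: regular_point DM.
- exact: regular_lipschitz DM.
- exact: (classical_equation N0 oU UV cU Dw DM h1 h2 h3 h4).
Qed.

Lemma classical_burgersS U V w (N : R) : open U -> U `<=` V ->
  classical_burgers V w N -> classical_burgers U w N.
Proof.
move=> oU UV [oV h1 h2 h3]; split; first exact: oU.
- by move=> z /UV /h1.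
- by move=> x1 x2 t1 t2 z z' B; apply: h2; exact: subset_trans UV.
- by move=> z /UV /h3.
Qed.

Lemma cont_of_box_lipschitz U (f : R * R -> R) (N : R) : open U -> 0 <= N ->
  (forall x1 x2 t1 t2 z z', box x1 x2 t1 t2 `<=` U ->
     box x1 x2 t1 t2 z -> box x1 x2 t1 t2 z' ->
     `|f z - f z'| <= N * (`|z.1 - z'.1| + `|z.2 - z'.2|)) ->
  forall z, U z -> cont_at z f.
Proof.
move=> oU N0 H z Uz.
have [|r r0 Hr] := @box_slack R U z.1 z.1 z.2 z.2 oU.
  move=> s /boxP[a b].
  by have -> : s = z; [case: s z a b {Uz} => ? ? [? ?] /= /le_anti -> /le_anti ->|].
have N1 : 0 < 2 * N + 1 by lra.
apply/cvgrPdist_le => e e0; near=> s.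
have d1 : `|z.1 - s.1| < Num.min r (e / (2 * N + 1)).
  near: s; have : (z.1 - s.1) @[s --> z] --> 0 by rewrite -(subrr z.1); apply: cvgB; [exact: cvg_cst|exact: cvg_fst].
  by move/cvgr0Pnorm_lt; apply; rewrite lt_min r0 divr_gt0.
have d2 : `|z.2 - s.2| < Num.min r (e / (2 * N + 1)).
  near: s; have : (z.2 - s.2) @[s --> z] --> 0 by rewrite -(subrr z.2); apply: cvgB; [exact: cvg_cst|exact: cvg_snd].
  by move/cvgr0Pnorm_lt; apply; rewrite lt_min r0 divr_gt0.
move: d1 d2; rewrite !lt_min => /andP[d1 e1] /andP[d2 e2].
have inb (u v : R) : `|u - v| < r -> u - r <= v <= u + r by move=> /ltW; rewrite ler_norml; lra.
apply: le_trans (H _ _ _ _ z s Hr _ _) _.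
- by apply/boxP; rewrite !gerBl !lerDl !(ltW r0).
- by apply/boxP; split; exact: inb.
apply: (@le_trans _ _ (N * (e / (2 * N + 1) + e / (2 * N + 1)))).
  by rewrite ler_wpM2l// lerD// ltW.
by rewrite -mulrDl mulrA ler_pdivrMr//; have := e0; lra.
Unshelve. all: by end_near.
Qed.

Lemma classical_cont U w (N : R) : 0 <= N -> classical_burgers U w N -> forall z, U z ->
  [/\ cont_at z w, cont_at z (partial_x w) & cont_at z (partial_t w)].
Proof.
move=> N0 [oU _ hl _] z Uz; split; apply: (cont_of_box_lipschitz oU N0 _ Uz) => x1 x2 t1 t2 s s' B Bs Bs';
  by have [] := hl _ _ _ _ _ _ B Bs Bs'.
Qed.

End ClassicalSolutions.

Section BetweenCurves.
Context {R : realType}.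
Variables (U : set (R * R)) (w1 w2 : R * R -> R) (N L a b : R) (c d : R -> R).
Hypotheses (N0 : 0 <= N) (L0 : 0 < L).
Hypothesis cb1 : classical_burgers U w1 N.
Hypothesis cb2 : classical_burgers U w2 N.
Hypothesis UE : forall z, U z <-> a < z.2 < b /\ c z.2 < z.1 < d z.2.
Hypothesis c_lip : forall t t', a < t < b -> a < t' < b -> `|c t - c t'| <= L * `|t - t'|.
Hypothesis trace : forall t, a < t < b -> (w1 (x, t) - w2 (x, t)) @[x --> (c t)^'+] --> 0.
Hypothesis trace_x : forall t, a < t < b ->
  (partial_x w1 (x, t) - partial_x w2 (x, t)) @[x --> (c t)^'+] --> 0.

(** Around each point of U there is a strip in which the part of the plane to the right
    of c belongs to U, since U is open and its sections are intervals starting at c.  On it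
    the flux y_x - (w1^2 - w2^2) / 2 has the x-derivative y_t by the equation. *)
Theorem burgers_unique_right_of_curve z : U z -> w1 z = w2 z.
Proof.
case: z => x t Uz; apply/eqP; rewrite -subr_eq0; apply/eqP.
have oU := cb_open cb1.
have [|r r0 Hr] := @box_slack R U x x t t oU.
  move=> s /boxP[h1 h2].
  by have -> : s = (x, t); [case: s h1 h2 => ? ? /= /le_anti -> /le_anti ->|].
have /UE[/= tab /andP[cx xd]] := Uz.
have inU s : right_of c (t - r) (t + r) (x + r) s -> U s.
  move=> [/andP[s1 s2] cs sx].
  have inr : U (x + r, s.2).
    by apply: Hr; apply/boxP; split => /=; [rewrite lexx andbT; lra|rewrite (ltW s1) (ltW s2)].
  by have /UE[/= sab /andP[_ ds]] := inr; apply/UE; rewrite sab cs; split => //; exact: lt_trans ds.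
have sub s : t - r < s < t + r -> a < s < b.
  move=> /andP[s1 s2].
  have inr : U (x + r, s).
    by apply: Hr; apply/boxP; split => /=; [rewrite lexx andbT; lra|rewrite (ltW s1) (ltW s2)].
  by have /UE[] := inr.
pose y z := w1 z - w2 z; pose D z := partial_x w1 z - partial_x w2 z.
pose e z := partial_t w1 z - partial_t w2 z.
pose F z := D z - (w1 z * w1 z - w2 z * w2 z) / 2.
have E0 : (t - r + (t + r)) / 2 = t by field.
have := @vanishing_right_of_curve R c (t - r) (t + r) (x + r) L (2 * N) N y D e F L0.
rewrite E0; apply.
- by rewrite mulr_ge0.
- exact: N0.
- by move=> s s' /sub h /sub h'; exact: c_lip.
- move=> s /inU Us; have [_ _ _ h1 _] := cb_point cb1 Us; have [_ _ _ h2 _] := cb_point cb2 Us.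
  exact: (is_deriveBf h1 h2).
- move=> s /inU Us; have [_ _ _ _ h1] := cb_point cb1 Us; have [_ _ _ _ h2] := cb_point cb2 Us.
  exact: (is_deriveBf h1 h2).
- move=> s /inU Us; have [_ _ _ h1 _] := cb_point cb1 Us; have [_ _ _ h2 _] := cb_point cb2 Us.
  have := is_deriveBf (is_deriveBf (cb_eq cb1 Us) (cb_eq cb2 Us))
    (is_deriveZf (1 / 2) (is_deriveBf (is_deriveMf h1 h1) (is_deriveMf h2 h2))).
  move=> h; apply: is_derive_ext (is_derive_val _ h) => [u|]; first by rewrite /F /D /=; ring.
  by case: (s) => ? ?; rewrite /e /=; field.
- move=> s /inU Us; have [h1 _ _ _ _] := cb_point cb1 Us; have [h2 _ _ _ _] := cb_point cb2 Us.
  have -> : F s - D s = (- (w1 s + w2 s) / 2) * y s by rewrite /F /y; field.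
  rewrite normrM ler_wpM2r// mulNr normrN normrM (ger0_norm (_ : 0 <= 2^-1))// ler_pdivrMr//.
  by apply: le_trans (ler_normD _ _) _; lra.
- move=> s /inU Us; have [c1 c2 c3] := classical_cont N0 cb1 Us; have [c4 c5 c6] := classical_cont N0 cb2 Us.
  split; [exact: cont_atB|exact: cont_atB|exact: cont_atB|].
  apply: (cont_atB (f := D)); first exact: cont_atB.
  apply: (cont_atM (f := fun z => w1 z * w1 z - w2 z * w2 z) _ (@cont_at_cst R _ _)).
  by apply: (cont_atB (f := fun z => w1 z * w1 z)); exact: cont_atM.
- move=> s s' q ss' Os sM.
  have B : box s s' q q `<=` U.
    move=> u /boxP[/andP[u1 u2] u3]; apply: inU; have [qab cq _] := Os.
    have Eq : u.2 = q by apply/esym/le_anti.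
    by split; rewrite ?Eq; [exact: qab|exact: lt_le_trans u1|exact: le_lt_trans sM].
  have B1 : box s s' q q (s', q) by apply/boxP; rewrite /= !lexx ss'.
  have B2 : box s s' q q (s, q) by apply/boxP; rewrite /= !lexx ss'.
  have [_ h1 _] := cb_lip cb1 B B1 B2; have [_ h2 _] := cb_lip cb2 B B1 B2.
  move: h1 h2; rewrite /= subrr normr0 addr0 (ger0_norm (_ : 0 <= s' - s)) ?subr_ge0// => h1 h2.
  rewrite /D (_ : _ - _ = (partial_x w1 (s', q) - partial_x w1 (s, q)) - (partial_x w2 (s', q) - partial_x w2 (s, q))); last by ring.
  by apply: le_trans (ler_normB _ _) _; move: h1 h2; lra.
- move=> s q q' qq' Os.
  have B : box s s q q' `<=` U.
    move=> u /boxP[u1 u2]; have Eq : u.1 = s by apply/esym/le_anti.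
    by apply: inU; have := Os u.2 u2; rewrite -Eq -surjective_pairing.
  have B1 : box s s q q' (s, q') by apply/boxP; rewrite /= !lexx qq'.
  have B2 : box s s q q' (s, q) by apply/boxP; rewrite /= !lexx qq'.
  have [_ _ h1] := cb_lip cb1 B B1 B2; have [_ _ h2] := cb_lip cb2 B B1 B2.
  move: h1 h2; rewrite /= subrr normr0 add0r (ger0_norm (_ : 0 <= q' - q)) ?subr_ge0// => h1 h2.
  rewrite /e (_ : _ - _ = (partial_t w1 (s, q') - partial_t w1 (s, q)) - (partial_t w2 (s, q') - partial_t w2 (s, q))); last by ring.
  by apply: le_trans (ler_normB _ _) _; move: h1 h2; lra.
- by move=> s /sub; exact: trace.
- by move=> s /sub; exact: trace_x.
- by split => /=; [rewrite gtrBl ltrDl r0| |rewrite ltrDl].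
Qed.

End BetweenCurves.

(** * Gronwall, and weak derivatives on an interval *)

Section OneDimensionalLemmas.
Context {R : realType}.
Local Notation mu := (@lebesgue_measure R).

Lemma left_limit_witness (f : R -> R) (c l a e : R) : a < c -> 0 < e ->
  f x @[x --> c^'-] --> l -> exists x, [/\ a < x, c - e < x, x < c & `|l - f x| <= e].
Proof.
move=> ac e0 /cvgrPdist_le/(_ e e0) H.
have H2 : \forall x \near c^'-, [/\ a < x, c - e < x, x < c & `|l - f x| <= e].
  near=> x; split; last by near: x.
  - by near: x; exact: nbhs_left_gt.
  - by near: x; apply: nbhs_left_gt; rewrite gtrBl.
  - by near: x; exact: nbhs_left_lt.
by have [x Hx] := filter_ex H2; exists x.
Unshelve. all: by end_near.
Qed.

(** The function f^2 exp(- 2 N t) is nonincreasing and vanishes at 0. *)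
Lemma gronwall_zero (f f' : R -> R) (T N : R) :
  {within `[0, T], continuous f} -> f 0 = 0 ->
  (forall t, 0 < t < T -> is_derive t 1 f (f' t) /\ `|f' t| <= N * `|f t|) ->
  forall t, 0 < t < T -> f t = 0.
Proof.
move=> cf f0 H t /andP[t0 tT].
pose g s := f s * f s * expR (- (2 * N) * s + 0).
pose g' s := (f' s * f s + f s * f' s) * expR (- (2 * N) * s + 0)
  + f s * f s * (expR (- (2 * N) * s + 0) * - (2 * N)).
have dg s : 0 < s < T -> is_derive s 1 g (g' s).
  move=> /H[df _].
  have de := is_derive_compf (f := expR) (g := fun s => - (2 * N) * s + 0) (is_derive_expR _) (is_derive_affine _ _ s).
  exact: (is_deriveMf (is_deriveMf df df) de).
have g'le s : 0 < s < T -> g' s <= 0.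
  move=> /H[_ Hs].
  have -> : g' s = expR (- (2 * N) * s + 0) * (2 * (f s * f' s - N * (f s * f s))) by rewrite /g'; ring.
  rewrite mulr_ge0_le0 ?expR_ge0//.
  have h1 : f s * f' s <= `|f s| * `|f' s| by rewrite -normrM ler_norm.
  have h2 : `|f s| * `|f' s| <= `|f s| * (N * `|f s|) by rewrite ler_wpM2l.
  have h3 : `|f s| * (N * `|f s|) = N * (f s * f s) by rewrite mulrCA -expr2 real_normK ?num_real// expr2.
  by move: h1 h2; rewrite h3; lra.
have cg : {within `[0, t], continuous g}.
  have cft : {within `[0, t], continuous f}.
    apply: continuous_subspaceW cf => s; rewrite /= !in_itv /= => /andP[-> st].
    exact: le_trans st (ltW tT).
  have ce : {within `[0, t], continuous (fun s : R => expR (- (2 * N) * s + 0))}.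
    apply: continuous_subspaceT => s.
    exact: is_derive_cont (is_derive_compf (f := expR) (g := fun s => - (2 * N) * s + 0) (is_derive_expR _) (is_derive_affine _ _ s)).
  by move=> s; apply: cvgM; [apply: cvgM; exact: cft|exact: ce].
have inT s : s \in `]0, t[ -> 0 < s < T.
  by rewrite in_itv /= => /andP[-> st]; exact: lt_trans tT.
have [c /inT cT E] := @MVT R g g' 0 t t0 (fun s si => dg s (inT s si)) cg.
have gt : g t <= 0.
  have -> : g t = g' c * t by move: E; rewrite {2}/g f0 !mul0r !subr0.
  by rewrite mulr_le0_ge0 ?g'le// ltW.
have : f t * f t <= 0 by rewrite -(pmulr_lle0 _ (expR_gt0 (- (2 * N) * t + 0))).
by rewrite -expr2 => h; apply/eqP; rewrite -sqrf_eq0 eq_le h sqr_ge0.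
Qed.

(** A null set does not contain an interval. *)
Lemma ae_exists_itv (P : R -> Prop) (u v : R) : u < v -> {ae mu, forall t, P t} ->
  exists2 t, u < t < v & P t.
Proof.
move=> uv [A [mA A0 PA]]; apply: contrapT => nP.
have : (mu `]u, v[ <= mu A)%E.
  apply: le_measure; rewrite ?inE//.
  move=> t; rewrite /= in_itv /= => tuv; apply: PA => /= Pt; apply: nP; by exists t.
have := @lebesgue_measure_itv R `]u, v[; rewrite /= lte_fin uv -EFinB A0 => ->.
by rewrite lee_fin subr_le0 leNgt uv.
Qed.

Lemma cutoff_test_fun1 (U : set R) (n a b : R) : 0 < n -> `[a, b] `<=` U ->
  test_fun1 U (cutoff n a b).
Proof.
move=> n0 abU; have [sm] := @cutoff_smooth R n a b.
have sub : closure [set x | cutoff n a b x != 0] `<=` `[a, b].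
  rewrite closureE => x; apply; split; first exact: interval_closed.
  move=> y /=; rewrite in_itv /=; apply: contraPP => /negP yab /eqP; apply.
  exact: cutoff_supp.
split => //.
  apply: (subclosed_compact _ (@segment_compact R a b) sub); exact: closed_closure.
exact: subset_trans sub abU.
Qed.

Lemma weak_deriv1_unique (U : set R) (k : nat) (f1 f2 g1 g2 : R -> R) (x1 x2 : R) :
  measurable U ->
  (forall x, U x -> f1 x = f2 x) -> weak_deriv1 U k f1 g1 -> weak_deriv1 U k f2 g2 ->
  `[x1, x2] `<=` U -> {ae mu, forall x, x1 < x < x2 -> g1 x = g2 x}.
Proof.
move=> mU f12 [_ l1 d1] [_ l2 d2] sub.
have int g : locally_integrable U g -> mu.-integrable `[x1, x2] (EFin \o g).
  move=> [mg _ ig]; apply/integrableP; split.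
    apply/measurable_EFinP; apply: measurable_funS mg => //.
  by have := ig `[x1, x2]%classic sub (@segment_compact R x1 x2).
have i1 := int _ l1; have i2 := int _ l2.
have mI : measurable (`[x1, x2]%classic : set R) by exact: measurable_itv.
have i12 : mu.-integrable `[x1, x2] (EFin \o (fun x => g1 x - g2 x)).
  have : mu.-integrable `[x1, x2] ((EFin \o g1) \- (EFin \o g2))%E by exact: integrableB.
  by [].
have H n y1 y2 : 0 < n -> x1 <= y1 -> y2 <= x2 ->
    \int[mu]_(x in `[x1, x2]) ((g1 x - g2 x) * cutoff n y1 y2 x) = 0.
  move=> n0 xy yx.
  have ysub : (`[y1, y2]%classic : set R) `<=` `[x1, x2].
    by move=> s; rewrite /= !in_itv /= => /andP[s1 s2]; rewrite (le_trans xy s1) (le_trans s2 yx).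
  have ph := cutoff_test_fun1 n0 (subset_trans ysub sub).
  have out g s : U s -> ~ `[x1, x2]%classic s -> g s * cutoff n y1 y2 s = 0.
    move=> _ ns; rewrite (cutoff_supp n0) ?mulr0//; apply/negP => ys; apply: ns.
    by apply: ysub; rewrite /= in_itv.
  have bd g : mu.-integrable `[x1, x2] (EFin \o g) ->
      mu.-integrable `[x1, x2] (EFin \o (fun x => g x * cutoff n y1 y2 x)).
    move=> ig; have : mu.-integrable `[x1, x2] ((EFin \o g) \* (EFin \o cutoff n y1 y2))%E.
      apply: integrableMl => //; first by apply: smooth_measurable; exact: cutoff_smooth.
      by exists 1; split => // M M1 x _; apply: le_trans (cutoff_norm_le1 n y1 y2 x) (ltW M1).
    by [].
  have E : \int[mu]_(x in U) (g1 x * cutoff n y1 y2 x) = \int[mu]_(x in U) (g2 x * cutoff n y1 y2 x).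
    have h : \int[mu]_(x in U) (f1 x * derive1n k (cutoff n y1 y2) x) =
        \int[mu]_(x in U) (f2 x * derive1n k (cutoff n y1 y2) x).
      by apply: eq_Rintegral => x /set_mem /f12 ->.
    move: h; rewrite (d1 _ ph) (d2 _ ph) => /(congr1 (fun u => (-1) ^+ k * u)).
    by rewrite !mulrA -exprMn mulrNN mulr1 expr1n !mul1r.
  move: E; rewrite (@Rintegral_support _ _ _ mu _ _ _ (out g1) sub) (@Rintegral_support _ _ _ mu _ _ _ (out g2) sub) => E.
  under eq_Rintegral do rewrite mulrBl.
  by rewrite (@RintegralB _ _ _ mu)// ?E ?subrr//; exact: bd.
have := fundamental_lemma1 i12 H.
apply: filterS => x /= Hx x12; have := Hx; rewrite in_itv /= => /(_ x12).
by case=> /eqP; rewrite subr_eq0 => /eqP.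
Qed.

End OneDimensionalLemmas.

(** * The path of one particle *)

Section OneSolution.
Context {R : realType}.
Variables (T delta M : R) (w0 alpha eta : R -> R) (q0 q1 : R) (w : R * R -> R) (p : R -> R).
Hypothesis sol : fluid_particle_solution T w0 alpha eta q0 q1 w p.
Hypotheses (d0 : 0 < delta < 1) (M0 : 0 < M).
Hypothesis p_bound : forall t, t \in `]0, T[ -> `|p t| <= 1 - delta.

Lemma classical_on_side U : U `<=` Qdom T p -> (Wkoo_norm 2 U w <= M%:E)%E ->
  classical_burgers U w (M + 1).
Proof.
move=> UQ; apply: (classical_of_Wkoo M0 UQ); first by move=> z /(fps_repr sol)[].
exact: fps_burgers sol.
Qed.

Lemma path_lt1 t : 0 < t < T -> -1 < p t < 1.
Proof.
move=> tT; have := p_bound (t := t); rewrite in_itv /= => /(_ tT).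
by rewrite ler_norml => /andP[h1 h2]; have /andP[h3 h4] := d0; apply/andP; split; lra.
Qed.

Lemma QleftE z : Qleft T p z <-> 0 < z.2 < T /\ -1 < z.1 < p z.2.
Proof.
split=> [[[/andP[-> _] _ ->] ->]//|[zT /andP[z1 zp]]].
have /andP[_ p1] := path_lt1 zT.
by split => //; split; rewrite ?z1 ?(lt_trans zp p1)// lt_eqF.
Qed.

Lemma QrightE z : Qright T p z <-> 0 < z.2 < T /\ p z.2 < z.1 < 1.
Proof.
split=> [[[/andP[_ ->] _ ->] ->]//|[zT /andP[zp z1]]].
have /andP[p1 _] := path_lt1 zT.
by split => //; split; rewrite ?z1 ?(lt_trans p1 zp)// gt_eqF.
Qed.

Hypothesis cb : classical_burgers (Qleft T p) w (M + 1).

Lemma velocity_bound t : 0 < t < T ->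
  is_derive t 1 p (derive1 p t) /\ `|derive1 p t| <= M + 1.
Proof.
move=> tT; have [] := fps_velocity sol (t := t); first by rewrite in_itv.
move=> dp vl _; split; first exact: derivable_is_derive.
apply/ler_addgt0Pr => e e0; have /andP[p1 _] := path_lt1 tT.
have [x [px _ xp H]] := left_limit_witness p1 e0 vl.
have [|wN _ _ _ _] := cb_point cb (z := (x, t)); first by apply/QleftE; rewrite /= px.
have -> : derive1 p t = w (x, t) + (derive1 p t - w (x, t)) by ring.
by apply: le_trans (ler_normD _ _) _; exact: lerD.
Qed.

Lemma path_lipschitz t t' : 0 < t < T -> 0 < t' < T -> `|p t - p t'| <= (M + 1) * `|t - t'|.
Proof.
move=> /andP[t0 tT] /andP[t0' tT'].
have inT s : Num.min t' t <= s <= Num.max t' t -> 0 < s < T.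
  by move=> /andP[s1 s2]; rewrite (lt_le_trans _ s1) ?lt_min ?t0 ?t0'// (le_lt_trans s2) ?gt_max ?tT ?tT'.
by apply: (@lipschitz_of_deriv _ p (derive1 p)) => s /inT /velocity_bound[].
Qed.

Lemma horizontal_lipschitz t x x' : 0 < t < T -> -1 < x < p t -> -1 < x' < p t ->
  `|w (x, t) - w (x', t)| <= (M + 1) * `|x - x'|.
Proof.
move=> tT; wlog xx' : x x' / x <= x' => [H|].
  have [xx'|/ltW x'x] := leP x x'; first exact: H.
  by move=> hx hx'; rewrite distrC [X in _ * X]distrC; exact: H.
move=> /andP[x1 xp] /andP[x1' xp'].
have B : box x x' t t `<=` Qleft T p.
  move=> u /boxP[/andP[u1 u2] /le_anti E]; apply/QleftE; rewrite -E; split => //.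
  by rewrite (lt_le_trans x1 u1) (le_lt_trans u2 xp').
have B1 : box x x' t t (x, t) by apply/boxP; rewrite /= !lexx xx'.
have B2 : box x x' t t (x', t) by apply/boxP; rewrite /= !lexx xx'.
have [h _ _] := cb_lip cb B B1 B2.
by move: h; rewrite /= subrr normr0 addr0.
Qed.

End OneSolution.

(** Evaluate f and g just before u and v: g, which extends f, changes by at most N times
    the distance of the two points. *)
Lemma left_trace_gap {R : realType} (f g : R -> R) (u v l m a N : R) : a < u -> u <= v -> 0 <= N ->
  f x @[x --> u^'-] --> l -> g x @[x --> v^'-] --> m ->
  (forall x, a < x < u -> f x = g x) ->
  (forall x x', a < x < v -> a < x' < v -> `|g x - g x'| <= N * `|x - x'|) ->
  `|l - m| <= N * `|u - v|.
Proof.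
move=> au uv N0 fl gm fg gL; apply/ler_addgt0Pr => e e0.
have N2 : 0 < N + 2 by rewrite ltr_wpDl.
pose r := e / (N + 2); have r0 : 0 < r by rewrite divr_gt0.
have [x [ax ux xu Hx]] := left_limit_witness au r0 fl.
have [x' [ax' vx' xv' Hx']] := left_limit_witness (lt_le_trans au uv) r0 gm.
have h : `|g x - g x'| <= N * (v - u + r).
  apply: le_trans (gL _ _ _ _) _; rewrite ?ax ?ax' ?(lt_le_trans xu uv)//.
  rewrite ler_wpM2l// ler_norml; apply/andP; split; move: ux xu vx' xv' uv; lra.
have -> : l - m = (l - f x) - (m - g x') + (g x - g x') by rewrite fg ?ax//; ring.
apply: le_trans (ler_normD _ _) _.
have -> : N * `|u - v| + e = (r + r) + N * (v - u + r).
  rewrite distrC ger0_norm ?subr_ge0// /r; field; by rewrite gt_eqF.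
apply: lerD => //; apply: le_trans (ler_normB _ _) _; exact: lerD.
Qed.

Lemma equal_partial_x {R : realType} (U : set (R * R)) (f g : R * R -> R) z : open U -> U z ->
  (forall s, U s -> f s = g s) -> partial_x f z = partial_x g z.
Proof.
case: z => x t oU Uz fg; rewrite /partial_x /= !derive1E.
apply: near_eq_derive.
have H : \forall s \near (x, t), U s by apply: open_nbhs_nbhs; split.
near=> s; apply: fg; near: s.
exact: (cvg_pair (F := nbhs x) (f := id) (g := fun=> t) cvg_id (cvg_cst t) H).
Unshelve. all: by end_near.
Qed.

(** * Identification of the two solutions *)

Section TwoSolutions.
Context {R : realType}.
Variables (T delta M : R) (w0 alpha eta1 eta2 beta1 beta2 : R -> R) (q0 q1 : R).
Variables (w1 w2 : R * R -> R) (p1 p2 : R -> R).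
Hypothesis sol1 : fluid_particle_solution T w0 alpha eta1 q0 q1 w1 p1.
Hypothesis sol2 : fluid_particle_solution T w0 alpha eta2 q0 q1 w2 p2.
Hypothesis beta1_def : forall t, t \in `]0, T[ -> partial_x w1 (x, t) @[x --> (-1)^'+] --> beta1 t.
Hypothesis beta2_def : forall t, t \in `]0, T[ -> partial_x w2 (x, t) @[x --> (-1)^'+] --> beta2 t.
Hypotheses (d0 : 0 < delta < 1) (M0 : 0 < M).
Hypothesis p1_bound : forall t, t \in `]0, T[ -> `|p1 t| <= 1 - delta.
Hypothesis p2_bound : forall t, t \in `]0, T[ -> `|p2 t| <= 1 - delta.
Hypothesis left1 : classical_burgers (Qleft T p1) w1 (M + 1).
Hypothesis left2 : classical_burgers (Qleft T p2) w2 (M + 1).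
Hypothesis right1 : classical_burgers (Qright T p1) w1 (M + 1).
Hypothesis right2 : classical_burgers (Qright T p2) w2 (M + 1).
Hypothesis beta_eq : {in `]0, T[, beta1 =1 beta2}.

Let inT (t : R) : 0 < t < T -> t \in `]0, T[. Proof. by rewrite in_itv. Qed.
Let N0 : 0 <= M + 1. Proof. by rewrite addr_ge0 ?ltW. Qed.

(** The common data at x = -1 are Cauchy data for unique continuation. *)
Lemma equal_left z : 0 < z.2 < T -> -1 < z.1 < Num.min (p1 z.2) (p2 z.2) -> w1 z = w2 z.
Proof.
move=> zT zp.
have oU := openI (cb_open left1) (cb_open left2).
have c1 := classical_burgersS oU (@subIsetl _ _ _) left1.
have c2 := classical_burgersS oU (@subIsetr _ _ _) left2.
apply: (burgers_unique_right_of_curve (L := 1) (a := 0) (b := T) (c := fun=> -1)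
  (d := fun t => Num.min (p1 t) (p2 t)) N0 _ c1 c2) => //.
- move=> s; split=> [[/(QleftE d0 p1_bound)[-> /andP[-> h1]] /(QleftE d0 p2_bound)[_ /andP[_ h2]]]|].
    by rewrite lt_min h1 h2.
  rewrite lt_min => -[sT /andP[s1 /andP[h1 h2]]].
  by split; [apply/(QleftE d0 p1_bound)|apply/(QleftE d0 p2_bound)]; rewrite s1.
- by move=> t t' _ _; rewrite subrr normr0 mul1r.
- move=> t /inT tT; rewrite -(subrr (alpha t)).
  by apply: cvgB; [exact: (fps_left sol1)|exact: (fps_left sol2)].
- move=> t /inT tT; rewrite -(subrr (beta1 t)) {2}(beta_eq tT).
  by apply: cvgB; [exact: beta1_def|exact: beta2_def].
- move: zp; rewrite lt_min => /andP[z1 /andP[z2 z3]].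
  by split; [apply/(QleftE d0 p1_bound)|apply/(QleftE d0 p2_bound)]; rewrite z1.
Qed.

(** Both velocities are left traces of one and the same function, at p1 and at p2. *)
Lemma velocity_gap t : 0 < t < T ->
  `|derive1 p1 t - derive1 p2 t| <= (M + 1) * `|p1 t - p2 t|.
Proof.
move=> tT; have ti := inT tT.
have [_ v1 _] := fps_velocity sol1 ti; have [_ v2 _] := fps_velocity sol2 ti.
have /andP[m1 _] := path_lt1 d0 p1_bound tT; have /andP[m2 _] := path_lt1 d0 p2_bound tT.
have eqw x : -1 < x < p1 t -> x < p2 t -> w1 (x, t) = w2 (x, t).
  by move=> /andP[x1 x2] x3; apply: equal_left => //=; rewrite x1 lt_min x2.
have [p12|/ltW p21] := leP (p1 t) (p2 t).
  apply: (left_trace_gap m1 p12 N0 v1 v2) => [x /[dup] /andP[_ xp] h|x x'].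
    by apply: eqw h _; exact: lt_le_trans p12.
  exact: (horizontal_lipschitz d0 p2_bound left2).
rewrite distrC [X in _ * X]distrC.
apply: (left_trace_gap m2 p21 N0 v2 v1) => [x /andP[x1 xp]|x x'].
  by apply/esym; apply: eqw => //; rewrite x1 (lt_le_trans xp).
exact: (horizontal_lipschitz d0 p1_bound left1).
Qed.

Lemma equal_path t : 0 < t < T -> p1 t = p2 t.
Proof.
move=> tT; apply/eqP; rewrite -subr_eq0; apply/eqP.
apply: (@gronwall_zero R (fun t => p1 t - p2 t) (fun t => derive1 p1 t - derive1 p2 t) T (M + 1)) => //.
- by move=> s; apply: cvgB; [exact: (fps_p_cont sol1)|exact: (fps_p_cont sol2)].
- by rewrite (fps_p0 sol1) (fps_p0 sol2) subrr.
- move=> s sT; split; last exact: velocity_gap.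
  have [h1 _] := velocity_bound sol1 d0 p1_bound left1 sT.
  have [h2 _] := velocity_bound sol2 d0 p2_bound left2 sT.
  exact: is_deriveBf.
Qed.

Lemma equal_partial_x_left z : 0 < z.2 < T -> -1 < z.1 < p1 z.2 ->
  partial_x w1 z = partial_x w2 z.
Proof.
move=> zT zp; apply: (equal_partial_x (cb_open left1)); first exact/(QleftE d0 p1_bound).
move=> s /(QleftE d0 p1_bound)[sT /andP[s1 s2]]; apply: equal_left => //.
by rewrite s1 lt_min -(equal_path sT) s2.
Qed.

(** At almost every time the jump of w_x is the second derivative of the common path and
    the left limits of w_x agree by [equal_partial_x_left]; so do then the right ones. *)
Lemma flux_trace_dense t e : 0 < t < T -> 0 < e ->
  exists s, [/\ 0 < s < T, `|s - t| < e &
    (partial_x w1 (x, s) - partial_x w2 (x, s)) @[x --> (p1 s)^'+] --> 0].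
Proof.
move=> /andP[t0 tT] e0.
have [g1 wd1 j1] := fps_jump sol1; have [g2 wd2 j2] := fps_jump sol2.
pose r := Num.min e (Num.min (t / 2) ((T - t) / 2)).
have r0 : 0 < r by rewrite !lt_min e0 !divr_gt0// subr_gt0.
have [re [r1 r2]] : r <= e /\ r <= t / 2 /\ r <= (T - t) / 2.
  by have := lexx r; rewrite {2}/r !le_min => /and3P[].
have sub : (`[t - r, t + r]%classic : set R) `<=` `]0, T[.
  by move=> s; rewrite /= !in_itv /= => /andP[s1 s2]; apply/andP; split; move: s1 s2 r1 r2 t0 tT; lra.
have mU : measurable (`]0, T[%classic : set R) by exact: measurable_itv.
have p12 s : (`]0, T[%classic : set R) s -> p1 s = p2 s by rewrite /= in_itv /=; exact: equal_path.
have g12 := weak_deriv1_unique mU p12 wd1 wd2 sub.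
have rr : t - r < t + r by lra.
have ae : Filter (nbhs (almost_everywhere (@lebesgue_measure R))) by exact: ae_filter_ringOfSetsType.
have J := @filterI _ _ ae _ _ (@filterI _ _ ae _ _ j1 j2) g12.
have [s /andP[s1 s2] [[J1 J2] E]] := @ae_exists_itv R _ _ _ rr J.
have sT : 0 < s < T.
  have := sub s; rewrite /= !in_itv /=; apply; by rewrite !ltW.
exists s; split => //.
  by rewrite ltr_norml; apply/andP; split; move: s1 s2 re; lra.
have si := inT sT.
have [l1 [a1 [L1 A1 E1]]] := J1 si; have [l2 [a2 [L2 A2 E2]]] := J2 si.
rewrite -(equal_path sT) in L2 A2.
have /andP[m1 _] := path_lt1 d0 p1_bound sT.
have l12 : l1 = l2.
  suff L3 : partial_x w1 (x, s) @[x --> (p1 s)^'-] --> l2 by exact: (cvg_unique _ L1 L3).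
  apply: cvg_trans L2; apply: near_eq_cvg; near=> x; apply/esym; apply: equal_partial_x_left => //=.
  by apply/andP; split; near: x; [exact: nbhs_left_gt|exact: nbhs_left_lt].
have a12 : a1 - a2 = 0 by move: E1 E2; rewrite E ?s1// => ->; rewrite l12; lra.
by rewrite -a12; exact: cvgB.
Unshelve. all: by end_near.
Qed.

Lemma flux_gap_lipschitz x1 x2 t1 t2 z z' : box x1 x2 t1 t2 `<=` Qright T p1 ->
  box x1 x2 t1 t2 z -> box x1 x2 t1 t2 z' ->
  `|(partial_x w1 z - partial_x w2 z) - (partial_x w1 z' - partial_x w2 z')| <=
    2 * (M + 1) * (`|z.1 - z'.1| + `|z.2 - z'.2|).
Proof.
move=> B1 Bz Bz'.
have B2 : box x1 x2 t1 t2 `<=` Qright T p2.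
  move=> s /B1 /(QrightE d0 p1_bound)[sT h]; apply/(QrightE d0 p2_bound).
  by rewrite -(equal_path sT).
have [_ h1 _] := cb_lip right1 B1 Bz Bz'; have [_ h2 _] := cb_lip right2 B2 Bz Bz'.
rewrite [X in `|X|](_ : _ = (partial_x w1 z - partial_x w1 z') - (partial_x w2 z - partial_x w2 z')); last by ring.
apply: le_trans (ler_normB _ _) _; rewrite -mulrA mulr_natl mulr2n; exact: lerD.
Qed.

(** A point at distance h from the particle is compared with a point at the same x, at
    one of the times of [flux_trace_dense] that differs by less than a multiple of h.  The
    gap there is O(h) by the Lipschitz bound in x, and changes by O(h) in between. *)
Lemma flux_trace t : 0 < t < T ->
  (partial_x w1 (x, t) - partial_x w2 (x, t)) @[x --> (p1 t)^'+] --> 0.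
Proof.
move=> tT; have /andP[_ pt1] := path_lt1 d0 p1_bound tT.
have N1 : 0 < M + 1 by rewrite addr_gt0.
have N2 : 0 <= 2 * (M + 1) by rewrite mulr_ge0// ltW.
apply: (@right_limit0_of_linear R _ _ ((p1 t + 1) / 2) (3 * (M + 1) + 1)).
- by move: pt1; lra.
- by move: N1; lra.
move=> x /andP[px xm].
have x1 : x < 1 by move: xm pt1; lra.
pose h := x - p1 t; have h0 : 0 < h by rewrite subr_gt0.
pose q := h / (2 * (M + 1)); have q_gt0 : 0 < q by rewrite divr_gt0// mulr_gt0.
have Nq : (M + 1) * q = h / 2 by rewrite /q; field; rewrite gt_eqF.
have [s [sT st Ds]] := flux_trace_dense tT q_gt0.
have near_t r : 0 < r < T -> `|r - t| <= q -> `|p1 r - p1 t| <= h / 2.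
  move=> rT rq; apply: le_trans (path_lipschitz sol1 d0 p1_bound left1 rT tT) _.
  by rewrite -Nq ler_wpM2l// ltW.
have ps := near_t s sT (ltW st).
have pxs : p1 s < x by move: ps; rewrite ler_norml /h => /andP[_]; move: h0; rewrite /h; lra.
have vert : `|(partial_x w1 (x, t) - partial_x w2 (x, t)) - (partial_x w1 (x, s) - partial_x w2 (x, s))| <= h.
  have B : box x x (Num.min t s) (Num.max t s) `<=` Qright T p1.
    move=> z /boxP[/le_anti zx /andP[z1 z2]].
    have zT : 0 < z.2 < T.
      move: tT sT => /andP[t0 tT] /andP[s0 sT].
      by rewrite (lt_le_trans _ z1) ?lt_min ?t0// (le_lt_trans z2)// gt_max tT.
    have zq : `|z.2 - t| <= q.
      move: z1 z2 (ltW st); rewrite !ler_norml; case: (leP t s) => _ z1 z2 /andP[s1 s2];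
        by apply/andP; split; move: q_gt0; lra.
    have := near_t _ zT zq; rewrite ler_norml => /andP[_ h2].
    by apply/(QrightE d0 p1_bound); rewrite -zx x1; split => //; move: h2 h0; rewrite /h; lra.
  have B1 : box x x (Num.min t s) (Num.max t s) (x, t).
    by apply/boxP; rewrite /= !lexx ge_min le_max lexx.
  have B2 : box x x (Num.min t s) (Num.max t s) (x, s).
    by apply/boxP; rewrite /= !lexx ge_min le_max lexx !orbT.
  apply: le_trans (flux_gap_lipschitz B B1 B2) _.
  rewrite /= subrr normr0 add0r distrC (_ : h = 2 * (M + 1) * q); last by rewrite -mulrA Nq; field.
  exact: (ler_wpM2l N2 (ltW st)).
have horiz : `|partial_x w1 (x, s) - partial_x w2 (x, s)| <= 2 * (M + 1) * (x - p1 s).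
  apply: (right_limit_le pxs Ds) => x' /andP[px' x'x].
  have B : box x' x s s `<=` Qright T p1.
    move=> z /boxP[/andP[z1 z2] /le_anti zs]; apply/(QrightE d0 p1_bound); rewrite -zs.
    by split => //; rewrite (lt_le_trans px' z1) (le_lt_trans z2 x1).
  have B1 : box x' x s s (x, s) by apply/boxP; rewrite /= !lexx ltW.
  have B2 : box x' x s s (x', s) by apply/boxP; rewrite /= !lexx ltW.
  have := flux_gap_lipschitz B B1 B2; rewrite /= subrr normr0 addr0 => H.
  rewrite -[X in `|X|](subrK (partial_x w1 (x', s) - partial_x w2 (x', s))) addrC.
  apply: le_trans (ler_normD _ _) _; rewrite lerD2l; apply: (le_trans H).
  rewrite ger0_norm; last by rewrite subr_ge0 ltW.
  by apply: (ler_wpM2l N2); rewrite lerD2l lerN2 ltW.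
rewrite -[X in `|X|](subrK (partial_x w1 (x, s) - partial_x w2 (x, s))).
apply: le_trans (ler_normD _ _) _.
have xs : x - p1 s <= 3 / 2 * h.
  by move: ps; rewrite ler_norml => /andP[h1 _]; move: h1; rewrite /h; lra.
have := ler_wpM2l N2 xs.
move: vert horiz; rewrite -/h; lra.
Qed.

Lemma equal_right z : 0 < z.2 < T -> p1 z.2 < z.1 < 1 -> w1 z = w2 z.
Proof.
move=> zT zp.
have oU := openI (cb_open right1) (cb_open right2).
have c1 := classical_burgersS oU (@subIsetl _ _ _) right1.
have c2 := classical_burgersS oU (@subIsetr _ _ _) right2.
have N1 : 0 < M + 1 by rewrite addr_gt0.
have UE s : (Qright T p1 `&` Qright T p2) s <-> 0 < s.2 < T /\ p1 s.2 < s.1 < 1.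
  split=> [[/(QrightE d0 p1_bound)[-> ->] _]//|[sT h]].
  by split; [apply/(QrightE d0 p1_bound)|apply/(QrightE d0 p2_bound); rewrite -(equal_path sT)].
apply: (burgers_unique_right_of_curve (c := p1) (d := fun=> 1) N0 N1 c1 c2 UE).
- by move=> t t'; exact: (path_lipschitz sol1 d0 p1_bound left1).
- move=> t tT; have ti := inT tT.
  have [_ _ v1] := fps_velocity sol1 ti; have [_ _ v2] := fps_velocity sol2 ti.
  have E : derive1 p1 t = derive1 p2 t.
    apply/eqP; rewrite -subr_eq0 -normr_le0; have := velocity_gap tT.
    by rewrite (equal_path tT) subrr normr0 mulr0.
  rewrite -(subrr (derive1 p1 t)) {2}E; apply: cvgB; first exact: v1.
  by rewrite (equal_path tT).
- exact: flux_trace.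
- exact/UE.
Qed.

Lemma equal_right_boundary : {in `]0, T[, eta1 =1 eta2}.
Proof.
move=> t ti; have tT : 0 < t < T by move: ti; rewrite in_itv.
have h1 := fps_right sol1 ti; have h2 := fps_right sol2 ti.
have /andP[_ m1] := path_lt1 d0 p1_bound tT.
suff h3 : w1 (x, t) @[x --> 1^'-] --> eta2 t by exact: (cvg_unique _ h1 h3).
apply: cvg_trans h2; apply: near_eq_cvg; near=> x; apply/esym; apply: equal_right => //=.
by apply/andP; split; near: x; [exact: nbhs_left_gt|exact: nbhs_left_lt].
Unshelve. all: by end_near.
Qed.

End TwoSolutions.

Unset Implicit Arguments.

Theorem corollary4p2 (R : realType) (T : R) (w0 alpha eta1 eta2 : R -> R)
  (q0 q1 : R) (w1 w2 : R * R -> R) (p1 p2 beta1 beta2 : R -> R) (delta M : R)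
  (T_gt0 : 0 < T)
  (w0_L2 : in_L2 `]-1, 1[ w0)
  (alpha_cont : {within `[0, T], continuous alpha})
  (q0_lt1 : `|q0| < 1)
  (eta1_cont : {within `[0, T], continuous eta1})
  (eta2_cont : {within `[0, T], continuous eta2})
  (sol1 : fluid_particle_solution T w0 alpha eta1 q0 q1 w1 p1)
  (sol2 : fluid_particle_solution T w0 alpha eta2 q0 q1 w2 p2)
  (beta1_def : forall t, t \in `]0, T[ ->
     partial_x w1 (x, t) @[x --> (-1)^'+] --> beta1 t)
  (beta2_def : forall t, t \in `]0, T[ ->
     partial_x w2 (x, t) @[x --> (-1)^'+] --> beta2 t)
  (delta_itv : 0 < delta < 1)
  (M_gt0 : 0 < M)
  (p1_bound : forall t, t \in `]0, T[ -> `|p1 t| <= 1 - delta)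
  (p2_bound : forall t, t \in `]0, T[ -> `|p2 t| <= 1 - delta)
  (w1_left : (Wkoo_norm 2 (Qleft T p1) w1 <= M%:E)%E)
  (w1_right : (Wkoo_norm 2 (Qright T p1) w1 <= M%:E)%E)
  (w2_left : (Wkoo_norm 2 (Qleft T p2) w2 <= M%:E)%E)
  (w2_right : (Wkoo_norm 2 (Qright T p2) w2 <= M%:E)%E)
  (beta_eq : {in `]0, T[, beta1 =1 beta2}) :
  {in `]0, T[, eta1 =1 eta2}.
Proof.
have left1 := classical_on_side sol1 M_gt0 (@subIsetl _ _ _ : Qleft T p1 `<=` Qdom T p1) w1_left.
have left2 := classical_on_side sol2 M_gt0 (@subIsetl _ _ _ : Qleft T p2 `<=` Qdom T p2) w2_left.
have right1 := classical_on_side sol1 M_gt0 (@subIsetl _ _ _ : Qright T p1 `<=` Qdom T p1) w1_right.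
have right2 := classical_on_side sol2 M_gt0 (@subIsetl _ _ _ : Qright T p2 `<=` Qdom T p2) w2_right.
exact: (equal_right_boundary sol1 sol2 beta1_def beta2_def delta_itv M_gt0 p1_bound p2_bound
  left1 left2 right1 right2 beta_eq).
Qed.
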